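(* Let $1<q<2$, let $\alpha>0$ and $\mu>0$, let $J\in L^1(\mathbb{R})$ be a nonnegative even function with $\int_{\mathbb{R}}J\,dx=1$, and let $\varphi\in L^1(\mathbb{R})$ be nonnegative. Then the solution $u^\mu$ of $$u^\mu_t+|u^\mu|^{q-1}(u^\mu)_x=\alpha(J\ast u^\mu-u^\mu)+\mu u^\mu_{xx},\quad x\in\mathbb{R},\ t>0,\qquad u^\mu(0)=\varphi,$$ satisfies $$\big((u^\mu)^{q-1}\big)_x(t,x)\le\frac1t,\quad\forall t>0,\ \text{a.e. }x\in\mathbb{R}.$$
   Context: Here $\ast$ is convolution in $x$. The solution $u^\mu$ is the unique solution in $C([0,\infty),L^1(\mathbb{R}))$; it satisfies $u^\mu\in C((0,\infty),W^{2,p}(\mathbb{R}))\cap C^1((0,\infty),L^p(\mathbb{R}))$ for all $1<p<\infty$, and it is nonnegative when $\varphi$ is nonnegative. *)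

(* Defs.v *)
From HB Require Import structures.
From mathcomp Require Import all_boot all_order all_algebra.
From mathcomp Require Import all_classical all_reals all_analysis.
Set Implicit Arguments.
Unset Strict Implicit.
Unset Printing Implicit Defensive.
Import Order.TTheory GRing.Theory Num.Theory.
Import numFieldNormedType.Exports.
Local Open Scope classical_set_scope.
Local Open Scope ring_scope.

(* Elements of L^p(R) are handled through representatives R -> R: membership
   is [f \in Lfun lebesgue_measure p%:E], and identities hold a.e.  A curve
   with values in L^p(R) is v : R -> R -> R, with [v t] the function of x at
   time t; its values at times outside the interval considered are irrelevant.
   Nothing below distinguishes two a.e. equal representatives of [v t]. *)

Definition Lp_dist (R : realType) (p : R) (f g : R -> R) : \bar R :=
  Lnorm (@lebesgue_measure R) p%:E (EFin \o (f \- g)).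

(* v \in C(I, L^p(R)) *)
Definition continuous_Lp (R : realType) (p : R) (I : set R)
    (v : R -> R -> R) : Prop :=
  (forall t, I t -> v t \in Lfun (@lebesgue_measure R) p%:E) /\
  (forall t, I t -> Lp_dist p (v s) (v t) @[s --> within I (nbhs t)] --> 0%E).

(* Norm convergence in L^p(R) of the difference quotients of v at the points
   of I, meant for I open. *)
Definition is_derive_Lp (R : realType) (p : R) (I : set R)
    (v v' : R -> R -> R) : Prop :=
  forall t, I t ->
    Lp_dist p (fun x => h^-1 * (v (t + h) x - v t x)) (v' t)
      @[h --> 0^'] --> 0%E.

(* v \in C^1(I, L^p(R)) with time derivative v' *)
Definition C1_Lp (R : realType) (p : R) (I : set R)
    (v v' : R -> R -> R) : Prop :=
  [/\ continuous_Lp p I v, continuous_Lp p I v' & is_derive_Lp p I v v'].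

Definition test_function (R : realType) (phi : R -> R) : Prop :=
  (forall (n : nat) (x : R), derivable (derive1n n phi) x 1) /\
  compact (closure [set x | phi x != 0]).

Definition is_weak_derivative (R : realType) (f g : R -> R) : Prop :=
  [/\ locally_integrable setT f, locally_integrable setT g &
      forall phi : R -> R, test_function phi ->
        \int[@lebesgue_measure R]_x (f x * derive1 phi x) =
        - \int[@lebesgue_measure R]_x (g x * phi x)].

(* v \in C(I, W^{2,p}(R)) with first and second weak derivatives vx, vxx; the
   W^{2,p} norm is the sum of the L^p norms of the function and of its two
   derivatives. *)
Definition continuous_W2p (R : realType) (p : R) (I : set R)
    (v vx vxx : R -> R -> R) : Prop :=
  (forall t, I t -> is_weak_derivative (v t) (vx t) /\
                    is_weak_derivative (vx t) (vxx t)) /\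
  [/\ continuous_Lp p I v, continuous_Lp p I vx & continuous_Lp p I vxx].

Definition convolution (R : realType) (f g : R -> R) (x : R) : R :=
  \int[@lebesgue_measure R]_y (f (x - y) * g y).

(* Solutions of
     u_t + |u|^(q-1) u_x = alpha (J * u - u) + mu u_xx,   u(0) = phi,
   in C([0,oo), L^1) that belong to C((0,oo), W^{2,p}) and C^1((0,oo), L^p)
   for all 1 < p < oo, the equation being an identity in L^p(R), i.e. a.e. in
   x, at each t > 0.  Limits in different L^p spaces agree a.e., so a single
   ut (as well as ux, uxx) serves all the exponents p.  No sign condition is
   put on u. *)
Definition is_solution (R : realType) (q alpha mu : R) (J phi : R -> R)
    (u : R -> R -> R) : Prop :=
  [/\ continuous_Lp 1 `[0, +oo[ u,
      {ae @lebesgue_measure R, forall x, u 0 x = phi x} &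
      exists ut ux uxx : R -> R -> R,
        (forall p : R, 1 < p -> continuous_W2p p `]0, +oo[ u ux uxx /\
                                C1_Lp p `]0, +oo[ u ut) /\
        (forall t : R, 0 < t ->
           {ae @lebesgue_measure R, forall x,
              ut t x + `|u t x| `^ (q - 1) * ux t x =
              alpha * (convolution J (u t) x - u t x) + mu * uxx t x})].

(* Main.v *)
(* Integrating the equation in x over an interval removes the need for regularity
   of u_t and u_xx: the distribution function P(t,x), the integral of u(t,.) over
   (-oo,x], satisfies classically
     d/dt (P(t,b) - P(t,a)) = - [F(u)]_a^b + alpha [J * P - P]_a^b + mu [u_x]_a^b,
   F being the primitive of |s|^(q-1), once u is replaced by its C^1 representative.
   A maximum principle for P(t,y) - P(t,x) on x <= y shows that u >= 0.

   The one-sided estimate comes from doubling the variables.  Put p = q - 1 and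
   v = (eps + m)^p, where m(t,x) is the mean of u(t,.) over [x, x + d], and consider
   a positive maximum over x >= y of
     (t - tau) (v(t,x) - v(t,y)) - (x - y) - eta (t - tau).
   There v_x = v_y = 1 / (t - tau), the diffusive terms have a sign, the nonlocal
   terms have a sign by convexity of r^(1/p), and the transport terms yield
   v(t,y) - v(t,x) up to an error vanishing with d, which cancels the derivative of
   the factor t - tau and leaves -eta: a contradiction.  Letting d, eta and tau go to
   0, t ((eps + u)^p(t,x) - (eps + u)^p(t,y)) <= x - y.  As eps goes to 0, the upper
   bound 1/t on the derivatives also bounds their absolute values in L^1_loc, and
   they converge to the weak derivative of u^p. *)

Require Import Defs.
From HB Require Import structures.
From mathcomp Require Import all_boot all_order all_algebra.
From mathcomp Require Import all_classical all_reals all_analysis.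
From mathcomp Require Import measurable_realfun ring lra.
Set Implicit Arguments.
Unset Strict Implicit.
Unset Printing Implicit Defensive.
Import Order.TTheory GRing.Theory Num.Theory.
Import numFieldNormedType.Exports.
Local Open Scope classical_set_scope.
Local Open Scope ring_scope.

(** * Integrals and primitives *)

Section primitive.
Context {R : realType}.
Notation mu := (@lebesgue_measure R).
Implicit Types (f g F : R -> R) (a b c x y : R).

(** The obstacle is regularity: [u] comes with no classical time derivative and no continuous second
    space derivative, so no maximum principle applies to it directly. A mean over a window of width
    [d] has all the derivatives needed, at the price of a flux evaluated at the ends of the window.
    That error is [O((L * d) ^ p)] with [L] a bound on [u_x], available only for times at least
    [tau > 0]; so [tau] and [eta] are fixed before [d].

    The shift [eps] is forced by [p < 1], since [r ^ p] is singular at 0. It separates the transport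
    speed [m ^ p] from [v = (eps + m) ^ p]; monotonicity of [(r - eps) ^ p - r ^ p] makes the
    discrepancy favourable.

    Attainment differs in the two arguments. For the sign, one point may escape to infinity while
    the difference stays negative, hence a small bump is subtracted. For the one-sided estimate, a
    positive value forces a mean above [eta ^ (1 / p)] at the leading point, and the term [x - y]
    bounds the separation, so uniformly small tails give compactness. *)

Lemma ae_imply (P Q : R -> Prop) : (forall x, P x -> Q x) ->
  {ae mu, forall x, P x} -> {ae mu, forall x, Q x}.
Proof.
by move=> PQ; apply: filterS PQ; exact: (ae_filter_ringOfSetsType mu).
Qed.

Lemma ae_imply2 (P Q S : R -> Prop) : (forall x, P x -> Q x -> S x) ->
  {ae mu, forall x, P x} -> {ae mu, forall x, Q x} -> {ae mu, forall x, S x}.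
Proof.
by move=> PQ; apply: filterS2 PQ; exact: (ae_filter_ringOfSetsType mu).
Qed.

Definition locint g := forall a b, mu.-integrable `[a, b] (EFin \o g).

Lemma locally_integrable_locint g : locally_integrable setT g -> locint g.
Proof.
move=> [mg _ ig] a b; apply/integrableP; split.
  by apply/measurable_EFinP; apply: measurable_funS mg.
by apply: ig => //; exact: segment_compact.
Qed.

Lemma locint_locally_integrable g :
  measurable_fun setT g -> locint g -> locally_integrable setT g.
Proof.
move=> mg ig; split => //; first exact: openT.
move=> K _ cK; have [M [_ /(_ (M + 1))]] := compact_bounded cK.
rewrite ltrDl ltr01 => /(_ isT) KM.
have KS : K `<=` `[- (M + 1), M + 1]%classic.
  by move=> x /KM /=; rewrite in_itv/= -ler_norml.
have /integrableP[_] := ig (- (M + 1)) (M + 1).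
apply: le_lt_trans; apply: ge0_subset_integral => //.
- exact: compact_measurable.
- apply/measurable_EFinP; apply: measurableT_comp => //.
  exact: measurable_funS mg.
Qed.

Lemma integrable_locint g : mu.-integrable setT (EFin \o g) -> locint g.
Proof. by move=> ig a b; apply: integrableS ig. Qed.

Lemma continuous_locint g : continuous g -> locint g.
Proof.
move=> cg a b; apply: continuous_compact_integrable; first exact: segment_compact.
exact: continuous_subspaceT.
Qed.

Lemma integrableM_bounded (D : set R) f g (M : R) : measurable D ->
  mu.-integrable D (EFin \o f) -> measurable_fun D g ->
  (forall x, D x -> `|g x| <= M) -> mu.-integrable D (EFin \o (fun x => f x * g x)).
Proof.
move=> mD /[dup] intf /integrableP[/measurable_EFinP mf _] mg gM.
have := @integrableZl _ _ _ mu _ mD M _ intf; apply: le_integrable => //.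
  exact/measurable_EFinP/measurable_funM.
move=> x Dx /=; rewrite lee_fin !normrM mulrC ler_wpM2r//.
exact: le_trans (gM x Dx) (ler_norm _).
Qed.

Lemma integrableB_Rfun (D : set R) f g : measurable D ->
  mu.-integrable D (EFin \o f) -> mu.-integrable D (EFin \o g) ->
  mu.-integrable D (EFin \o (fun x => f x - g x)).
Proof. by move=> mD; exact: integrableB. Qed.

Lemma integrableD_Rfun (D : set R) f g : measurable D ->
  mu.-integrable D (EFin \o f) -> mu.-integrable D (EFin \o g) ->
  mu.-integrable D (EFin \o (fun x => f x + g x)).
Proof. by move=> mD; exact: integrableD. Qed.

Lemma integrableZ_Rfun (D : set R) (c : R) f : measurable D ->
  mu.-integrable D (EFin \o f) -> mu.-integrable D (EFin \o (fun x => c * f x)).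
Proof. by move=> mD; exact: integrableZl. Qed.

Lemma integrable_norm_Rfun (D : set R) f :
  mu.-integrable D (EFin \o f) -> mu.-integrable D (EFin \o (fun x => `|f x|)).
Proof. by move=> /integrable_abse. Qed.

Lemma continuous_measurable f (D : set R) : continuous f -> measurable D ->
  measurable_fun D f.
Proof.
by move=> cf mD; apply: measurable_funS (continuous_measurable_fun cf).
Qed.

Lemma locintM_bounded f g (M : R) : locint f -> measurable_fun setT g ->
  (forall x, `|g x| <= M) -> locint (fun x => f x * g x).
Proof.
move=> lf mg gM a b; apply: (@integrableM_bounded _ _ _ M) => //.
exact: measurable_funS mg.
Qed.

Lemma locintB f g : locint f -> locint g -> locint (fun x => f x - g x).
Proof. by move=> lf lg a b; exact: integrableB_Rfun. Qed.

Lemma ae_Rintegral_eq (D : set R) f g : measurable D ->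
  measurable_fun D f -> measurable_fun D g ->
  {ae mu, forall x, f x = g x} -> \int[mu]_(x in D) f x = \int[mu]_(x in D) g x.
Proof.
move=> mD mf mg fg; rewrite /Rintegral; congr fine.
apply: ae_eq_integral => //; [exact/measurable_EFinP..|].
by apply: ae_imply fg => x -> _.
Qed.

Lemma Rintegral_split g a b c : locint g -> a <= b -> b <= c ->
  \int[mu]_(x in `[a, c]) g x =
  \int[mu]_(x in `[a, b]) g x + \int[mu]_(x in `[b, c]) g x.
Proof.
move=> ig ab bc.
have -> : \int[mu]_(x in `[b, c]) g x = \int[mu]_(x in `]b, c]) g x.
  rewrite Rintegral_itv_obnd_cbnd//.
  by apply: integrableS (ig b c) => //; apply: subset_itvr; rewrite bnd_simp.
by rewrite -(@Rintegral_itvB _ g (BLeft a) (BRight c) b) ?bnd_simp// addrC subrK.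
Qed.

(** The oriented integral from 0 to [x]: unless [x = 0], one of the two segments is empty. *)
Definition primitive g x :=
  \int[mu]_(y in `[0, x]) g y - \int[mu]_(y in `[x, 0]) g y.

Lemma primitiveB g a b : locint g -> a <= b ->
  primitive g b - primitive g a = \int[mu]_(x in `[a, b]) g x.
Proof.
move=> ig ab; rewrite /primitive.
have E u v : v <= u -> \int[mu]_(y in `[u, v]) g y = 0.
  rewrite le_eqVlt => /predU1P[->|vu].
    by rewrite set_itv1 Rintegral_set1.
  by rewrite set_itv_ge ?Rintegral_set0// bnd_simp -ltNge.
have [a0|a0] := leP 0 a.
  rewrite (E b 0) ?(le_trans a0)// (E a 0)// (Rintegral_split ig a0 ab); lra.
have [b0|b0] := leP 0 b.
  rewrite (E b 0)// (E 0 a) ?ltW// (Rintegral_split ig (ltW a0) b0); lra.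
by rewrite (E 0 b) ?ltW// (E 0 a) ?ltW// (Rintegral_split ig ab (ltW b0)); lra.
Qed.

Lemma is_derive_primitive g x : locint g -> {for x, continuous g} ->
  is_derive x 1 (primitive g) (g x).
Proof.
move=> ig cg; pose a := x - 1.
have xx1 : x < x + 1 by rewrite ltrDl.
have ax : a < x by rewrite gtrBl.
have := continuous_FTC1_closed xx1 (ig a (x + 1)) ax cg.
set G := fun _ => _; move=> [dG G'].
have nG : \forall y \near x, (cst (primitive g a) + G) y = primitive g y.
  near=> y; rewrite /G /= fctE -(@primitiveB g a y)//; first by rewrite /cst; lra.
  by near: y; apply: (lt_le_nbhsr) => /=; rewrite /a gtrBl.
have d2 : is_derive x 1 G (g x) by rewrite -G' derive1E; exact: derivableP.
have d1 : is_derive x 1 (cst (primitive g a) + G) (g x).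
  by rewrite -[g x]add0r; apply: is_deriveD.
exact: near_eq_is_derive nG d1.
Unshelve. all: by end_near. Qed.

(** Remainder form of the derivative: it covers [h = 0] and involves no quotient, so estimates on
    increments apply directly. *)
Lemma is_deriveP f x (d : R) : is_derive x 1 f d <->
  forall e : R, 0 < e -> exists2 r : R, 0 < r &
    forall h : R, `|h| < r -> `|f (x + h) - f x - d * h| <= e * `|h|.
Proof.
have dE : (fun h : R => h^-1 *: (f (h *: (1 : R) + x) - f x)) =
    (fun h : R => h^-1 * (f (x + h) - f x)).
  apply: funext => h; have -> // : h *: (1 : R) + x = x + h.
  by rewrite addrC; congr (_ + _); exact: mulr1.
split=> [[df fE] e e0|H].
  have : (h^-1 * (f (x + h) - f x)) @[h --> 0^'] --> d.
    by rewrite -fE -dE.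
  move/cvgrPdist_le => /(_ e e0) [r /= r0 Hr].
  exists r => // h hr; have [->|h0] := eqVneq h 0.
    by rewrite addr0 subrr mulr0 subrr normr0 mulr0.
  have := Hr h; rewrite /ball_/= sub0r normrN => /(_ hr h0) Hh.
  have -> : f (x + h) - f x - d * h = - ((d - h^-1 * (f (x + h) - f x)) * h).
    by rewrite mulrBl mulrAC mulVf// mul1r; ring.
  by rewrite normrN normrM ler_wpM2r.
have C : (h^-1 * (f (x + h) - f x)) @[h --> 0^'] --> d.
  apply/cvgrPdist_le => e e0; have [r r0 Hr] := H e e0.
  exists r => //= h; rewrite /ball_/= sub0r normrN => hr h0.
  rewrite -(@ler_pM2r _ `|h|) ?normr_gt0//.
  rewrite -normrM mulrBl mulrAC mulVf// mul1r.
  by rewrite distrC Hr.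
rewrite -dE in C.
by apply: DeriveDef; [apply/cvg_ex; exists d|exact/cvg_lim].
Qed.

Lemma is_derive_continuous f x (f' : R) : is_derive x 1 f f' -> {for x, continuous f}.
Proof.
by move=> [df _]; apply/differentiable_continuous/derivable1_diffP.
Qed.

Lemma Rintegral_derive F f a b : a <= b ->
  (forall x, is_derive x 1 F (f x)) -> continuous f ->
  \int[mu]_(x in `[a, b]) f x = F b - F a.
Proof.
rewrite le_eqVlt => /predU1P[<-|ab] dF cf.
  by rewrite set_itv1 Rintegral_set1 subrr.
rewrite /Rintegral (@continuous_FTC2 _ f F)//.
- exact: continuous_subspaceT.
- split.
  + by move=> x _; apply: ex_derive.
  + by apply/cvg_at_right_filter; apply: (is_derive_continuous (dF a)).
  + by apply/cvg_at_left_filter; apply: (is_derive_continuous (dF b)).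
- by move=> x _; rewrite derive1E; apply: derive_val.
Qed.

End primitive.

(** * Smooth test functions *)

Section derivation_rules.
Context {R : realType}.
Implicit Types (f g : R -> R) (x a b c : R).

Lemma der_eq f x a b : is_derive x 1 f a -> a = b -> is_derive x 1 f b.
Proof. by move=> + <-. Qed.

Lemma der_cst c x : is_derive x 1 (fun _ : R => c) 0.
Proof. exact: is_derive_cst. Qed.

Lemma der_id x : is_derive x 1 (fun y : R => y) 1.
Proof. exact: is_derive_id. Qed.

Lemma derD f g x a b : is_derive x 1 f a -> is_derive x 1 g b ->
  is_derive x 1 (fun y => f y + g y) (a + b).
Proof. exact: is_deriveD. Qed.

Lemma derN f x a : is_derive x 1 f a -> is_derive x 1 (fun y => - f y) (- a).
Proof. exact: is_deriveN. Qed.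

Lemma derB f g x a b : is_derive x 1 f a -> is_derive x 1 g b ->
  is_derive x 1 (fun y => f y - g y) (a - b).
Proof. exact: is_deriveB. Qed.

Lemma derM f g x a b : is_derive x 1 f a -> is_derive x 1 g b ->
  is_derive x 1 (fun y => f y * g y) (a * g x + f x * b).
Proof.
move=> fa gb; apply: der_eq (is_deriveM fa gb) _.
by rewrite -![_ *: _]/(_ * _); ring.
Qed.

Lemma derZ c f x a : is_derive x 1 f a ->
  is_derive x 1 (fun y => c * f y) (c * a).
Proof. exact: is_deriveZ. Qed.

Lemma der_comp f g x a b : is_derive (g x) 1 f a -> is_derive x 1 g b ->
  is_derive x 1 (fun y => f (g y)) (a * b).
Proof. exact: is_derive1_comp. Qed.

Lemma der_affine f c b x a : is_derive (c * x + b) 1 f a ->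
  is_derive x 1 (fun y => f (c * y + b)) (a * c).
Proof.
move=> fa; apply: (der_comp (g := fun y => c * y + b)) => //.
apply: der_eq (derD (derZ c (der_id x)) (der_cst b x)) _; ring.
Qed.

Lemma der_powR f x a b : 0 < f x -> is_derive x 1 f a ->
  is_derive x 1 (fun y => f y `^ b) (b * f x `^ (b - 1) * a).
Proof.
move=> f0 fa; apply: (@der_comp (fun y => y `^ b) f) => //.
exact: is_derive1_powR.
Qed.

Lemma derX n f x a : is_derive x 1 f a ->
  is_derive x 1 (fun y => f y ^+ n) (n%:R * f x ^+ n.-1 * a).
Proof.
move=> fa; have -> : (fun y => f y ^+ n) = f ^+ n.
  by apply/funext => y; rewrite exprfctE.
exact: is_deriveX.
Qed.

Lemma derV f x a : f x != 0 -> is_derive x 1 f a ->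
  is_derive x 1 (fun y => (f y)^-1) (- (f x) ^- 2 * a).
Proof.
move=> f0 [da <-].
apply: DeriveDef; first exact: derivableV.
by rewrite deriveV.
Qed.

End derivation_rules.

Section smooth.
Context {R : realType}.
Notation mu := (@lebesgue_measure R).
Implicit Types (f g : R -> R) (x a b c : R).

Fixpoint Cn n f := if n is m.+1 then
  exists2 f' : R -> R, (forall x, is_derive x 1 f (f' x)) & Cn m f' else True.

Lemma CnD n f g : Cn n f -> Cn n g -> Cn n (fun x => f x + g x).
Proof.
elim: n f g => // n IH f g [f' df cf] [g' dg cg].
by exists (fun x => f' x + g' x); [move=> x; exact: derD|exact: IH].
Qed.

Lemma CnZ n c f : Cn n f -> Cn n (fun x => c * f x).
Proof.
elim: n f => // n IH f [f' df cf].
by exists (fun x => c * f' x); [move=> x; exact: derZ|exact: IH].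
Qed.

Lemma CnW n f : Cn n.+1 f -> Cn n f.
Proof.
by elim: n f => // n IH f [f' df cf]; exists f' => //; exact: IH.
Qed.

Lemma CnM n f g : Cn n f -> Cn n g -> Cn n (fun x => f x * g x).
Proof.
elim: n f g => // n IH f g cnf cng; have [f' df cf] := cnf; have [g' dg cg] := cng.
exists (fun x => f' x * g x + f x * g' x); first by move=> x; exact: derM.
by apply: CnD; apply: IH => //; exact: CnW.
Qed.

Lemma Cn_affine n f a b : Cn n f -> Cn n (fun x => f (a * x + b)).
Proof.
elim: n f => // n IH f [f' df cf].
exists (fun x => a * f' (a * x + b)); last exact/CnZ/IH.
by move=> x; rewrite mulrC; exact: der_affine.
Qed.

Lemma Cn_derivable f : (forall n, Cn n f) -> forall n x, derivable (derive1n n f) x 1.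
Proof.
move=> cf n x; move: (cf n.+1) => {cf}; elim: n f => [|n IH] f.
  by move=> [f' df _]; exact: ex_derive.
move=> [f' df cf]; rewrite /derive1n iterSr.
suff -> : derive1 f = f' by exact: IH.
by apply/funext => y; rewrite derive1E; exact: derive_val.
Qed.

(* [x^-k * exp (- 1 / x)], extended by [0]: a family stable under derivation up to
   linear combinations. *)
Definition psi k x := if 0 < x then x^-1 ^+ k * expR (- x^-1) else 0.

Lemma der_psi k x : is_derive x 1 (psi k) (psi k.+2 x - k%:R * psi k.+1 x).
Proof.
have [x0|x0|<-] := ltgtP 0 x.
- have n : \forall y \near x, y^-1 ^+ k * expR (- y^-1) = psi k y.
    by near=> y; rewrite /psi ifT//; near: y; exact: lt_nbhsr.
  apply: near_eq_is_derive n _.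
  have xn0 : x != 0 by rewrite gt_eqF.
  have dV := derV xn0 (der_id x).
  apply: der_eq (derM (derX k dV) (der_comp (is_derive_expR _) (derN dV))) _.
  rewrite /psi x0.
  case: k => [|k] /=; rewrite ?exprS ?expr0; field; exact: xn0.
- have n : \forall y \near x, 0 = psi k y.
    by near=> y; rewrite /psi ifF//; apply/negbTE; rewrite -leNgt ltW//; near: y; exact: lt_nbhsl.
  apply: near_eq_is_derive n _.
  by rewrite /psi !ltNge (ltW x0)/= mulr0 subr0; exact: der_cst.
(* At 0, [exp (1 / h) >= h^-(k+2) / (k+2)!] gives [psi k h <= (k+2)! * h^2], whence the radius
   [e / (k+2)!]. *)
rewrite /psi ltxx mulr0 subr0; apply/is_deriveP => e e0.
exists (e / k.+2`!%:R); first by rewrite divr_gt0// ltr0n fact_gt0.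
move=> h he; rewrite add0r mul0r ltxx !subr0.
have [h0|h0] := ltP 0 h; last by rewrite normr0 mulr_ge0// ltW.
rewrite ger0_norm; last by rewrite mulr_ge0// ?expR_ge0// exprn_ge0// invr_ge0 ltW.
rewrite gtr0_norm// in he; rewrite (gtr0_norm h0).
have h1 : 0 < h^-1 by rewrite invr_gt0.
have := expR_ge1Dxn k.+1 (ltW h1) => E.
have {E} : h^-1 ^+ k.+2 / k.+2`!%:R <= expR h^-1 by lra.
rewrite expRN ler_pdivrMr ?ltr0n ?fact_gt0// => E.
rewrite ler_pdivrMr ?expR_gt0//.
have -> : h^-1 ^+ k = h ^+ 2 * h^-1 ^+ k.+2.
  by rewrite !exprS; field; rewrite gt_eqF.
apply: le_trans (ler_wpM2l _ E) _; first by rewrite exprn_ge0 ?ltW.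
rewrite expr2 -mulrA mulrA [e * h]mulrC -!mulrA ler_pM2l// mulrA mulrAC.
rewrite [leRHS]mulrC [leLHS]mulrC ler_pM2l ?expR_gt0//.
by rewrite -ler_pdivlMr ?ltr0n ?fact_gt0// ltW.
Unshelve. all: by end_near. Qed.

Lemma Cn_psi n k : Cn n (psi k).
Proof.
elim: n k => // n IH k.
exists (fun x => psi k.+2 x + (- k%:R) * psi k.+1 x).
  by move=> x; rewrite mulNr; exact: der_psi.
by apply: CnD => //; exact: CnZ.
Qed.

(** The classical bump [exp (- 1 / x) exp (- 1 / (1 - x))] on []0, 1[], left unnormalised: its mass
    [step 1] is carried along and cancelled in the end. *)
Definition sbump x := psi 0 x * psi 0 ((-1) * x + 1).

Lemma Cn_sbump n : Cn n sbump.
Proof. by apply: CnM; [|apply: (Cn_affine (f := psi 0))]; exact: Cn_psi. Qed.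

Lemma psi_ge0 x : 0 <= psi 0 x.
Proof. by rewrite /psi; case: ifP => // _; rewrite expr0 mul1r expR_ge0. Qed.

Lemma psi_le1 x : psi 0 x <= 1.
Proof.
rewrite /psi; case: ifP => // x0; rewrite expr0 mul1r expR_le1.
by rewrite oppr_le0 invr_ge0 ltW.
Qed.

Lemma sbump_ge0 x : 0 <= sbump x. Proof. by rewrite mulr_ge0// psi_ge0. Qed.

Lemma sbump_le1 x : sbump x <= 1.
Proof. by rewrite /sbump -[1]mulr1 ler_pM// ?psi_ge0 ?psi_le1// mulr1 psi_le1. Qed.

Lemma sbump0 x : ~~ (0 < x < 1) -> sbump x = 0.
Proof.
rewrite /sbump /psi mulN1r addrC subr_gt0.
by case: (ltP 0 x); rewrite ?mul0r//=; case: (ltP x 1); rewrite ?mulr0.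
Qed.

Lemma sbump_half : 0 < sbump 2^-1.
Proof.
rewrite /sbump; have -> : -1 * 2^-1 + 1 = 2^-1 :> R by field.
by rewrite /psi ifT ?invr_gt0// expr0 mul1r mulr_gt0// expR_gt0.
Qed.

Lemma continuous_sbump : continuous sbump.
Proof. by move=> x; have [f' df _] := Cn_sbump 1; exact: is_derive_continuous (df x). Qed.

Definition step := primitive sbump.

Lemma der_step x : is_derive x 1 step (sbump x).
Proof.
by apply: is_derive_primitive;
  [exact/continuous_locint/continuous_sbump|exact: continuous_sbump].
Qed.

Lemma Cn_step n : Cn n step.
Proof. by case: n => // n; exists sbump => [x|]; [exact: der_step|exact: Cn_sbump]. Qed.

Lemma step_nondecreasing : {homo step : x y / x <= y}.
Proof.
move=> x y xy; rewrite -subr_ge0 primitiveB//; last exact/continuous_locint/continuous_sbump.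
by apply: Rintegral_ge0 => z _; exact: sbump_ge0.
Qed.

Lemma step_le0 x : x <= 0 -> step x = 0.
Proof.
have I0 : step 0 = 0 by rewrite /step /primitive subrr.
move=> x0; apply/eqP; rewrite -oppr_eq0 -[X in X == _]add0r -{1}I0 primitiveB//;
  last exact/continuous_locint/continuous_sbump.
apply/eqP; rewrite -[RHS](Rintegral_set0 mu (fun _ => 0)).
rewrite (@eq_Rintegral _ _ _ _ _ (cst 0)) => [|y].
  by rewrite Rintegral_set0 Rintegral_cst// mul0r.
by rewrite inE/= in_itv/= => /andP[_ y0]; rewrite sbump0// ltNge y0.
Qed.

Lemma step_ge1 x : 1 <= x -> step x = step 1.
Proof.
move=> x1; apply/eqP; rewrite -subr_eq0 primitiveB//; last exact/continuous_locint/continuous_sbump.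
apply/eqP; rewrite (@eq_Rintegral _ _ _ _ _ (cst 0)) => [|y].
  by rewrite Rintegral_cst// mul0r.
by rewrite inE/= in_itv/= => /andP[y1 _]; rewrite sbump0// [y < 1]ltNge y1 andbF.
Qed.

(** Were [step 1] zero, the monotone [step] would vanish identically, and so would its derivative
    [sbump] at 1/2. *)
Lemma step1_gt0 : 0 < step 1.
Proof.
have s0 : step 0 = 0 by rewrite step_le0.
have s01 : 0 <= step 1 by rewrite -s0 step_nondecreasing.
rewrite lt_neqAle s01 andbT eq_sym.
apply/eqP => E.
have E2 x : step x = 0.
  have [/step_le0//|x0] := leP x 0.
  have sx : 0 <= step x by rewrite -s0 step_nondecreasing ?ltW.
  apply/eqP; rewrite eq_le sx andbT.
  have [x1|x1] := leP x 1; first by rewrite -E step_nondecreasing.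
  by rewrite (step_ge1 (ltW x1)) E.
have d0 : is_derive (2^-1 : R) 1 step 0.
  by rewrite (_ : step = cst 0); [exact: is_derive_cst|exact/funext].
have := sbump_half; have -> : sbump 2^-1 = 0; last by rewrite ltxx.
by rewrite -(@derive_val _ _ _ _ _ _ _ (der_step 2^-1)); exact: derive_val.
Qed.

(* A smooth ramp from 0 to [step 1] over [a, a + d], and back over [b, b + d]. *)
Definition plateau a b d x := step (d^-1 * x + - (d^-1 * a)) - step (d^-1 * x + - (d^-1 * b)).

Lemma der_plateau a b d x : is_derive x 1 (plateau a b d)
  (d^-1 * sbump (d^-1 * x + - (d^-1 * a)) - d^-1 * sbump (d^-1 * x + - (d^-1 * b))).
Proof.
rewrite mulrC [d^-1 * sbump (_ - _ * b)]mulrC.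
by apply: derB; apply: der_affine; exact: der_step.
Qed.

Lemma plateau_support a b d x : 0 < d -> a <= b -> ~~ (a < x < b + d) -> plateau a b d x = 0.
Proof.
move=> d0 ab; rewrite negb_and -!leNgt => /orP[xa|bx]; rewrite /plateau -!mulrBr.
  rewrite !step_le0 ?subrr// pmulr_rle0 ?invr_gt0 ?subr_le0//; exact: le_trans ab.
rewrite ![step (d^-1 * _)]step_ge1 ?subrr//.
  by rewrite mulrC ler_pdivlMr// mul1r; lra.
by rewrite mulrC ler_pdivlMr// mul1r; lra.
Qed.

Lemma plateau_test a b d : 0 < d -> a <= b -> test_function (plateau a b d).
Proof.
move=> d0 ab; split.
  apply: Cn_derivable => n.
  rewrite /plateau; under eq_fun do rewrite -[- step _]mulN1r.
  apply: CnD; last apply: CnZ; apply: (Cn_affine (f := step)); exact: Cn_step.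
apply: (@subclosed_compact _ _ `[a, b + d]%classic); first exact: closed_closure.
  exact: segment_compact.
have /closure_id E : closed `[a, b + d]%classic by exact: interval_closed.
rewrite [X in _ `<=` X]E; apply: closure_subset => x /=.
rewrite in_itv/=; apply: contraNT => xab; apply/eqP/plateau_support => //.
by apply: contra xab => /andP[ax xb]; rewrite !ltW.
Qed.

End smooth.

(** * Weak derivatives on the line *)

Section du_bois_reymond.
Context {R : realType}.
Notation mu := (@lebesgue_measure R).
Implicit Types (f g : R -> R) (x a b c : R).

Lemma ae_exists (P : R -> Prop) : {ae mu, forall x, P x} -> exists x, P x.
Proof.
move=> [N [mN N0 PN]]; apply: contrapT => /forallNP nP.
have NT : N = setT by apply/seteqP; split => // x _; apply: PN => /=; exact: nP.
have := lebesgue_measure_itv (`[0, 1] : interval R).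
rewrite /= lte_fin ltr01 oppr0 adde0 => m1.
have : (mu `[0%R, 1%R]%classic <= mu N)%E.
  by rewrite NT; apply: le_measure; rewrite ?inE.
by rewrite N0 m1 lee_fin ler10.
Qed.

Lemma Rdominated_cvg (D : set R) (f_ : nat -> R -> R) f g : measurable D ->
  (forall n, measurable_fun D (f_ n)) -> measurable_fun D f ->
  (forall x, D x -> f_ n x @[n --> \oo] --> f x) ->
  mu.-integrable D (EFin \o g) ->
  (forall n x, D x -> `|f_ n x| <= g x) ->
  \int[mu]_(x in D) f_ n x @[n --> \oo] --> \int[mu]_(x in D) f x.
Proof.
move=> mD mf_ mf ff ig fg.
have H1 n : measurable_fun D (EFin \o f_ n) by exact/measurable_EFinP.
have H2 : measurable_fun D (EFin \o f) by exact/measurable_EFinP.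
have H3 : {ae mu, forall x, D x -> (EFin \o f_ n) x @[n --> \oo] --> (EFin \o f) x}.
  by apply: aeW => x Dx; apply: cvg_EFin; [exact: nearW|exact: ff].
have H4 : {ae mu, forall x n, D x -> (`|(EFin \o f_ n) x| <= (EFin \o g) x)%E}.
  by apply: aeW => x n Dx; rewrite lee_fin; exact: fg.
have [intf _ C] := @dominated_convergence _ _ _ mu _ mD _ _ _ H1 H2 H3 ig H4.
have : (\int[mu]_(x in D) (EFin \o f_ n) x)%E @[n --> \oo] -->
  (\int[mu]_(x in D) f x)%:E.
  rewrite /Rintegral fineK//; exact: integrable_fin_num.
exact: fine_cvg.
Qed.

(** The kernel has mass [step 1], is at most [1 / d] with [d = 1 / (n + 1)], and lives on
    [[a, a + d]], inside the ball of radius [2 * d], whose measure is [4 * d]. The error is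
    therefore at most four times the mean deviation of [f] from [f a] on that ball, whence
    [e / 4]. *)
Lemma cvg_bump_average f a : locally_integrable setT f -> lebesgue_pt f a ->
  \int[mu]_(x in `[a, a + n.+1%:R^-1])
      (f x * (n.+1%:R * sbump (n.+1%:R * x + - (n.+1%:R * a)))) @[n --> \oo]
    --> step 1 * f a.
Proof.
move=> lf fa; have lif := locally_integrable_locint lf.
apply/cvgrPdist_le => e e0.
have : \forall r \near 0^'+, (davg f a r < (e / 4)%:E)%E.
  move/fine_cvgP : fa => [fin].
  move/cvgrPdist_lt => /(_ (e / 4)) /(_ (divr_gt0 e0 (ltr0n _ 4))) H.
  near=> r.
  have finr : davg f a r \is a fin_num by near: r.
  rewrite -(fineK finr) lte_fin (le_lt_trans (ler_norm _))//.
  rewrite -normrN -[X in `|X|]add0r; near: r; exact: H.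
move=> [r /= r0 Hr]; have r20 : 0 < r / 2 by rewrite divr_gt0.
near=> n.
set d := n.+1%:R^-1; have d0 : 0 < d by rewrite invr_gt0.
have nE : n.+1%:R = d^-1 by rewrite invrK.
have dr : d < r / 2.
  by rewrite /d; near: n; exact: near_infty_natSinv_lt (PosNum r20).
have {Hr}Hd : (davg f a (2 * d) < (e / 4)%:E)%E.
  by apply: Hr => //=; rewrite ?mulr_gt0// sub0r normrN gtr0_norm ?mulr_gt0//; lra.
pose k x := d^-1 * sbump (d^-1 * x + - (d^-1 * a)).
have kE : (fun x => (f x * (n.+1%:R * sbump (n.+1%:R * x + - (n.+1%:R * a))))) =
    (fun x => f x * k x).
  by rewrite nE.
rewrite kE.
have dk x : is_derive x 1 (fun x => step (d^-1 * x + - (d^-1 * a))) (k x).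
  by rewrite /k [d^-1 * sbump _]mulrC; apply: der_affine; exact: der_step.
have ck : continuous k.
  have [k' dk' _] : Cn 1 k := CnZ _ (Cn_affine _ _ (Cn_sbump 1)).
  by move=> x; exact: is_derive_continuous (dk' x).
have k0 x : 0 <= k x by rewrite mulr_ge0 ?sbump_ge0 ?invr_ge0 ?ltW.
have k1 x : k x <= d^-1 by rewrite ler_piMr ?sbump_le1 ?invr_ge0 ?ltW.
have mk : measurable_fun setT k by exact: continuous_measurable_fun.
have mf : measurable_fun setT f by case: lf.
have Ik : \int[mu]_(x in `[a, a + d]) k x = step 1.
  rewrite (Rintegral_derive _ dk)// ?lerDl ?ltW// mulrDr mulVf ?gt_eqF//.
  have -> : d^-1 * a + 1 - d^-1 * a = 1 by ring.
  by rewrite subrr [X in _ - X]step_le0// subr0.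
have nk x : `|k x| <= d^-1 by rewrite ger0_norm.
have ifk : locint (fun x => f x * k x) by exact: locintM_bounded nk.
have ick : locint (fun x => f a * k x).
  by move=> u v; apply: integrableZ_Rfun => //; exact: continuous_locint.
have icf : locint (fun x => f x - f a).
  by apply: locintB => //; apply: continuous_locint => x; exact: cvg_cst.
have icfk : locint (fun x => (f x - f a) * k x) by exact: locintM_bounded nk.
have -> : step 1 * f a - \int[mu]_(x in `[a, a + d]) (f x * k x) =
    - \int[mu]_(x in `[a, a + d]) ((f x - f a) * k x).
  under [in RHS]eq_Rintegral do rewrite mulrBl.
  rewrite RintegralB// RintegralZl// ?Ik; first ring.
  exact: continuous_locint.
rewrite normrN.
have mB : measurable (ball a (2 * d)) by exact: measurable_ball.
have aB : `[a, a + d]%classic `<=` ball a (2 * d).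
  move=> x /=; rewrite in_itv/= /ball/= => /andP[ax xad].
  by rewrite distrC ger0_norm ?subr_ge0//; lra.
have H1 : (\int[mu]_(x in ball a (2 * d)) `|f x - f a|%:E < (e * d)%:E)%E.
  move: Hd; rewrite /davg /iavg lebesgue_measure_ball ?mulr_ge0// ?ltW//.
  rewrite inver mulrn_eq0/= mulf_eq0 pnatr_eq0/= gt_eqF// lte_pdivrMl//.
    by rewrite -EFinM; have -> : (2 * d) *+ 2 * (e / 4) = e * d by field.
  by rewrite pmulrn_lgt0// mulr_gt0.
have H2 : (\int[mu]_(x in `[a, (a + d)%R]) `|f x - f a|%:E < (e * d)%:E)%E.
  apply: le_lt_trans H1; apply: ge0_subset_integral => //.
  apply/measurable_EFinP; apply: measurableT_comp => //.
  by apply: measurable_funB => //; exact: measurable_funS mf.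
have {}H2 : \int[mu]_(x in `[a, a + d]) `|f x - f a| < e * d.
  rewrite -lte_fin /Rintegral fineK//; apply: integrable_fin_num => //.
  exact/integrable_norm_Rfun.
apply: (le_trans (le_normr_Rintegral _ _)) => //.
apply: (@le_trans _ _ (\int[mu]_(x in `[a, a + d]) (d^-1 * `|f x - f a|))).
  apply: le_Rintegral => //; first exact: integrable_norm_Rfun.
    exact/integrableZ_Rfun/integrable_norm_Rfun.
  by move=> x _; rewrite normrM mulrC ler_wpM2r.
rewrite RintegralZl//; last exact: integrable_norm_Rfun.
by rewrite mulrC ler_pdivrMr// ltW.
Unshelve. all: by end_near. Qed.

End du_bois_reymond.

Section du_bois_reymond2.
Context {R : realType}.
Notation mu := (@lebesgue_measure R).
Implicit Types (f g : R -> R) (x a b c : R).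

Lemma restrict_zero (D : set R) f : (forall x, ~ D x -> f x = 0) -> f \_ D = f.
Proof.
move=> f0; apply/funext => x; rewrite patchE; case: ifPn => //.
by rewrite notin_setE => /f0.
Qed.

Lemma Rintegral_zero_outside (D : set R) f :
  (forall x, ~ D x -> f x = 0) -> \int[mu]_x f x = \int[mu]_(x in D) f x.
Proof. by move=> /restrict_zero f0; rewrite [RHS]Rintegral_mkcond f0. Qed.

Lemma integrable_zero_outside (D : set R) f : measurable D ->
  (forall x, ~ D x -> f x = 0) -> mu.-integrable D (EFin \o f) ->
  mu.-integrable setT (EFin \o f).
Proof.
move=> mD f0 intf; have := (@integrable_mkcond _ _ _ mu D _ mD).1 intf.
by rewrite restrict_EFin restrict_zero.
Qed.

Lemma cvg_plateau a b x : a < b ->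
  plateau a b n.+1%:R^-1 x @[n --> \oo] --> (cst (step 1) \_ `]a, b]) x.
Proof.
move=> ab.
have [ax|xa] := ltP a x; last first.
  rewrite patchE ifF; last by apply/negbTE; rewrite notin_setE/= in_itv/= ltNge xa.
  apply: cvg_near_cst; near=> n.
  by rewrite plateau_support ?invr_gt0// ?ltW// ltNge xa.
have [xb|bx] := leP x b.
  rewrite patchE ifT; last by rewrite inE/= in_itv/= ax xb.
  have xa0 : 0 < x - a by rewrite subr_gt0.
  apply: cvg_near_cst; near=> n.
  rewrite /plateau invrK -!mulrBr [X in _ - X]step_le0 ?subr0.
    rewrite step_ge1// -ler_pdivrMl ?ltr0n// mulr1 ltW//.
    by near: n; exact: near_infty_natSinv_lt (PosNum xa0).
  by rewrite pmulr_rle0 ?ltr0n// subr_le0.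
rewrite patchE ifF; last first.
  by apply/negbTE; rewrite notin_setE/= in_itv/= ax/= leNgt bx.
have xb0 : 0 < x - b by rewrite subr_gt0.
apply: cvg_near_cst; near=> n.
rewrite plateau_support ?invr_gt0// ?ltW// ax/= -leNgt.
rewrite -lerBrDl ltW//.
by near: n; exact: near_infty_natSinv_lt (PosNum xb0).
Unshelve. all: by end_near. Qed.

Lemma plateau_bound a b d x : `|plateau a b d x| <= step 1.
Proof.
have s01 (y : R) : 0 <= step y <= step 1.
  have s0 : step 0 = 0 :> R by rewrite step_le0.
  apply/andP; split.
    have [y0|y0] := leP y 0; first by rewrite step_le0.
    by rewrite -s0 step_nondecreasing// ltW.
  have [y1|y1] := leP y 1; first exact: step_nondecreasing.
  by rewrite step_ge1// ltW.
rewrite /plateau ler_norml; move: (s01 (d^-1 * x + - (d^-1 * a))) (s01 (d^-1 * x + - (d^-1 * b))).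
move=> /andP[? ?] /andP[? ?]; apply/andP; split; lra.
Qed.

Lemma continuous_plateau a b d : continuous (plateau a b d).
Proof. by move=> x; exact: is_derive_continuous (der_plateau a b d x). Qed.

(** The test functions are plateaus with ramps of width [1 / (n + 1)] starting at [a] and [b]. Their
    derivatives are differences of two bumps concentrating at [a] and [b], while the plateaus tend
    to [step 1] on []a, b]]; the factor [step 1] cancels. *)
Lemma weak_derivative_lebesgue_pt f g a b : is_weak_derivative f g -> a < b ->
  lebesgue_pt f a -> lebesgue_pt f b ->
  f b - f a = \int[mu]_(x in `[a, b]) g x.
Proof.
move=> [lf lg fg] ab fa fb.
have lif := locally_integrable_locint lf; have lig := locally_integrable_locint lg.
have mf : measurable_fun setT f by case: lf.
have mg : measurable_fun setT g by case: lg.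
pose d n : R := n.+1%:R^-1.
have d0 n : 0 < d n by rewrite invr_gt0.
pose k c n x := n.+1%:R * sbump (n.+1%:R * x + - (n.+1%:R * c)) : R.
have k0 c n x : ~ (`[c, c + d n]%classic x) -> f x * k c n x = 0.
  move=> /= /negP; rewrite in_itv/= negb_and -!ltNge => H.
  rewrite /k -mulrBr sbump0 ?mulr0// negb_and -!leNgt.
  case/orP: H => H; apply/orP; [left|right].
    by rewrite pmulr_rle0 ?ltr0n// subr_le0 ltW.
  by rewrite -ler_pdivrMl ?ltr0n// mulr1 lerBrDl ltW.
have ck c n : continuous (k c n).
  have [k' dk' _] : Cn 1 (k c n) := CnZ _ (Cn_affine _ _ (Cn_sbump 1)).
  by move=> x; exact: is_derive_continuous (dk' x).
have ifk c n : mu.-integrable setT (EFin \o (fun x => f x * k c n x)).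
  apply: (@integrable_zero_outside `[c, c + d n]) => //; first exact: k0.
  suff H : locint (fun x => f x * k c n x) by exact: (H c (c + d n)).
  apply: (@locintM_bounded _ _ _ n.+1%:R) => //.
    exact: continuous_measurable.
  move=> x; have kx : 0 <= k c n x by rewrite mulr_ge0// sbump_ge0.
  by rewrite (ger0_norm kx) ler_piMr// sbump_le1.
have L : \int[mu]_x (f x * derive1 (plateau a b (d n)) x) @[n --> \oo] -->
    step 1 * f a - step 1 * f b.
  under eq_cvg => n.
    rewrite (_ : (fun _ => _) = (fun x => f x * k a n x - f x * k b n x)).
      rewrite RintegralB// !(Rintegral_zero_outside (k0 _ n)).
      over.
    apply/funext => x; rewrite derive1E (@derive_val _ _ _ _ _ _ _ (der_plateau _ _ _ _)).
    by rewrite /d invrK mulrBr.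
  by apply: cvgB; apply: cvg_bump_average.
have L2 : \int[mu]_x (g x * plateau a b (d n) x) @[n --> \oo] -->
    step 1 * \int[mu]_(x in `[a, b]) g x.
  have -> : step 1 * \int[mu]_(x in `[a, b]) g x =
      \int[mu]_(x in `[a, b + 1]) (g x * (cst (step 1) \_ `]a, b]) x).
    have -> : (fun x => g x * (cst (step 1) \_ `]a, b]) x) = (fun x => step 1 * g x) \_ `]a, b].
      by apply/funext => x; rewrite !patchE; case: ifP; rewrite ?mulr0 1?mulrC.
    rewrite -Rintegral_mkcondr setIidr; last first.
      by apply: subset_itv; rewrite bnd_simp// lerDl.
    rewrite Rintegral_itv_obnd_cbnd; last first.
      apply: integrableZ_Rfun => //; apply: integrableS (lig a b) => //.
      by apply: subset_itvr; rewrite bnd_simp.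
    by rewrite RintegralZl.
  under eq_cvg => n.
    rewrite (@Rintegral_zero_outside `[a, b + 1]); first over.
    move=> x /= /negP xab; rewrite plateau_support ?mulr0 ?ltW//.
    apply: contra xab => /andP[ax xb]; rewrite in_itv/= ltW//=.
    by rewrite (le_trans (ltW xb))// lerD2l invf_le1 ?ltr0n// ler1n.
  apply: (@Rdominated_cvg _ _ _ _ (fun x => step 1 * `|g x|)) => //.
  - move=> n; apply: measurable_funM; first exact: measurable_funS mg.
    by apply: continuous_measurable => //; exact: continuous_plateau.
  - apply: measurable_funM; first exact: measurable_funS mg.
    by apply/measurable_restrict => //; exact: measurable_cst.
  - by move=> x _; apply: cvgM; [exact: cvg_cst|exact: cvg_plateau].
  - exact/integrableZ_Rfun/integrable_norm_Rfun.
  - by move=> n x _; rewrite normrM mulrC ler_wpM2r// plateau_bound.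
have E : step 1 * f a - step 1 * f b = - (step 1 * \int[mu]_(x in `[a, b]) g x).
  apply: cvg_unique L _ => //; move: L2 => /cvgN; apply: cvg_trans.
  apply: near_eq_cvg; apply: nearW => n.
  by rewrite fg//; exact: plateau_test (ltW _).
have s1 : step 1 != 0 :> R by rewrite gt_eqF// step1_gt0.
by apply: (mulfI s1); rewrite mulrBr -[RHS]opprK -E opprB.
Qed.

(** Du Bois-Reymond: almost every point is a Lebesgue point of [f], and any one of them determines
    the constant. *)
Lemma weak_derivative_primitive f g : is_weak_derivative f g ->
  exists C, {ae mu, forall x, f x = C + primitive g x}.
Proof.
move=> fg; have [lf lg _] := fg; have lig := locally_integrable_locint lg.
have aef := lebesgue_differentiation lf.
have [a fa] := ae_exists aef.
exists (f a - primitive g a); apply: ae_imply aef => x fx.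
have [ax|xa|<-] := ltgtP a x; last by rewrite subrK.
  have := weak_derivative_lebesgue_pt fg ax fa fx.
  by rewrite -(primitiveB lig (ltW ax)); lra.
have := weak_derivative_lebesgue_pt fg xa fx fa.
by rewrite -(primitiveB lig (ltW xa)); lra.
Qed.

End du_bois_reymond2.

(** * Convolution *)

Section change_of_variable.
Context {R : realType}.
Notation mu := (@lebesgue_measure R).
Implicit Types (f g : R -> R) (x a b c : R).

Let reflect c : measurableTypeR R -> measurableTypeR R := fun x => c - x.

Let measurable_reflect c : measurable_fun setT (reflect c).
Proof. exact: measurable_funB. Qed.

Lemma lebesgue_measure_reflect c A : measurable A ->
  pushforward mu (reflect c) A = mu A.
Proof.
move=> mA; apply/esym/lebesgue_measure_unique => //=.
move=> _ [[a b]] _ <-.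
rewrite /pushforward (_ : reflect c @^-1` _ = `[c - b, c - a[%classic).
  rewrite !lebesgue_measure_itv/= !lte_fin ltrD2l ltrN2.
  by case: ifPn => // _; rewrite -!EFinD; congr EFin; ring.
apply/seteqP; split => x /=; rewrite !in_itv/= /reflect => /andP[? ?]; apply/andP; split; lra.
Qed.

Lemma ge0_integral_reflect (f : R -> \bar R) c : measurable_fun setT f ->
  (forall x, (0 <= f x)%E) ->
  (\int[mu]_x f x = \int[mu]_x f (c - x)%R)%E.
Proof.
move=> mf f0.
transitivity (\int[pushforward mu (reflect c)]_x f x)%E.
  by apply: eq_measure_integral => //= A mA _; rewrite lebesgue_measure_reflect.
by rewrite ge0_integral_pushforward ?preimage_setT.
Qed.

Lemma integral_reflect (f : R -> \bar R) c : measurable_fun setT f ->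
  (\int[mu]_x f x = \int[mu]_x f (c - x)%R)%E.
Proof.
move=> mf; rewrite [LHS]integralE [RHS]integralE.
rewrite (ge0_integral_reflect c)//; last exact: measurable_funepos.
rewrite [X in (_ - X = _)%E](ge0_integral_reflect c)//; last exact: measurable_funeneg.
by congr (_ - _)%E; apply: eq_integral => x _; rewrite ?funeposE ?funenegE.
Qed.

(** A translation is the composite of the reflections [x -> - x] and [x -> c - x]. *)
Lemma integral_translate (f : R -> \bar R) c : measurable_fun setT f ->
  (\int[mu]_x f x = \int[mu]_x f (x - c)%R)%E.
Proof.
move=> mf; rewrite (integral_reflect 0)// (integral_reflect c).
  by apply: eq_integral => x _; congr f; ring.
by apply: measurableT_comp => //; exact: measurable_funB.
Qed.

Lemma integrable_translate f c : mu.-integrable setT (EFin \o f) ->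
  mu.-integrable setT (EFin \o (fun x => f (x - c))).
Proof.
move=> /integrableP[/measurable_EFinP mf foo]; apply/integrableP; split.
  by apply/measurable_EFinP; apply: measurableT_comp => //; exact: measurable_funB.
rewrite -(integral_translate c (f := fun x => `|(EFin \o f) x|%E))//.
exact/measurable_EFinP/measurableT_comp.
Qed.

End change_of_variable.

Section convolution_integral.
Context {R : realType}.
Notation mu := (@lebesgue_measure R).
Implicit Types (J u f g : R -> R) (x a b c : R).

Lemma convolutionE J u x : measurable_fun setT J -> measurable_fun setT u ->
  convolution J u x = \int[mu]_h (J h * u (x - h)).
Proof.
move=> mJ mu'; rewrite /convolution /Rintegral (integral_reflect x).
  by congr fine; apply: eq_integral => h _; rewrite subKr.
apply/measurable_EFinP/measurable_funM => //.
by apply: measurableT_comp => //; exact: measurable_funB.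
Qed.

Lemma integral_shift_itv (f : R -> \bar R) a b h : measurable_fun setT f ->
  (\int[mu]_(x in `[a, b]) f (x - h)%R = \int[mu]_(x in `[(a - h)%R, (b - h)%R]) f x)%E.
Proof.
move=> mf; rewrite integral_mkcond [RHS]integral_mkcond.
rewrite [RHS](integral_translate h).
  apply: eq_integral => x _; rewrite !patchE; congr (if _ then _ else _).
  by apply/idP/idP; rewrite !inE/= !in_itv/= !lerD2r.
by apply/measurable_restrict => //; exact: measurable_funS mf.
Qed.

(** Fubini for [J h * u (x - h)] cut off to [x] in [[a, b]]; the absolute integral is at most the
    product of the two L^1 norms. *)
Lemma convolution_integral J u a b : mu.-integrable setT (EFin \o J) ->
  mu.-integrable setT (EFin \o u) ->
  mu.-integrable `[a, b] (EFin \o convolution J u) /\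
  \int[mu]_(x in `[a, b]) convolution J u x =
    \int[mu]_h (J h * \int[mu]_(x in `[a - h, b - h]) u x).
Proof.
move=> iJ iu.
have mJ : measurable_fun setT J by apply/measurable_EFinP; exact: measurable_int iJ.
have mu' : measurable_fun setT u by apply/measurable_EFinP; exact: measurable_int iu.
pose f (z : R * R) := (J z.2 * u (z.1 - z.2) * \1_`[a, b] z.1)%:E.
have mf : measurable_fun setT f.
  apply/measurable_EFinP; apply: measurable_funM.
    apply: measurable_funM; first exact: measurableT_comp.
    by apply: measurableT_comp => //; exact: measurable_funB.
  by apply: measurableT_comp => //.
have mf' : measurable_fun setT (abse \o f) by exact: measurableT_comp.
pose Iu := fine (\int[mu]_x `|u x|%:E)%E.
have IuE : (\int[mu]_x `|u x|%:E)%E = Iu%:E.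
  by rewrite /Iu fineK//; apply: integrable_fin_num => //; exact: integrable_norm_Rfun.
have intf : (mu \x mu)%E.-integrable setT f.
  apply/integrable21ltyP => //.
  apply: (@le_lt_trans _ _ (\int[mu]_h (`|J h|%:E * Iu%:E))%E).
    apply: ge0_le_integral => //.
    - by move=> y _; apply: integral_ge0.
    - by have := @measurable_fun_fubini_tonelli_G _ _ _ _ _ mu (abse \o f) mf' (fun=> abse_ge0 _).
    - apply: emeasurable_funM => //; apply/measurable_EFinP; exact: measurableT_comp.
    move=> h _.
    rewrite -IuE (integral_translate h); last exact/measurable_EFinP/measurableT_comp.
    have muh : measurable_fun setT (fun x => `|u (x - h)|).
      by do 2 apply: measurableT_comp => //; exact: measurable_funB.
    rewrite -ge0_integralZl//; last exact/measurable_EFinP.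
    apply: ge0_le_integral => //.
    - exact: (measurable_fun_pair1 _ mf').
    - by apply/measurable_EFinP; exact: measurable_funM.
    move=> x _; rewrite /f -EFinM lee_fin !normrM ler_piMr// ?mulr_ge0//.
    by rewrite indicE; case: (_ \in _); rewrite ?normr1 ?normr0.
  rewrite ge0_integralZr//; last 2 first.
    by apply/measurable_EFinP; exact: measurableT_comp.
    by rewrite -IuE; exact: integral_ge0.
  apply: lte_mul_pinfty => //; first exact: integral_ge0.
    exact: (integrable_fin_num _ (integrable_norm_Rfun iJ)).
  by rewrite ltry.
have FE x : `[a, b]%classic x -> fubini_F mu f x = (\int[mu]_h (J h * u (x - h))%:E)%E.
  move=> abx; rewrite /fubini_F /f; apply: eq_integral => h _.
  by rewrite indicE mem_set// mulr1.
have FF : mu.-integrable setT (fubini_F mu f) by exact: integrable_fubini_F.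
have Fab : mu.-integrable `[a, b] (fubini_F mu f) by exact: integrableS FF.
have convE x : `[a, b]%classic x -> convolution J u x = fine (fubini_F mu f x).
  by move=> abx; rewrite convolutionE// FE.
(* The inner integral may fail to be finite on a null set, where [convolution] takes the default
   value of [fine]. *)
have ae_fin : {ae mu, forall x, `[a, b]%classic x ->
    (fubini_F mu f x = (EFin \o convolution J u) x)%E}.
  have : {ae mu, forall x, `[a, b]%classic x -> fubini_F mu f x \is a fin_num}.
    by apply: integrable_ae.
  by apply: ae_imply => x + abx => /(_ abx) fx; rewrite /= convE// fineK.
have mfc : measurable_fun `[a, b] (EFin \o convolution J u).
  apply/measurable_EFinP.
  apply: (@eq_measurable_fun _ _ _ _ _ (fine \o fubini_F mu f)).
    by move=> x; rewrite inE => abx; rewrite /= convE.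
  apply: measurableT_comp => //; exact: measurable_int Fab.
split.
  apply/integrableP; split => //.
  have /integrableP[mF] := Fab; apply: le_lt_trans; rewrite le_eqVlt; apply/orP; left.
  apply/eqP; apply: ae_eq_integral => //; [exact: measurableT_comp..|].
  by apply: ae_imply ae_fin => x H abx; rewrite H.
transitivity (fine (\int[mu]_(x in `[a, b]) fubini_F mu f x)).
  rewrite /Rintegral; congr fine; apply: ae_eq_integral => //.
    exact: measurable_int Fab.
  by apply: ae_imply ae_fin => x H abx; rewrite H.
transitivity (fine (\int[mu]_x fubini_F mu f x)).
  congr fine; rewrite integral_mkcond; apply: eq_integral => x _.
  rewrite patchE; case: ifPn => // /negP xab; rewrite /fubini_F.
  rewrite integral0_eq// => h _; rewrite /f indicE.
  by case: (boolP (_ \in _)) => // _; rewrite mulr0.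
rewrite integral12_prod_meas1// -integral21_prod_meas1//.
rewrite /Rintegral; congr fine; apply: eq_integral => h _.
rewrite /fubini_G /f.
have iuh : mu.-integrable `[(a - h)%R, (b - h)%R] (EFin \o u) by exact: integrableS iu.
rewrite EFinM /Rintegral fineK; last exact: integrable_fin_num.
rewrite -integral_shift_itv; last exact/measurable_EFinP.
rewrite -integralZl//; last exact: integrableS (integrable_translate h iu).
rewrite [RHS]integral_mkcond; apply: eq_integral => x _; rewrite patchE indicE.
by case: ifPn => _; rewrite ?mulr1 ?mulr0// EFinM.
Qed.
End convolution_integral.

(** * Curves in Lebesgue spaces *)

Section local_L2.
Context {R : realType}.
Notation mu := (@lebesgue_measure R).
Implicit Types (f g : R -> R) (x a b c : R).

(** Young's inequality [|f| <= eta + |f| ^ 2 / eta], integrated. The free [eta] gives crude bounds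
    when it is 1, equicontinuity of primitives when it is large, and smallness when it equals
    [E]. *)
Lemma Lnorm2_local f (E eta : R) a b : measurable_fun setT f -> 0 <= E ->
  (Lnorm mu 2%:E (EFin \o f) <= E%:E)%E -> 0 < eta -> a <= b ->
  mu.-integrable `[a, b] (EFin \o f) /\
  \int[mu]_(x in `[a, b]) `|f x| <= eta * (b - a) + E ^+ 2 / eta.
Proof.
move=> mf E0 fE eta0 ab.
have mfab : measurable_fun `[a, b] (EFin \o f).
  by apply/measurable_EFinP; exact: measurable_funS mf.
have mp : measurable_fun setT (fun x => `|f x| `^ 2).
  by apply: (measurableT_comp (measurable_powR 2)); exact: measurableT_comp.
have I2 : (\int[mu]_x (`|f x| `^ 2)%:E <= (E ^+ 2)%:E)%E.
  have := @powR_Lnorm _ _ _ mu (EFin \o f) 2.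
  rewrite pnatr_eq0/= => /(_ isT) H.
  have -> : (\int[mu]_x (`|f x| `^ 2)%:E = Lnorm mu 2%:E (EFin \o f) `^ 2)%E.
    by rewrite H; apply: eq_integral.
  rewrite -[E ^+ 2]powR_mulrn// -poweR_EFin.
  by apply: gt0_ler_poweR => //; rewrite in_itv/= leey andbT ?Lnorm_ge0// lee_fin.
have I1 : (\int[mu]_(x in `[a, b]) `|f x|%:E <= (eta * (b - a) + E ^+ 2 / eta)%:E)%E.
  apply: (@le_trans _ _ (\int[mu]_(x in `[a, b]) (eta%:E + eta^-1%:E * (`|f x| `^ 2)%:E))%E).
    apply: ge0_le_integral => //.
    - by apply/measurable_EFinP/measurableT_comp => //; exact/measurable_EFinP.
    - apply: emeasurable_funD => //; apply: emeasurable_funM => //.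
      by apply/measurable_EFinP; exact: measurable_funS mp.
    move=> x _; rewrite -EFinM -EFinD lee_fin powR_mulrn//.
    rewrite -(ler_pM2l eta0) mulrDr mulrA divff ?gt_eqF// mul1r.
    have := sqr_ge0 (eta - `|f x|); have := sqr_ge0 (`|f x|); nra.
  rewrite ge0_integralD//; last 3 first.
    - by move=> x _; rewrite lee_fin ltW.
    - by move=> x _; rewrite -EFinM lee_fin mulr_ge0 ?powR_ge0// invr_ge0 ltW.
    - apply: emeasurable_funM => //.
      by apply/measurable_EFinP; exact: measurable_funS mp.
  rewrite EFinD; apply: leeD.
    rewrite integral_cst//= lebesgue_measure_itv/= lte_fin; case: ifPn => _.
      by rewrite -EFinD -EFinM.
    by rewrite mule0 lee_fin mulr_ge0 ?subr_ge0// ltW.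
  have mp' : measurable_fun `[a, b] (fun x => (`|f x| `^ 2)%:E).
    by apply/measurable_EFinP; exact: measurable_funS mp.
  have p0 x : `[a, b]%classic x -> (0 <= (`|f x| `^ 2)%:E)%E by rewrite lee_fin powR_ge0.
  rewrite ge0_integralZl//; last by rewrite lee_fin invr_ge0 ltW.
  rewrite mulrC EFinM; apply: lee_wpmul2l; first by rewrite lee_fin invr_ge0 ltW.
  apply: le_trans I2; apply: ge0_subset_integral => //; first exact/measurable_EFinP.
have iab : mu.-integrable `[a, b] (EFin \o f).
  by apply/integrableP; split => //; apply: le_lt_trans I1 _; rewrite ltry.
split=> //; rewrite -lee_fin /Rintegral fineK//.
by apply: integrable_fin_num => //; exact: integrable_norm_Rfun.
Qed.

Lemma Rintegral_norm_ge0 f (D : set R) : 0 <= \int[mu]_(x in D) `|f x|.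
Proof. by apply: Rintegral_ge0. Qed.

Lemma continuous_primitive_L2 f (E : R) : measurable_fun setT f -> 0 <= E ->
  (Lnorm mu 2%:E (EFin \o f) <= E%:E)%E -> continuous (primitive f).
Proof.
move=> mf E0 fE x.
have lf : locint f.
  move=> a b; have [ab|ba] := leP a b; last first.
    by rewrite set_itv_ge ?bnd_simp -?ltNge//; exact: integrable_set0.
  by have [] := Lnorm2_local mf E0 fE ltr01 ab.
apply/cvgrPdist_le => e e0.
(* This [eta] makes [E ^ 2 / eta] at most [e / 2]; lengths below [r] leave the other half for
   [eta * (b - a)]. *)
pose eta := (E ^+ 2 + 1) / (e / 2).
have eta0 : 0 < eta by rewrite !divr_gt0// ltr_wpDl// sqr_ge0.
have E2 : E ^+ 2 / eta <= e / 2.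
  rewrite ler_pdivrMr//; have -> : e / 2 * eta = E ^+ 2 + 1; last by rewrite lerDl.
  by rewrite /eta mulrC divfK// gt_eqF// divr_gt0.
pose r := e / 2 / eta; have r0 : 0 < r by rewrite /r divr_gt0// divr_gt0.
have key a b : a <= b -> b - a < r -> `|primitive f b - primitive f a| <= e.
  move=> ab bar; rewrite primitiveB//.
  apply: (le_trans (le_normr_Rintegral _ _)) => //.
  have [_] := Lnorm2_local mf E0 fE eta0 ab; move/le_trans; apply.
  have -> : e = e / 2 + e / 2 by field.
  by rewrite lerD// mulrC -ler_pdivlMr// ltW.
near=> y; have yr : `|x - y| < r by near: y; exact: (nbhsx_ballx x r r0).
have [xy|yx] := leP x y.
  rewrite distrC key//; move: yr; rewrite distrC ger0_norm ?subr_ge0//.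
by rewrite key ?ltW//; move: yr; rewrite ger0_norm ?subr_ge0 ?ltW.
Unshelve. all: by end_near. Qed.

End local_L2.

Section representatives.
Context {R : realType}.
Notation mu := (@lebesgue_measure R).
Implicit Types (f g : R -> R) (x a b c : R).

Lemma ae_primitive_eq f g : measurable_fun setT f -> measurable_fun setT g ->
  {ae mu, forall x, f x = g x} -> primitive f = primitive g.
Proof.
move=> mf mg fg; apply/funext => x; rewrite /primitive.
by congr (_ - _); apply: ae_Rintegral_eq => //;
  first [exact: measurable_funS mf|exact: measurable_funS mg].
Qed.

(** The representation by primitives is applied twice. For the bound, the integral of [|wx|] over
    [[x, x + 1]] is at most [1 + E1 ^ 2], and [wx] deviates there from [wx x] by at most
    [1 + E2 ^ 2]. Being explicit in the norms, the bound becomes uniform on compact sets of positive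
    times. *)
Lemma W22_representative f f1 f2 (E1 E2 : R) : 0 <= E1 -> 0 <= E2 ->
  is_weak_derivative f f1 -> is_weak_derivative f1 f2 ->
  (Lnorm mu 2%:E (EFin \o f1) <= E1%:E)%E ->
  (Lnorm mu 2%:E (EFin \o f2) <= E2%:E)%E ->
  exists w wx : R -> R,
  [/\ {ae mu, forall x, f x = w x} /\ {ae mu, forall x, f1 x = wx x},
      forall x, is_derive x 1 w (wx x), continuous wx,
      forall a b, a <= b -> \int[mu]_(x in `[a, b]) f2 x = wx b - wx a &
      forall x, `|wx x| <= 2 + E1 ^+ 2 + E2 ^+ 2].
Proof.
move=> E10 E20 W1 W2 n1 n2.
have [[mf _ _] [mf1 _ _] _] := W1; have [_ lf2 _] := W2; have [mf2 _ _] := lf2.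
have lif2 := locally_integrable_locint lf2.
have [C1 f1E] := weak_derivative_primitive W2.
pose wx x := C1 + primitive f2 x.
have cwx : continuous wx.
  move=> x; apply: cvgD; first exact: cvg_cst.
  exact: continuous_primitive_L2 mf2 E20 n2 x.
have [C fE] := weak_derivative_primitive W1.
pose w x := C + primitive wx x.
have mwx : measurable_fun setT wx by exact: continuous_measurable.
have pE : primitive f1 = primitive wx by exact: ae_primitive_eq.
have Iwx a b : a <= b -> \int[mu]_(x in `[a, b]) f2 x = wx b - wx a.
  by move=> ab; rewrite /wx -(primitiveB lif2 ab); ring.
exists w, wx; split => //.
- split=> //; by apply: ae_imply fE => x ->; rewrite pE.
- move=> x; rewrite -[wx x]add0r; apply: (derD (der_cst C x)).
  by apply: is_derive_primitive; [exact: continuous_locint|exact: cwx].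
move=> x; pose I := `[x, x + 1]%classic : set R.
have mI : measurable I by exact: measurable_itv.
have xx : x + 1 - x = 1 by ring.
have xx1 : x <= x + 1 by rewrite lerDl.
have [if1 I1] := Lnorm2_local mf1 E10 n1 ltr01 xx1.
have [if2 I2] := Lnorm2_local mf2 E20 n2 ltr01 xx1.
have iwx : mu.-integrable I (EFin \o wx) by exact: continuous_locint.
have {}I1 : \int[mu]_(y in I) `|wx y| <= 1 + E1 ^+ 2.
  rewrite (@ae_Rintegral_eq _ _ _ (fun y => `|f1 y|)) => //.
  - by move: I1; rewrite xx mul1r divr1.
  - by apply: measurableT_comp => //; exact: continuous_measurable.
  - by apply: measurableT_comp => //; exact: measurable_funS mf1.
  - by apply: ae_imply f1E => y ->.
have {}I2 : \int[mu]_(y in I) `|f2 y| <= 1 + E2 ^+ 2.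
  by move: I2; rewrite xx mul1r divr1.
have B y : I y -> `|wx x| <= `|wx y| + (1 + E2 ^+ 2).
  rewrite /I/= in_itv/= => /andP[xy yx].
  have : `|wx y - wx x| <= 1 + E2 ^+ 2.
    rewrite -Iwx//; apply: (le_trans (le_normr_Rintegral _ _)) => //.
    have ln : locint (fun y => `|f2 y|).
      by move=> a b; apply: integrable_norm_Rfun; exact: lif2.
    apply: le_trans I2; rewrite /I (Rintegral_split ln xy yx).
    by rewrite lerDl Rintegral_norm_ge0.
  move=> H; have := ler_normB (wx y) (wx y - wx x).
  by rewrite subKr; lra.
have : \int[mu]_(y in I) `|wx x| <= \int[mu]_(y in I) (`|wx y| + (1 + E2 ^+ 2)).
  have icst c : mu.-integrable I (EFin \o cst c).
    by apply: continuous_locint => y; exact: cvg_cst.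
  apply: le_Rintegral => //; first exact: icst.
  by apply: integrableD_Rfun => //; [exact: integrable_norm_Rfun|exact: icst].
rewrite RintegralD//; [|exact: integrable_norm_Rfun|];
  last by apply: continuous_locint => y; exact: cvg_cst.
rewrite !Rintegral_cst//= lebesgue_measure_itv/= lte_fin ltrDl ltr01.
rewrite -EFinB/= xx !mulr1; lra.
Qed.

End representatives.

Section curves.
Context {R : realType}.
Notation mu := (@lebesgue_measure R).
Implicit Types (f g : R -> R) (x a b c : R).

(** By compactness finitely many neighbourhoods suffice, and monotonicity of [Q] in [B] gives their
    bounds a common replacement. *)
Lemma segment_bound (Q : R -> R -> Prop) a b :
  (forall B B' s, B <= B' -> Q B s -> Q B' s) ->
  (forall t, a <= t <= b -> exists B r : R, 0 < r /\
    forall s, a <= s <= b -> `|s - t| < r -> Q B s) ->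
  exists B, forall s, a <= s <= b -> Q B s.
Proof.
move=> Qmono Qloc.
have /compact_near_coveringP/near_covering_withinP cov := @segment_compact R a b.
have [|M [Mreal HM]] := cov R (pinfty_nbhs R) Q _.
  move=> t /=; rewrite in_itv/= => /Qloc[B [r [r0 HB]]].
  exists (ball t r, [set B' | B <= B']).
    split; first exact: (nbhsx_ballx t r r0).
    by exists B; split; [exact: num_real|move=> B' /ltW].
  move=> [s B'] [/= st BB']; rewrite in_itv/= => sab.
  by apply: Qmono BB' _; apply: HB => //; rewrite distrC.
exists (M + 1) => s sab; apply: HM; first by rewrite ltrDl.
by rewrite /= in_itv.
Qed.

Lemma ereal_cvg0_lt (T : Type) (F : set_system T) (f : T -> \bar R) (e : R) :
  Filter F -> f @ F --> 0%E -> 0 < e -> \forall x \near F, (f x < e%:E)%E.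
Proof.
move=> FF /fine_cvgP[fin]; move/cvgrPdist_lt => H e0; have := H e e0.
apply: filterS2 fin => x fx; rewrite sub0r normrN => fe.
by rewrite -(fineK fx) lte_fin (le_lt_trans (ler_norm _)).
Qed.

Lemma continuous_Lp_lt (p : R) (I : set R) v t (e : R) : continuous_Lp p I v ->
  I t -> 0 < e -> exists2 r, 0 < r &
  forall s, I s -> `|s - t| < r -> (Lp_dist p (v s) (v t) < e%:E)%E.
Proof.
move=> [_ cv] It e0; have := ereal_cvg0_lt _ (cv t It) e0.
move=> [r /= r0 H]; exists r => // s Is st; apply: H => //=.
by rewrite distrC.
Qed.

Lemma Lfun_measurable (p : \bar R) f : f \in Lfun mu p -> measurable_fun setT f.
Proof. by rewrite inE => /andP[]; rewrite inE. Qed.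

Lemma Lfun_Lnorm (p : \bar R) f : f \in Lfun mu p -> (Lnorm mu p (EFin \o f) < +oo)%E.
Proof. by rewrite inE => /andP[_]; rewrite inE. Qed.

Lemma Lfun2_locint f : f \in Lfun mu 2%:E -> locint f.
Proof.
move=> lf c d; have [cd|dc] := leP c d; last first.
  by rewrite set_itv_ge ?bnd_simp -?ltNge//; exact: integrable_set0.
have /Lfun_Lnorm H := lf; have mf := Lfun_measurable lf.
have N0 : 0 <= fine (Lnorm mu 2%:E (EFin \o f)).
  by apply: fine_ge0; exact: Lnorm_ge0.
have N1 : (Lnorm mu 2%:E (EFin \o f) <= (fine (Lnorm mu 2%:E (EFin \o f)))%:E)%E.
  by rewrite fineK// ge0_fin_numE ?Lnorm_ge0.
by have [] := Lnorm2_local mf N0 N1 ltr01 cd.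
Qed.

Lemma continuous_Lp_bounded (p : R) (I : set R) v a b : 1 <= p ->
  continuous_Lp p I v -> (forall t, a <= t <= b -> I t) ->
  exists2 B, 0 <= B &
    forall t, a <= t <= b -> (Lnorm mu p%:E (EFin \o v t) <= B%:E)%E.
Proof.
move=> p1 cv abI.
have [B HB] : exists B, forall t, a <= t <= b ->
    (Lnorm mu p%:E (EFin \o v t) <= B%:E)%E.
  apply: (@segment_bound (fun B t => (Lnorm mu p%:E (EFin \o v t) <= B%:E)%E)).
    by move=> B B' s BB' /le_trans; apply; rewrite lee_fin.
  move=> t tab; have It := abI t tab; have vt := cv.1 t It.
  have [r r0 Hr] := continuous_Lp_lt cv It ltr01.
  exists (fine (Lnorm mu p%:E (EFin \o v t)) + 1), r; split => // s sab st.
  have vs := cv.1 s (abI s sab).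
  have -> : EFin \o v s = EFin \o ((v s \- v t) \+ v t)%R.
    by apply/funext => x /=; rewrite subrK.
  apply: (le_trans (minkowski_EFin _ _ _ _)) => //.
  - by apply: measurable_funB; [exact: Lfun_measurable vs|exact: Lfun_measurable vt].
  - exact: Lfun_measurable vt.
  rewrite EFinD fineK ?ge0_fin_numE ?Lnorm_ge0//; last exact: Lfun_Lnorm.
  by rewrite addeC leeD// ltW//; apply: Hr => //; exact: abI.
exists (Num.max B 0); first by rewrite le_max lexx orbT.
by move=> t /HB/le_trans; apply; rewrite lee_fin le_max lexx.
Qed.

Lemma Lp_dist_measurable p (I : set R) v t : continuous_Lp p I v -> I t ->
  measurable_fun setT (v t).
Proof. by move=> [H _] /H; exact: Lfun_measurable. Qed.

(** Integration over [[a, b]] is a bounded functional on L^2: [Lnorm2_local] with [eta] and [E] both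
    equal to [e'] bounds the L^1 error of the difference quotient by [e' * (b - a + 1) = e]. *)
Lemma is_derive_Lp_integral (v v' : R -> R -> R) (t : R) a b : 0 < t -> a <= b ->
  C1_Lp 2 `]0, +oo[ v v' ->
  is_derive t 1 (fun s => \int[mu]_(x in `[a, b]) v s x)
    (\int[mu]_(x in `[a, b]) v' t x).
Proof.
move=> t0 ab [cv cv' dv].
have It (s : R) : 0 < s -> (`]0, +oo[%classic : set R) s by move=> s0; rewrite /= in_itv/= s0.
have lv (s : R) : 0 < s -> locint (v s).
  by move=> s0; apply/Lfun2_locint/cv.1/It.
have lv' : mu.-integrable `[a, b] (EFin \o v' t).
  by apply: Lfun2_locint; exact/cv'.1/It.
apply/is_deriveP => e e0.
have ba : 0 < b - a + 1 by rewrite ltr_wpDl// subr_ge0.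
pose e' := e / (b - a + 1); have e'0 : 0 < e' by rewrite divr_gt0.
have [r /= r0 Hr] := ereal_cvg0_lt _ (dv t (It t t0)) e'0.
(* The bound [|h| < t] keeps [t + h] a positive time. *)
exists (Num.min r t); first by rewrite lt_min r0.
move=> h; rewrite lt_min => /andP[hr ht].
have [->|h0] := eqVneq h 0.
  by rewrite addr0 subrr mulr0 subrr normr0 mulr0.
have th0 : 0 < t + h by have := ler_norm (- h); rewrite normrN; lra.
have := Hr h; rewrite /ball_/= sub0r normrN => /(_ hr h0) Hh.
pose g x := h^-1 * (v (t + h) x - v t x) - v' t x.
have mg : measurable_fun setT g.
  apply: measurable_funB; last exact: Lp_dist_measurable cv' (It t t0).
  apply: measurable_funM => //.
  by apply: measurable_funB;
    [exact: Lp_dist_measurable cv (It _ th0)|exact: Lp_dist_measurable cv (It t t0)].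
have [ig Ig] := Lnorm2_local mg (ltW e'0) (ltW Hh) e'0 ab.
have -> : \int[mu]_(x in `[a, b]) v (t + h) x - \int[mu]_(x in `[a, b]) v t x -
    (\int[mu]_(x in `[a, b]) v' t x) * h = h * \int[mu]_(x in `[a, b]) g x.
  rewrite /g RintegralB//; last first.
    by apply: integrableZ_Rfun => //; apply: integrableB_Rfun => //; exact: lv.
  rewrite RintegralZl//; last by apply: integrableB_Rfun => //; exact: lv.
  rewrite RintegralB//; [|exact: lv|exact: lv].
  by field.
rewrite normrM mulrC ler_wpM2r//.
apply: (le_trans (le_normr_Rintegral _ _)) => //; apply: (le_trans Ig).
rewrite expr2 -mulrA divff ?gt_eqF// mulr1 -[X in _ + X]mulr1 -mulrDr.
by rewrite /e' divfK// gt_eqF.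
Qed.

End curves.

(** * The integrated equation *)

Section flow.
Context {R : realType}.
Notation mu := (@lebesgue_measure R).
Implicit Types (f g J u : R -> R) (x a b c t s : R).

Definition cumul f x := \int[mu]_(y in `]-oo, x]) f y.

Lemma cumulB f a b : mu.-integrable setT (EFin \o f) -> a <= b ->
  cumul f b - cumul f a = \int[mu]_(x in `[a, b]) f x.
Proof.
move=> intf ab; rewrite /cumul Rintegral_itvB//; first last.
  exact: integrableS intf.
by rewrite Rintegral_itv_obnd_cbnd//; exact: integrableS intf.
Qed.

Lemma cumul_primitive f x : mu.-integrable setT (EFin \o f) ->
  cumul f x = cumul f 0 + primitive f x.
Proof.
move=> intf; have lf := integrable_locint intf.
have p0 : primitive f 0 = 0 by rewrite /primitive subrr.
have [x0|x0] := leP 0 x.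
  by have := cumulB intf x0; rewrite -primitiveB// p0; lra.
by have := cumulB intf (ltW x0); rewrite -primitiveB ?ltW// p0; lra.
Qed.

Lemma cumul_dist f g x : mu.-integrable setT (EFin \o f) ->
  mu.-integrable setT (EFin \o g) ->
  ((`|cumul f x - cumul g x|)%:E <= Lp_dist 1 f g)%E.
Proof.
move=> intf intg; rewrite /cumul -RintegralB//; [|exact: integrableS intf|exact: integrableS intg].
have ifg := integrableB_Rfun measurableT intf intg.
rewrite /Lp_dist Lnorm1.
apply: (@le_trans _ _ (\int[mu]_(y in `]-oo, x]) (`|f y - g y|)%:E)%E).
  have -> : (\int[mu]_(y in `]-oo, x]) (`|f y - g y|)%:E =
      (\int[mu]_(y in `]-oo, x]) `|f y - g y|)%:E)%E.
    rewrite /Rintegral fineK//; apply: integrable_fin_num => //.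
    by apply: integrable_norm_Rfun; exact: integrableS ifg.
  by rewrite lee_fin le_normr_Rintegral//; exact: integrableS ifg.
apply: ge0_subset_integral => //.
by have /measurable_int := integrable_norm_Rfun ifg.
Qed.

(** The mass of [|f|] outside [[- n, n]] tends to 0 by dominated convergence, and two points on the
    same side enclose only such mass. The extra 1 in [n + 1] keeps the enclosed segment disjoint
    from the closed [[- n, n]]. *)
Lemma cumul_tail f e : mu.-integrable setT (EFin \o f) -> 0 < e ->
  exists M, forall x y, (M <= x /\ M <= y) \/ (x <= - M /\ y <= - M) ->
    `|cumul f x - cumul f y| <= e.
Proof.
move=> intf e0.
have mf : measurable_fun setT f by apply/measurable_EFinP; exact: measurable_int intf.
pose T n := \int[mu]_x (`|f x| * \1_(~` `[- n%:R, n%:R]) x).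
have Tn0 : T n @[n --> \oo] --> (0 : R).
  have -> : (0 : R) = \int[mu]_(x in setT) (cst 0 x : R) by rewrite Rintegral_cst// mul0r.
  apply: (@Rdominated_cvg _ _ _ _ (fun x => `|f x|)) => //.
  - move=> n; apply: measurable_funM; first exact: measurableT_comp.
    by apply: measurable_indic; exact: measurableC.
  - move=> x _; apply: cvg_near_cst; near=> n.
    rewrite indicE memNset ?mulr0//= => H; apply: H; rewrite in_itv/= -ler_norml.
    by near: n; exact: nbhs_infty_ger.
  - exact: integrable_norm_Rfun.
  - move=> n x _; rewrite normrM normr_id ler_piMr// indicE.
    by case: (_ \in _); rewrite ?normr1 ?normr0.
move/cvgrPdist_le : Tn0 => /(_ e e0) [n _ /(_ n (leqnn n))] /= Tn.
exists (n%:R + 1).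
have key x y : x <= y ->
    (n%:R + 1 <= x /\ n%:R + 1 <= y) \/ (x <= - (n%:R + 1) /\ y <= - (n%:R + 1)) ->
    `|cumul f x - cumul f y| <= e.
  move=> xy H; rewrite distrC cumulB//.
  have ifxy : mu.-integrable `[x, y] (EFin \o f) by exact: integrableS intf.
  apply: (le_trans (le_normr_Rintegral _ _)) => //.
  have -> : \int[mu]_(t in `[x, y]) `|f t| =
      \int[mu]_(t in `[x, y]) (`|f t| * \1_(~` `[- n%:R, n%:R]) t).
    apply: eq_Rintegral => z; rewrite inE/= in_itv/= => /andP[xz zy].
    rewrite indicE mem_set ?mulr1//= in_itv/= => /andP[].
    by case: H => -[]; lra.
  apply: le_trans (le_trans (ler_norm _) (_ : `|T n| <= e)); last first.
    by rewrite -normrN -[- T n]add0r.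
  rewrite /T -lee_fin.
  have i1 : mu.-integrable setT (EFin \o (fun x => `|f x| * \1_(~` `[- n%:R, n%:R]) x)).
    apply: (@integrableM_bounded _ _ _ _ 1) => //; first exact: integrable_norm_Rfun.
      by apply: measurable_indic; exact: measurableC.
    by move=> z _; rewrite indicE; case: (_ \in _); rewrite ?normr1 ?normr0.
  have i2 := integrable_fin_num _ i1.
  have i3 : mu.-integrable `[x, y] (EFin \o (fun x => `|f x| * \1_(~` `[- n%:R, n%:R]) x)).
    exact: integrableS i1.
  rewrite /Rintegral (fineK (i2 _))// (fineK (integrable_fin_num _ i3))//.
  apply: ge0_subset_integral => //; first exact: measurable_int i1.
  by move=> z _; rewrite lee_fin mulr_ge0.
move=> x y H; have [xy|yx] := leP x y; first exact: key.
by rewrite distrC; apply: key; [exact: ltW|case: H => -[]; tauto].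
Unshelve. all: by end_near. Qed.

Lemma cumul_bounded f : mu.-integrable setT (EFin \o f) ->
  exists B, forall x, `|cumul f x| <= B.
Proof.
move=> intf; exists (\int[mu]_y `|f y|) => x.
have ifx : mu.-integrable `]-oo, x] (EFin \o f) by exact: integrableS intf.
apply: (le_trans (le_normr_Rintegral _ _)) => //.
rewrite -lee_fin /Rintegral !fineK; last 2 first.
- by apply: integrable_fin_num => //; exact: integrable_norm_Rfun.
- by apply: integrable_fin_num => //; exact: integrable_norm_Rfun.
apply: ge0_subset_integral => //.
by have /measurable_int := integrable_norm_Rfun intf.
Qed.

End flow.

(** * Powers of the absolute value and the flux *)

Section abs_power.
Context {R : realType}.
Implicit Types (s p e : R).

Lemma powR_small p e : 0 < p -> 0 < e -> exists2 r, 0 < r &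
  forall s, `|s| < r -> `|s| `^ p <= e.
Proof.
move=> p0 e0; exists (e `^ p^-1); first exact: powR_gt0.
move=> s sr; have -> : e = (e `^ p^-1) `^ p.
  by rewrite -powRrM mulVf ?gt_eqF// powRr1// ltW.
by apply: ge0_ler_powR; rewrite ?nnegrE ?powR_ge0//; exact: ltW.
Qed.

Lemma continuous_abs_powR p : 0 < p -> continuous (fun s => `|s| `^ p).
Proof.
move=> p0 s; have [->|s0] := eqVneq s 0.
  apply/cvgrPdist_le => e e0; have [r r0 Hr] := powR_small p0 e0.
  rewrite normr0 powR0 ?gt_eqF//; near=> y; rewrite sub0r normrN.
  rewrite ger0_norm ?powR_ge0//; apply: Hr.
  by rewrite -normrN -[- y]add0r; near: y; exact: (nbhsx_ballx (0 : R) r r0).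
have c1 : {for s, continuous (fun s : R => `|s|)} by exact: norm_continuous.
have c2 : {for `|s|, continuous (fun s : R => s `^ p)}.
  by apply: is_derive_continuous; apply: is_derive1_powR; rewrite normr_gt0.
exact: (continuous_comp c1 c2).
Unshelve. all: by end_near. Qed.

Let norm_inv_le1 p : 0 < p -> `|(p + 1)^-1| <= 1.
Proof.
move=> p0; have p1 : 1 <= p + 1 by rewrite lerDr ltW.
rewrite ger0_norm ?invr_ge0 ?(le_trans ler01)// invf_le1//.
exact: lt_le_trans p1.
Qed.

Definition flux p s := s * `|s| `^ p / (p + 1).

Lemma fluxN p s : flux p (- s) = - flux p s.
Proof. by rewrite /flux normrN !mulNr. Qed.

(** Oddness reduces negative [s] to positive [s]; at 0 the remainder is [flux p h], at most
    [|h| ^ p * |h|]. *)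
Lemma der_flux p s : 0 < p -> is_derive s 1 (flux p) (`|s| `^ p).
Proof.
move=> p0; have p1 : p + 1 != 0 by rewrite gt_eqF// ltr_wpDr.
have pos s' : 0 < s' -> is_derive s' 1 (flux p) (`|s'| `^ p).
  move=> s0; have n : \forall y \near s', y * y `^ p / (p + 1) = flux p y.
    near=> y; rewrite /flux gtr0_norm//; near: y; exact: lt_nbhsr.
  apply: near_eq_is_derive n _.
  have d := derM (der_id s') (der_powR p s0 (der_id s')).
  have -> : `|s'| `^ p = (p + 1)^-1 * (1 * s' `^ p + s' * (p * s' `^ (p - 1) * 1)).
    rewrite gtr0_norm// !mul1r mulr1 mulrCA mulr_powRB1 ?ltW//.
    by field.
  rewrite (_ : (fun y => _) = (fun y => (p + 1)^-1 * (y * y `^ p))); last first.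
    by apply/funext => y; rewrite mulrC.
  exact: derZ.
have [s0|s0|<-] := ltgtP 0 s; first exact: pos.
  have -> : flux p = (fun y => - flux p (- y)).
    by apply/funext => y; rewrite fluxN opprK.
  have ns0 : 0 < - s by rewrite oppr_gt0.
  have := derN (der_comp (pos _ ns0) (derN (der_id s))).
  by rewrite normrN mulrN1 opprK.
rewrite normr0 powR0 ?gt_eqF//; apply/is_deriveP => e e0.
have [r r0 Hr] := powR_small p0 e0; exists r => // h hr.
rewrite add0r mul0r subr0 {2}/flux !mul0r subr0 /flux normrM normrM.
rewrite [`|_ `^ _|]ger0_norm ?powR_ge0// -mulrA mulrC ler_wpM2r//.
apply: le_trans (Hr h hr); rewrite ler_piMr ?powR_ge0//.
exact: norm_inv_le1.
Unshelve. all: by end_near. Qed.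

Lemma flux_small p s : 0 < p -> `|s| <= 1 -> `|flux p s| <= `|s|.
Proof.
move=> p0 s1; rewrite /flux !normrM [`|_ `^ _|]ger0_norm ?powR_ge0//.
rewrite -mulrA ler_piMr// mulr_ile1 ?powR_ge0//.
- have -> : 1 = 1 `^ p :> R by rewrite powR1.
  by apply: ge0_ler_powR; rewrite ?nnegrE//; exact: ltW.
- exact: norm_inv_le1.
Qed.

End abs_power.

(** * From solutions to the pointwise integrated equation *)

Section regular_flow.
Context {R : realType}.
Notation mu := (@lebesgue_measure R).
Implicit Types (f g J : R -> R) (x a b c t s : R).

(* What the maximum principles need of a solution [u]: [P t] is the distribution
   function of [u t], [w t] its [C^1] representative and [wx t] the derivative of
   the latter.  Integrated over an interval, the equation holds pointwise and
   involves neither [u_t] nor [u_xx]. *)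
Record regular_flow (q alpha nu : R) J (P w wx : R -> R -> R) : Prop := {
  rf_dP : forall t x, 0 < t -> is_derive x 1 (P t) (w t x);
  rf_dw : forall t x, 0 < t -> is_derive x 1 (w t) (wx t x);
  rf_cwx : forall t, 0 < t -> continuous (wx t);
  rf_time : forall t e : R, 0 <= t -> 0 < e -> exists2 r : R, 0 < r &
    forall s, 0 <= s -> `|s - t| < r -> forall x, `|P s x - P t x| <= e;
  rf_tail : forall t e : R, 0 <= t -> 0 < e -> exists M : R, forall x y,
    (M <= x /\ M <= y) \/ (x <= - M /\ y <= - M) -> `|P t x - P t y| <= e;
  rf_bnd : forall t, 0 <= t -> exists B, forall x, `|P t x| <= B;
  rf_wx : forall a b, 0 < a -> exists L, forall t x, a <= t <= b -> `|wx t x| <= L;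
  rf_eq : forall t a b, 0 < t -> a <= b ->
    is_derive t 1 (fun s => P s b - P s a)
      (- (flux (q - 1) (w t b) - flux (q - 1) (w t a))
       + alpha * (\int[mu]_h (J h * (P t (b - h) - P t (a - h))) - (P t b - P t a))
       + nu * (wx t b - wx t a)) }.

Lemma continuous_Lp1_integrable (I : set R) (u : R -> R -> R) t :
  continuous_Lp 1 I u -> I t -> mu.-integrable setT (EFin \o u t).
Proof. by move=> [H _] /H /Lfun1_integrable. Qed.

(** Exponent 2 yields the representatives and the bound on [wx] away from time 0; continuity in L^1
    up to time 0 yields the uniform statements on [P]. *)
Lemma solution_regular_flow q alpha nu J phi u : 1 < q ->
  mu.-integrable setT (EFin \o J) -> is_solution q alpha nu J phi u ->
  exists w wx : R -> R -> R,
    regular_flow q alpha nu J (fun t => cumul (u t)) w wx /\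
    forall t, 0 < t -> {ae mu, forall x, u t x = w t x}.
Proof.
move=> q1 iJ [cu u0 [ut [ux [uxx [reg eqn]]]]].
have It s : 0 < s -> (`]0, +oo[%classic : set R) s by move=> s0; rewrite /= in_itv/= s0.
have Ic s : 0 <= s -> (`[0, +oo[%classic : set R) s by move=> s0; rewrite /= in_itv/= s0.
have q0 : 0 < q - 1 by rewrite subr_gt0.
have [[W [cu2 cux cuxx]] C1] := reg 2 (ltr1n _ 2).
have iu t : 0 <= t -> mu.-integrable setT (EFin \o u t).
  by move=> t0; exact: continuous_Lp1_integrable cu (Ic t t0).
have mmu t : 0 <= t -> measurable_fun setT (u t).
  by move=> t0; apply/measurable_EFinP; exact: measurable_int (iu t t0).
pose N f := fine (Lnorm mu 2%:E (EFin \o f)).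
have N0 f : 0 <= N f by apply: fine_ge0; exact: Lnorm_ge0.
have NE f : f \in Lfun mu 2%:E -> Lnorm mu 2%:E (EFin \o f) = (N f)%:E.
  by move=> /Lfun_Lnorm fy; rewrite fineK// ge0_fin_numE ?Lnorm_ge0.
(* All positive times are served by one choice of representatives; at the other times the pair is an
   unconstrained default. *)
pose good t (p : (R -> R) * (R -> R)) := 0 < t ->
  [/\ {ae mu, forall x, u t x = p.1 x} /\ {ae mu, forall x, ux t x = p.2 x},
      forall x, is_derive x 1 p.1 (p.2 x), continuous p.2,
      forall a b, a <= b -> \int[mu]_(x in `[a, b]) uxx t x = p.2 b - p.2 a &
      forall x, `|p.2 x| <= 2 + N (ux t) ^+ 2 + N (uxx t) ^+ 2].
have [p Hp] : {p : R -> (R -> R) * (R -> R) & forall t, good t (p t)}.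
  apply: choice => t; rewrite /good; have [t0|t0] := ltP 0 t; last first.
    by exists (cst 0, cst 0).
  have [W1 W2] := W t (It t t0).
  have n1 : (Lnorm mu 2%:E (EFin \o ux t) <= (N (ux t))%:E)%E.
    by rewrite -NE//; exact/cux.1/It.
  have n2 : (Lnorm mu 2%:E (EFin \o uxx t) <= (N (uxx t))%:E)%E.
    by rewrite -NE//; exact/cuxx.1/It.
  have [w [wx H]] := W22_representative (N0 _) (N0 _) W1 W2 n1 n2.
  by exists (w, wx).
pose w t := (p t).1; pose wx t := (p t).2.
exists w, wx; split; last by move=> t t0; have [[]] := Hp t t0.
have dw t x : 0 < t -> is_derive x 1 (w t) (wx t x).
  by move=> t0; have [_ H _ _ _] := Hp t t0; exact: H.
have cwx t : 0 < t -> continuous (wx t).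
  by move=> t0; have [_ _ H _ _] := Hp t t0; exact: H.
have cw t : 0 < t -> continuous (w t).
  by move=> t0 x; exact: is_derive_continuous (dw t x t0).
have uw t : 0 < t -> {ae mu, forall x, u t x = w t x}.
  by move=> t0; have [[]] := Hp t t0.
have uxwx t : 0 < t -> {ae mu, forall x, ux t x = wx t x}.
  by move=> t0; have [[]] := Hp t t0.
split => //.
- move=> t x t0; have -> : cumul (u t) = (fun y => cumul (u t) 0 + primitive (w t) y).
    apply/funext => y; rewrite (cumul_primitive _ (iu t (ltW t0))).
    rewrite (@ae_primitive_eq _ _ (w t))//; first exact: mmu (ltW t0).
      exact: continuous_measurable (cw t t0) _.
    exact: uw.
  rewrite -[w t x]add0r; apply: (derD (der_cst _ x)).
  apply: is_derive_primitive; first exact/continuous_locint/cw.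
  exact: cw.
- move=> t e t0 e0; have [r r0 Hr] := continuous_Lp_lt cu (Ic t t0) e0.
  exists r => // s s0 st x; rewrite -lee_fin.
  apply: (le_trans (cumul_dist x (iu s s0) (iu t t0))).
  by apply: ltW; apply: Hr => //; exact: Ic.
- by move=> t e t0 e0; exact: cumul_tail (iu t t0) e0.
- by move=> t t0; exact: cumul_bounded (iu t t0).
- move=> a b a0.
  have abI t : a <= t <= b -> (`]0, +oo[%classic : set R) t.
    by move=> /andP[at_ _]; apply: It; exact: lt_le_trans at_.
  have l12 : 1 <= 2 :> R by rewrite ler1n.
  have [B1 B10 HB1] := continuous_Lp_bounded l12 cux abI.
  have [B2 B20 HB2] := continuous_Lp_bounded l12 cuxx abI.
  exists (2 + B1 ^+ 2 + B2 ^+ 2) => t x tab.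
  have t0 : 0 < t by have := abI t tab; rewrite /= in_itv/= andbT.
  have [_ _ _ _ /(_ x)] := Hp t t0; move/le_trans; apply.
  have := HB1 t tab; rewrite NE ?lee_fin; last exact/cux.1/It.
  have := HB2 t tab; rewrite NE ?lee_fin; last exact/cuxx.1/It.
  move=> h2 h1; rewrite lerD// ?lerD// ler_sqr ?nnegrE//.
move=> t a b t0 ab.
have n : \forall s \near t, \int[mu]_(x in `[a, b]) u s x = cumul (u s) b - cumul (u s) a.
  near=> s; rewrite cumulB//; apply: iu; apply: ltW.
  by near: s; exact: lt_nbhsr.
apply: near_eq_is_derive n _.
apply: der_eq (is_derive_Lp_integral t0 ab C1) _.
have lut : mu.-integrable `[a, b] (EFin \o ut t).
  by have [_ [H _] _] := C1; apply: Lfun2_locint; exact/H/It.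
have luxx : mu.-integrable `[a, b] (EFin \o uxx t).
  by apply: Lfun2_locint; exact/cuxx.1/It.
have lw : mu.-integrable `[a, b] (EFin \o w t) by exact/continuous_locint/cw.
have [lconv Iconv] := convolution_integral a b iJ (iu t (ltW t0)).
have df x : is_derive x 1 (fun y => flux (q - 1) (w t y)) (`|w t x| `^ (q - 1) * wx t x).
  by apply: der_comp (dw t x t0); exact: der_flux.
have cF : continuous (fun x => `|w t x| `^ (q - 1) * wx t x).
  move=> x.
  have := continuous_comp (cw t t0 x) (@continuous_abs_powR _ _ q0 (w t x)).
  by move=> H; apply: cvgM; [exact: H|exact: cwx].
have lF : mu.-integrable `[a, b] (EFin \o (fun x => `|w t x| `^ (q - 1) * wx t x)).
  exact: continuous_locint.
(* With [w] and [wx] in place of [u] and [u_x], the transport term is the exact derivative of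
   [flux (q - 1) (w t x)]. *)
transitivity (\int[mu]_(x in `[a, b]) (alpha * (convolution J (u t) x - w t x)
    + nu * uxx t x - `|w t x| `^ (q - 1) * wx t x)).
  apply: ae_Rintegral_eq => //.
  - by apply/measurable_EFinP; exact: measurable_int lut.
  - apply: measurable_funB; last exact: continuous_measurable.
    apply: measurable_funD; apply: measurable_funM => //.
      apply: measurable_funB; last exact: continuous_measurable (cw t t0) _.
      by apply/measurable_EFinP; exact: measurable_int lconv.
    by apply/measurable_EFinP; exact: measurable_int luxx.
  - have E1 := uw t t0; have E2 := uxwx t t0; have E3 := eqn t t0.
    apply: ae_imply2 E1 (ae_imply2 _ E2 E3); last first.
      by move=> x E2x E3x; exact: (conj E2x E3x).
    by move=> x /= -> [<- <-]; ring.
have lcw : mu.-integrable `[a, b] (EFin \o (fun x => convolution J (u t) x - w t x)).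
  exact: integrableB_Rfun.
have lacw : mu.-integrable `[a, b] (EFin \o (fun x => alpha * (convolution J (u t) x - w t x))).
  exact: integrableZ_Rfun.
have lnu : mu.-integrable `[a, b] (EFin \o (fun x => nu * uxx t x)).
  exact: integrableZ_Rfun.
rewrite RintegralB//; last exact: integrableD_Rfun.
rewrite RintegralD// !RintegralZl// RintegralB// (Rintegral_derive ab df cF).
have [_ _ _ -> // _] := Hp t t0.
rewrite Iconv.
have -> : \int[mu]_(x in `[a, b]) w t x = cumul (u t) b - cumul (u t) a.
  rewrite (cumulB (iu t (ltW t0)) ab); apply: ae_Rintegral_eq => //.
  - exact: continuous_measurable (cw t t0) _.
  - exact: measurable_funS (mmu t (ltW t0)).
  - by apply: ae_imply (uw t t0).
have -> : \int[mu]_h (J h * \int[mu]_(x in `[a - h, b - h]) u t x) =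
    \int[mu]_h (J h * (cumul (u t) (b - h) - cumul (u t) (a - h))).
  by apply: eq_Rintegral => h _; rewrite cumulB// ?lerD2r//; exact/iu/ltW.
by rewrite addrC addrA.
Unshelve. all: by end_near. Qed.

End regular_flow.

(** * Nonnegativity *)

Section extrema.
Context {R : realType}.
Notation mu := (@lebesgue_measure R).
Implicit Types (f g J : R -> R) (x y a b c t s h d e r : R).

(** Only earlier times are compared, since the extremum may sit at the final time. *)
Lemma der_left_min f t d a : a < t -> is_derive t 1 f d ->
  (forall s, a <= s <= t -> f t <= f s) -> d <= 0.
Proof.
move=> at_ /is_deriveP df fmin; rewrite leNgt; apply/negP => d0.
have [r r0 Hr] := df (d / 2) (divr_gt0 d0 (ltr0n _ 2)).
pose h := Num.min (r / 2) (t - a).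
have h0 : 0 < h by rewrite lt_min divr_gt0//= subr_gt0.
have hr : h <= r / 2 by rewrite ge_min lexx.
have ha : h <= t - a by rewrite ge_min lexx orbT.
have := Hr (- h); rewrite normrN gtr0_norm// => /(_ (le_lt_trans hr _)) H.
have {}H : `|f (t + - h) - f t - d * - h| <= d / 2 * h by apply: H; lra.
have := fmin (t - h) _; have -> : a <= t - h <= t by apply/andP; split; lra.
move=> /(_ isT) ft; move: H; rewrite ler_norml => /andP[_]; nra.
Qed.

(** A parabola of slope [a] touches [f] from below at [x]. Evaluating at [k] and [- k] bounds
    [d - a] on both sides; [k] makes the quadratic term at most [e / 2 * k]. *)
Lemma touch1 f x d a c r : 0 < r -> is_derive x 1 f d ->
  (forall h, `|h| < r -> f x + a * h - c * h ^+ 2 <= f (x + h)) -> d = a.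
Proof.
move=> r0 /is_deriveP df fmin.
pose c' := `|c|; have cc' : c <= c' by exact: ler_norm.
have c'0 : 0 <= c' by exact: normr_ge0.
apply/eqP; rewrite -subr_eq0 -normr_le0; apply/ler_addgt0Pr => e e0.
have [r' r'0 Hr] := df (e / 2) (divr_gt0 e0 (ltr0n _ 2)).
pose k := Num.min (Num.min (r / 2) (r' / 2)) (e / (2 * (c' + 1))).
have k0 : 0 < k by rewrite !lt_min !divr_gt0//= mulr_gt0// ltr_wpDl.
have kr : k < r.
  by apply: (@le_lt_trans _ _ (r / 2)); [rewrite !ge_min lexx|lra].
have kr' : k < r'.
  by apply: (@le_lt_trans _ _ (r' / 2)); [rewrite !ge_min lexx orbT|lra].
have kc : c' * k <= e / 2.
  apply: (@le_trans _ _ ((c' + 1) * (e / (2 * (c' + 1))))).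
    apply: ler_pM => //; [exact: ltW|by rewrite lerDl|by rewrite !ge_min lexx orbT].
  by rewrite le_eqVlt; apply/orP; left; apply/eqP; field; rewrite gt_eqF// ltr_wpDl.
have nk : `|k| = k by rewrite gtr0_norm.
have nNk : `|- k| = k by rewrite normrN.
have := Hr k; rewrite nk => /(_ kr'); rewrite ler_norml => /andP[_ H1].
have := Hr (- k); rewrite nNk => /(_ kr'); rewrite ler_norml => /andP[_ H2].
have := fmin k; rewrite nk => /(_ kr) H3.
have := fmin (- k); rewrite nNk => /(_ kr) H4.
have ck : c * k ^+ 2 <= e / 2 * k.
  by rewrite expr2 mulrA ler_pM2r// (le_trans _ kc)// ler_pM2r.
rewrite add0r ler_norml; apply/andP; split; rewrite -(ler_pM2r k0); nra.
Qed.

(** If [d] were below [- 2 * c], the function [f (x + y) - a * y + c * y ^ 2] would have negative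
    derivative for small [y > 0], against the minimality of its value at 0. *)
Lemma touch2 f g x d a c r : 0 < r -> (forall y, is_derive y 1 f (g y)) ->
  is_derive x 1 g d ->
  (forall h, `|h| < r -> f x + a * h - c * h ^+ 2 <= f (x + h)) ->
  g x = a /\ - (2 * c) <= d.
Proof.
move=> r0 df dg fmin; have gx := touch1 r0 (df x) fmin; split => //.
rewrite leNgt; apply/negP => d0.
have e0 : 0 < (- (2 * c) - d) / 2 by rewrite divr_gt0// subr_gt0.
move/is_deriveP : dg => /(_ _ e0)[r' r'0 Hr].
pose k := Num.min (r / 2) (r' / 2).
have k0 : 0 < k by rewrite !lt_min !divr_gt0.
have kr : k < r by apply: (@le_lt_trans _ _ (r / 2)); [rewrite !ge_min lexx|lra].
have kr' : k < r' by apply: (@le_lt_trans _ _ (r' / 2)); [rewrite !ge_min lexx orbT|lra].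
pose F y := f (x + y) - a * y + c * y ^+ 2.
have dF y : is_derive y 1 F (g (x + y) - a + c * (2 * y)).
  apply: derD.
    apply: derB.
      have := der_comp (df (x + y)) (derD (der_cst x y) (der_id y)).
      by rewrite add0r mulr1.
    by have := derZ a (der_id y); rewrite mulr1.
  by have := derZ c (derX 2 (der_id y)); rewrite mulr1 expr1.
have cF : {within `[0, k], continuous F}.
  by apply: continuous_subspaceT => y; exact: is_derive_continuous (dF y).
have [z zk] := MVT k0 (fun y _ => dF y) cF.
rewrite /F addr0 mulr0 subr0 expr0n/= mulr0 addr0 subr0.
move: zk; rewrite in_itv/= => /andP[z0 zk].
have := fmin k; rewrite gtr0_norm// => /(_ kr) H1.
have := Hr z; rewrite gtr0_norm// => /(_ (lt_trans zk kr')).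
rewrite ler_norml gx => /andP[_ H2] E.
have : 0 <= (g (x + z) - a + c * (2 * z)) * k by rewrite -E; lra.
by rewrite pmulr_lge0//; nra.
Qed.

(** An explicit bump: maximum 1 at 0, at most 1/2 when [|x| >= 1], with derivative [theta1] bounded
    by 1. Being rational, it has estimates that are polynomial inequalities. *)
Definition theta x := (1 + x ^+ 2)^-1.
Definition theta1 x := - (2 * x) / (1 + x ^+ 2) ^+ 2.

Let den_gt0 x : 0 < 1 + x ^+ 2. Proof. by rewrite ltr_wpDr// sqr_ge0. Qed.

Lemma theta_gt0 x : 0 < theta x. Proof. by rewrite invr_gt0. Qed.

Lemma theta_le1 x : theta x <= 1.
Proof. by rewrite invf_le1// lerDl sqr_ge0. Qed.

Lemma theta_half x : 1 <= `|x| -> theta x <= 2^-1.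
Proof.
move=> x1; rewrite lef_pV2 ?posrE//.
have : 1 <= `|x| ^+ 2 by rewrite expr_ge1.
by rewrite real_normK ?num_real//; lra.
Qed.

Lemma theta0 : theta 0 = 1. Proof. by rewrite /theta expr0n/= addr0 invr1. Qed.

Lemma theta1_bound x : `|theta1 x| <= 1.
Proof.
rewrite /theta1 normrM normrN normfV [`|(_ ^+ 2)|]ger0_norm ?sqr_ge0//.
rewrite ler_pdivrMr ?exprn_gt0// mul1r ler_norml.
have A1 : 1 <= 1 + x ^+ 2 by rewrite lerDl sqr_ge0.
have A2 : 1 + x ^+ 2 <= (1 + x ^+ 2) ^+ 2 by rewrite expr2 ler_peMl// (le_trans ler01).
have H1 := sqr_ge0 (x - 1); have H2 := sqr_ge0 (x + 1); rewrite !expr2 in A1 A2 H1 H2 *.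
by apply/andP; split; nra.
Qed.

(** This encodes a second derivative at least -2. With denominators cleared, it follows from
    [A ^ 2 * B >= A * B >= A + (x + h) ^ 2] and [4 x^2 + 2 x h + (x + h)^2 = (2 x + h)^2 + x^2]. *)
Lemma theta_touch x h : theta x + theta1 x * h - h ^+ 2 <= theta (x + h).
Proof.
rewrite -subr_ge0 /theta /theta1; set A := 1 + x ^+ 2; set B := 1 + (x + h) ^+ 2.
have A0 : 0 < A by exact: den_gt0. have B0 : 0 < B by exact: den_gt0.
have -> : B^-1 - (A^-1 + - (2 * x) / A ^+ 2 * h - h ^+ 2) =
  h ^+ 2 * (4 * x ^+ 2 + 2 * x * h - A + A ^+ 2 * B) / (A ^+ 2 * B).
  by rewrite /A /B; field; rewrite !gt_eqF.
apply: divr_ge0; last by rewrite mulr_ge0 ?sqr_ge0// ltW.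
apply: mulr_ge0; first exact: sqr_ge0.
have A1 : 1 <= A by rewrite lerDl sqr_ge0.
have AB : A * B <= A ^+ 2 * B by rewrite expr2 -mulrA ler_peMl// ltW// mulr_gt0.
have : A + (x + h) ^+ 2 <= A * B.
  by rewrite /B mulrDr mulr1 lerD2l ler_peMl// sqr_ge0.
have := sqr_ge0 (2 * x + h); have := sqr_ge0 x; rewrite !expr2; nra.
Qed.

Lemma continuous_theta : continuous theta.
Proof.
move=> x; have d := derD (der_cst 1 x) (derX 2 (der_id x)).
have n0 : 1 + x ^+ 2 != 0 by rewrite gt_eqF.
have dV : is_derive x 1 theta _ := @derV _ (fun y => 1 + y ^+ 2) x _ n0 d.
exact: is_derive_continuous dV.
Qed.

End extrema.

Section perturbed_minimum.
Context {R : realType}.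
Notation mu := (@lebesgue_measure R).
Implicit Types (f g J : R -> R) (x y a b c t s h d e r l : R).

Lemma theta_ge0 x : 0 <= theta x.
Proof. exact/ltW/theta_gt0. Qed.

(* [W] need not attain its infimum; a bump of height [k] centred at a [k / 2]-minimizer
   confines the minimizers of the difference to a compact set. *)
Lemma perturbed_min (W : R -> R -> R -> R) T k m0 : 0 <= T -> 0 < k ->
  continuous (fun z : R * R * R => W z.1.1 z.1.2 z.2) ->
  (forall t x l, 0 <= t <= T -> 0 <= l -> m0 <= W t x l) ->
  exists x1 y1 t x l, [/\ 0 <= t <= T, 0 <= l,
    forall s x' l', 0 <= s <= T -> 0 <= l' ->
      W t x l - k * (theta (x - x1) * theta (x + l - y1)) <=
      W s x' l' - k * (theta (x' - x1) * theta (x' + l' - y1)) &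
    forall s x' l', 0 <= s <= T -> 0 <= l' -> W t x l <= W s x' l' + k].
Proof.
move=> T0 k0 cW Wm0.
pose S := [set w | exists t x l, [/\ 0 <= t <= T, 0 <= l & w = W t x l]].
have T00 : 0 <= (0 : R) <= T by rewrite lexx T0.
have infS : has_inf S.
  split; first by exists (W 0 0 0), 0, 0, 0.
  by exists m0 => _ [t [x [l [tT l0 ->]]]]; exact: Wm0.
have lbS t x l : 0 <= t <= T -> 0 <= l -> inf S <= W t x l.
  by move=> tT l0; apply: ge_inf; [exact: infS.2|exists t, x, l].
have k20 : 0 < k / 2 by rewrite divr_gt0.
have [_ [t1 [x1 [l1 [t1T l10 ->]]]] W1] := inf_adherent k20 infS.
pose y1 := x1 + l1.
pose Phi (z : R * R * R) := W z.1.1 z.1.2 z.2 - k * (theta (z.1.2 - x1) * theta (z.1.2 + z.2 - y1)).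
have cPhi : continuous Phi.
  move=> z; apply: cvgB; first exact: cW.
  apply: cvgM; first exact: cvg_cst.
  have c1 : continuous (fun z : R * R * R => z.1.2 - x1).
    move=> {}z; apply: cvgB; last exact: cvg_cst.
    by apply: (cvg_comp fst snd cvg_fst); exact: cvg_snd.
  have c2 : continuous (fun z : R * R * R => z.1.2 + z.2 - y1).
    move=> {}z; apply: cvgB; last exact: cvg_cst.
    apply: cvgD; last exact: cvg_snd.
    by apply: (cvg_comp fst snd cvg_fst); exact: cvg_snd.
  apply: cvgM.
    exact: (continuous_comp (c1 z) (@continuous_theta _ _)).
  exact: (continuous_comp (c2 z) (@continuous_theta _ _)).
(* Outside [K] one factor [theta] is at most 1/2, so the bump removes at most [k / 2], while at
   [(t1, x1, l1)] the perturbed value is already below [inf S - k / 2]. The bound [l1 + 2] comes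
   from [x > x1 - 1] and [x + l < y1 + 1]. *)
pose K : set (R * R * R) := (`[0, T] `*` `[x1 - 1, x1 + 1]) `*` `[0, l1 + 2].
have cK : compact K.
  by apply: compact_setX; [apply: compact_setX|]; exact: segment_compact.
have K1 : K (t1, x1, l1).
  rewrite /K/=; split; [split|]; rewrite /= in_itv/=; [done|apply/andP; split; lra..].
have K0 : K !=set0 by exists (t1, x1, l1).
have [[[t x] l] /set_mem /= zK zmin] := compact_EVT_min K0 cK (continuous_subspaceT cPhi).
have {}zmin z : K z -> Phi (t, x, l) <= Phi z by move=> Kz; apply: zmin; rewrite inE.
have [[]] := zK; rewrite /= !in_itv/= => tT xx /andP[l0 _].
have Phi1 : Phi (t1, x1, l1) < inf S - k / 2.
  by rewrite /Phi/= !subrr theta0 mulr1 mulr1; lra.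
have thh a b : 0 <= k * (theta a * theta b) <= k.
  apply/andP; split; first by rewrite !mulr_ge0 ?theta_ge0// ltW.
  by rewrite ler_piMr ?(ltW k0)// mulr_ile1 ?theta_le1 ?theta_ge0.
exists x1, y1, t, x, l; split => //.
  move=> s x' l' sT l'0; rewrite -/(Phi (t, x, l)) -/(Phi (s, x', l')).
  have [Kz|nK] := pselect (K (s, x', l')); first exact: zmin.
  have : Phi (t, x, l) <= inf S - k / 2 by rewrite (le_trans (zmin _ K1))// ltW.
  move/le_trans; apply; rewrite /Phi/=.
  suff : k * (theta (x' - x1) * theta (x' + l' - y1)) <= k / 2.
    by have := lbS s x' l' sT l'0; lra.
  rewrite ler_pM2l//.
  have [xx'|xx'] := leP 1 `|x' - x1|.
    by rewrite -[2^-1]mulr1 ler_pM ?theta_le1 ?theta_half ?theta_ge0.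
  rewrite mulrC -[2^-1]mulr1 ler_pM ?theta_le1 ?theta_half ?theta_ge0//.
  rewrite leNgt; apply/negP => yy; apply: nK; rewrite /K/=.
  move: xx' yy; rewrite !ltr_norml => /andP[xa xb] /andP[ya yb].
  split; [split|]; rewrite /= in_itv/= ?sT//.
    by apply/andP; split; lra.
  by rewrite l'0 /=; move: ya yb; rewrite /y1; lra.
move=> s x' l' sT l'0.
have := zmin _ K1; have := lbS s x' l' sT l'0.
have /andP[] := thh (x - x1) (x + l - y1); move: Phi1; rewrite /Phi/=; lra.
Qed.

Lemma average_ge J g c : mu.-integrable setT (EFin \o J) ->
  {ae mu, forall x, 0 <= J x} -> \int[mu]_x J x = 1 ->
  continuous g -> (exists B, forall x, `|g x| <= B) -> (forall x, c <= g x) ->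
  c <= \int[mu]_x (J x * g x).
Proof.
move=> iJ J0 J1 cg [B gB] gc.
have mg : measurable_fun setT g by exact: continuous_measurable.
have mJ : measurable_fun setT J by apply/measurable_EFinP; exact: measurable_int iJ.
have inJ := integrable_norm_Rfun iJ.
have mnJ : measurable_fun setT (fun x => `|J x|) by exact: measurableT_comp.
(* [J] is nonnegative only almost everywhere; [|J|] allows a pointwise comparison. *)
have -> : \int[mu]_x (J x * g x) = \int[mu]_x (`|J x| * g x).
  apply: ae_Rintegral_eq => //; [exact: measurable_funM..|].
  by apply: ae_imply J0 => x Jx; rewrite ger0_norm.
have -> : c = \int[mu]_x (c * `|J x|).
  rewrite RintegralZl// -[LHS]mulr1 -J1; congr (_ * _); apply: ae_Rintegral_eq => //.
  by apply: ae_imply J0 => x Jx; rewrite ger0_norm.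
apply: le_Rintegral => //; first exact: integrableZ_Rfun.
  by apply: integrableM_bounded => // x _; exact: gB.
by move=> x _; rewrite mulrC ler_wpM2l.
Qed.

End perturbed_minimum.

(** * Maximum principle for increments of the distribution function *)

Section nonnegativity.
Context {R : realType}.
Notation mu := (@lebesgue_measure R).
Implicit Types (f g : R -> R) (x y a b c t s h d e r l : R).
Variables (q alpha nu : R) (J : R -> R) (P w wx : R -> R -> R).
Hypothesis rf : regular_flow q alpha nu J P w wx.

(** [P t] is uniformly close to [P (t + r / 2)], which is differentiable; this covers [t = 0]. *)
Lemma rf_cont t : 0 <= t -> continuous (P t).
Proof.
have pos s : 0 < s -> continuous (P s).
  by move=> s0 x; exact: is_derive_continuous (rf_dP rf x s0).
move=> t0 x; apply/cvgrPdist_le => e e0.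
have e30 : 0 < e / 3 by rewrite divr_gt0.
have [r r0 Hr] := rf_time rf t0 e30.
have s0 : 0 < t + r / 2 by rewrite ltr_wpDl// divr_gt0.
have st : `|t + r / 2 - t| < r.
  by rewrite addrC addKr gtr0_norm ?divr_gt0//; lra.
have {}Hr := Hr _ (ltW s0) st.
have /cvgrPdist_le /(_ _ e30) := pos _ s0 x.
apply: filterS => y Hy.
have := Hr x; have := Hr y; move: Hy; rewrite !ler_norml.
by move=> /andP[? ?] /andP[? ?] /andP[? ?]; apply/andP; split; lra.
Qed.

(** Freezes negative times at 0, so that joint continuity is stated without a subspace topology. *)
Definition clamp t := Num.max t 0.

Lemma clamp_ge0 t : 0 <= clamp t. Proof. by rewrite le_max lexx orbT. Qed.

Lemma clamp_id t : 0 <= t -> clamp t = t.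
Proof. by move=> t0; apply/max_idPl. Qed.

Lemma clamp_dist s t : `|clamp s - clamp t| <= `|s - t|.
Proof.
rewrite /clamp; have [s0|s0] := leP s 0; have [t0|t0] := leP t 0.
- by rewrite subrr normr0.
- by rewrite sub0r normrN gtr0_norm// distrC gtr0_norm ?subr_gt0; lra.
- by rewrite subr0 gtr0_norm// gtr0_norm ?subr_gt0; lra.
- by [].
Qed.

Lemma rf_joint : continuous (fun z : R * R => P (clamp z.1) z.2).
Proof.
move=> [t x]; apply/cvgrPdist_le => e e0 /=.
have e20 : 0 < e / 2 by rewrite divr_gt0.
have [r r0 Hr] := rf_time rf (clamp_ge0 t) e20.
have /cvgrPdist_le /(_ _ e20) Hx := @rf_cont _ (clamp_ge0 t) x.
exists (ball t r, [set y | `|P (clamp t) x - P (clamp t) y| <= e / 2]).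
  by split => //; exact: nbhsx_ballx.
move=> [s y] [/= ts yx].
have := Hr (clamp s) (clamp_ge0 s) _ y.
move=> /(_ (le_lt_trans (clamp_dist _ _) _)); rewrite distrC => /(_ ts).
move: yx; rewrite !ler_norml => /andP[? ?] /andP[? ?]; apply/andP; split; lra.
Qed.

Lemma rf_bounded T : exists2 B, 0 <= B & forall t x, 0 <= t <= T -> `|P t x| <= B.
Proof.
have [B HB] : exists B, forall t, 0 <= t <= T -> forall x, `|P t x| <= B.
  apply: (@segment_bound _ (fun B t => forall x, `|P t x| <= B)).
    by move=> B B' s BB' H x; exact: le_trans BB'.
  move=> t /andP[t0 tT]; have [B HB] := rf_bnd rf t0.
  have [r r0 Hr] := rf_time rf t0 ltr01.
  exists (B + 1), r; split => // s /andP[s0 sT] st x.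
  have := Hr s s0 st x; have := HB x; rewrite !ler_norml.
  by move=> /andP[? ?] /andP[? ?]; apply/andP; split; lra.
exists `|B| => // t x tT; apply: le_trans (HB t tT x) _; exact: ler_norm.
Qed.

Lemma rf_joint3 (c k : R) :
  continuous (fun z : R * R * R => P (clamp z.1.1) (z.1.2 + c + k * z.2)).
Proof.
move=> z.
have a1 : (fun z : R * R * R => z.1.1) @ z --> z.1.1.
  by apply: (cvg_comp fst fst cvg_fst); exact: cvg_fst.
have a2 : (fun z : R * R * R => z.1.2 + c + k * z.2) @ z --> z.1.2 + c + k * z.2.
  apply: cvgD; last by apply: cvgM; [exact: cvg_cst|exact: cvg_snd].
  apply: cvgD; last exact: cvg_cst.
  by apply: (cvg_comp fst snd cvg_fst); exact: cvg_snd.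
have c1 : (fun z : R * R * R => (z.1.1, z.1.2 + c + k * z.2)) @ z --> (z.1.1, z.1.2 + c + k * z.2).
  exact: cvg_pair a1 a2.
exact: (cvg_comp _ _ c1 (@rf_joint _)).
Qed.

Hypotheses (q1 : 1 < q) (alpha0 : 0 <= alpha) (nu0 : 0 <= nu).
Hypotheses (iJ : mu.-integrable setT (EFin \o J))
  (J0 : {ae mu, forall x, 0 <= J x}) (J1 : \int[mu]_x J x = 1).
Hypothesis P0 : forall a b, a <= b -> P 0 a <= P 0 b.

(* Maximum principle for [P t y - P t x] on [x <= y], where the time derivative
   involves the derivatives of [P] only through [w] and [wx]. *)
Lemma rf_nondecreasing t a b : 0 <= t -> a <= b -> P t a <= P t b.
Proof.
rewrite le_eqVlt => /predU1P[<-|T0 ab]; first exact: P0.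
rewrite leNgt; apply/negP => neg; set T := t in T0 neg *.
(* [eta * T = d / 2] and [k <= d / 4] keep [W] negative at the point to be found. [D] collects the
   errors at scale [k]: two flux values, the nonlocal term, and two second derivatives of size
   [2 * k] each. [k <= 1] serves [flux_small]. *)
pose d := P T a - P T b; have d0 : 0 < d by rewrite subr_gt0.
pose eta := d / (2 * T); have eta0 : 0 < eta by rewrite divr_gt0// mulr_gt0.
pose D := 2 + alpha + 4 * nu; have D0 : 0 < D by rewrite /D; move: alpha0 nu0; lra.
pose k := Num.min 1 (Num.min (d / 4) (eta / (2 * D))).
have k0 : 0 < k by rewrite !lt_min ltr01 !divr_gt0//= mulr_gt0.
have k1 : k <= 1 by rewrite ge_min lexx.
have kd : k <= d / 4 by rewrite !ge_min lexx orbT.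
have keta : k * D < eta.
  have : k <= eta / (2 * D) by rewrite !ge_min lexx !orbT.
  rewrite -(ler_pM2r D0) => /le_lt_trans; apply.
  by have -> : eta / (2 * D) * D = eta / 2; [field; rewrite gt_eqF|lra].
pose W s x l := P (clamp s) (x + 0 + 1 * l) - P (clamp s) (x + 0 + 0 * l) + eta * s.
have cW : continuous (fun z : R * R * R => W z.1.1 z.1.2 z.2).
  move=> z; apply: cvgD; first by apply: cvgB; exact: rf_joint3.
  apply: cvgM; first exact: cvg_cst.
  by apply: (cvg_comp fst fst cvg_fst); exact: cvg_fst.
have WE s x l : 0 <= s -> W s x l = P s (x + l) - P s x + eta * s.
  by move=> s0; rewrite /W clamp_id// mul1r mul0r !addr0.
have [B B0 HB] := rf_bounded T.
have Wm s x l : 0 <= s <= T -> 0 <= l -> - (2 * B) <= W s x l.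
  move=> /andP[s0 sT] l0; rewrite WE//.
  have := HB s (x + l); have := HB s x; rewrite s0 sT => /(_ isT) + /(_ isT).
  have : 0 <= eta * s by rewrite mulr_ge0// ltW.
  by rewrite !ler_norml => ? /andP[? ?] /andP[? ?]; lra.
have [x1 [y1 [s [x [l [sT l0 Phi_min W_min]]]]]] := perturbed_min (ltW T0) k0 cW Wm.
have /andP[s0 sT'] := sT.
(* A negative value excludes [s = 0], by [P0], and [l = 0], where the increment vanishes. *)
have Wneg : W s x l < 0.
  have H : W s x l <= W T a (b - a) + k.
    by apply: W_min; rewrite ?subr_ge0// lexx ltW.
  have ab' : a + (b - a) = b by ring.
  rewrite (WE T a (b - a) (ltW T0)) ab' in H.
  have E : eta * T = d / 2 by rewrite /eta; field; rewrite gt_eqF.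
  by rewrite E in H; rewrite /d in kd H *; lra.
have {}s0 : 0 < s.
  rewrite lt_neqAle s0 andbT; apply/eqP => s00; move: Wneg.
  rewrite WE// -s00 mulr0 addr0 ltNge => /negP; apply.
  by rewrite subr_ge0 P0// lerDl.
have {}l0 : 0 < l.
  rewrite lt_neqAle l0 andbT; apply/eqP => l00; move: Wneg.
  rewrite WE ?ltW// -l00 addr0 subrr add0r ltNge => /negP; apply.
  by rewrite mulr_ge0// ltW.
set y := x + l in Phi_min.
have Pmin s' x' y' : 0 <= s' <= T -> x' <= y' ->
    P s y - P s x + eta * s - k * (theta (x - x1) * theta (y - y1)) <=
    P s' y' - P s' x' + eta * s' - k * (theta (x' - x1) * theta (y' - y1)).
  move=> s'T xy'; have /andP[s'0 _] := s'T.
  have := Phi_min s' x' (y' - x') s'T; rewrite subr_ge0 => /(_ xy').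
  have e' : x' + (y' - x') = y' by ring.
  by rewrite (WE s x l (ltW s0)) (WE s' _ _ s'0) e'.
pose cy := k * theta (x - x1); pose cx := k * theta (y - y1).
have c_bnd u : 0 <= k * theta u <= k.
  by rewrite mulr_ge0 ?theta_ge0 ?(ltW k0)//= ler_piMr ?theta_le1// ltW.
have /andP[cy0 cyk] : 0 <= cy <= k by exact: c_bnd.
have /andP[cx0 cxk] : 0 <= cx <= k by exact: c_bnd.
(* With the other variables frozen, the bump is [cy * theta (y - y1)], and the parabola below it
   touches [P s] at [y]. *)
have [wy wxy] : w s y = cy * theta1 (y - y1) /\ - (2 * cy) <= wx s y.
  apply: (@touch2 _ (P s) (w s) y _ _ _ l) => //.
  - by move=> z; exact: (rf_dP rf z s0).
  - exact: (rf_dw rf y s0).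
  move=> h; rewrite ltr_norml => /andP[hl _].
  have := Pmin s x (y + h) sT; have -> : x <= y + h by rewrite /y; lra.
  move=> /(_ isT) H.
  have := ler_wpM2l cy0 (theta_touch (y - y1) h).
  have -> : y - y1 + h = y + h - y1 by ring.
  by move: H; rewrite /cy; lra.
have [wX wxx] : - w s x = cx * theta1 (x - x1) /\ - (2 * cx) <= - wx s x.
  apply: (@touch2 _ (fun z => - P s z) (fun z => - w s z) x _ _ _ l) => //.
  - by move=> z; apply: derN; exact: (rf_dP rf z s0).
  - by apply: derN; exact: (rf_dw rf x s0).
  move=> h; rewrite ltr_norml => /andP[_ hl].
  have := Pmin s (x + h) y sT; have -> : x + h <= y by rewrite /y; lra.
  move=> /(_ isT) H.
  have := ler_wpM2l cx0 (theta_touch (x - x1) h).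
  have -> : x - x1 + h = x + h - x1 by ring.
  by move: H; rewrite /cx; lra.
(* Stationarity makes [w] of size [k] at both points, so the nonlinear transport term is negligible
   there. *)
have fl z c th : 0 <= c <= k -> `|th| <= 1 -> z = c * th -> `|flux (q - 1) z| <= k.
  move=> /andP[c0 ck] th1 zE.
  have zk : `|z| <= k.
    by rewrite zE normrM ger0_norm// (le_trans _ ck)// ler_piMr.
  apply: le_trans zk; apply: flux_small; rewrite ?subr_gt0//.
  by rewrite zE normrM ger0_norm// (le_trans _ k1)// (le_trans _ ck)// ler_piMr.
have fy : `|flux (q - 1) (w s y)| <= k.
  by apply: (fl _ cy _ _ _ wy); rewrite ?cy0 ?theta1_bound.
have fx : `|flux (q - 1) (w s x)| <= k.
  rewrite -normrN -fluxN.
  by apply: (fl _ cx _ _ _ wX); rewrite ?cx0 ?theta1_bound.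
have avg : P s y - P s x - k <= \int[mu]_h (J h * (P s (y - h) - P s (x - h))).
  apply: average_ge => //.
  - move=> h; have c0 z : continuous (fun h => P s (z - h)).
      move=> h'; apply: (cvg_comp (fun h => z - h) (P s)).
        by apply: cvgB; [exact: cvg_cst|exact: cvg_id].
      by apply: rf_cont; exact: ltW.
    by apply: cvgB; exact: c0.
  - exists (B + B) => h; rewrite (le_trans (ler_normB _ _))// lerD// HB//.
  move=> h; have := Pmin s (x - h) (y - h) sT; rewrite lerD2r => /(_ (ltW _)).
  have -> : x < y by rewrite ltrDl.
  move=> /(_ isT).
  have : k * (theta (x - x1) * theta (y - y1)) <= k.
    by rewrite ler_piMr ?(ltW k0)// mulr_ile1 ?theta_le1 ?theta_ge0.
  have : 0 <= k * (theta (x - h - x1) * theta (y - h - y1)).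
    by rewrite !mulr_ge0 ?theta_ge0// ltW.
  lra.
have xy : x <= y by rewrite lerDl ltW.
have dt := derD (rf_eq rf s0 xy) (derZ eta (der_id s)).
have := der_left_min s0 dt; set dd := (X in X <= 0) => H.
have {}H : dd <= 0.
  apply: H => s' /andP[s'0 s's].
  have s'T : 0 <= s' <= T by rewrite s'0 (le_trans s's).
  by have := Pmin s' x y s'T xy; lra.
(* The time derivative is at least [eta - k * D], which is positive. *)
move: H; rewrite /dd; apply/negP; rewrite -ltNge.
move: fy fx avg; set F1 := flux _ _; set F2 := flux _ _; set A := \int[mu]_h _.
rewrite !ler_norml => /andP[? ?] /andP[? ?] avg.
have h1 : - (alpha * k) <= alpha * (A - (P s y - P s x)).
  by rewrite -mulrN ler_wpM2l//; lra.
have h2 : - (nu * (4 * k)) <= nu * (wx s y - wx s x).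
  by rewrite -mulrN ler_wpM2l//; lra.
have kD : k * D = 2 * k + alpha * k + nu * (4 * k) by rewrite /D; ring.
by rewrite kD in keta; lra.
Qed.

End nonnegativity.

(** * The one-sided Lipschitz estimate *)

Section power_inequalities.
Context {R : realType}.
Implicit Types (x y a b e p r s A B : R).

(** For [0 < z <= x + y] and [p <= 1], [(z / (x + y)) ^ p >= z / (x + y)]; add the cases [z = x] and
    [z = y]. *)
Lemma powR_subadditive p x y : 0 < p -> p <= 1 -> 0 <= x -> 0 <= y ->
  (x + y) `^ p <= x `^ p + y `^ p.
Proof.
move=> p0 p1; rewrite le_eqVlt => /predU1P[<-|x0].
  by rewrite add0r powR0 ?gt_eqF// add0r.
rewrite le_eqVlt => /predU1P[<-|y0].
  by rewrite addr0 powR0 ?gt_eqF// addr0.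
have S0 : 0 < x + y by rewrite addr_gt0.
have H z : 0 < z -> z <= x + y -> (x + y) `^ p * (z / (x + y)) <= z `^ p.
  move=> z0 zS; have -> : z `^ p = (x + y) `^ p * (z / (x + y)) `^ p.
    rewrite -powRM ?divr_ge0 ?ltW//; congr (_ `^ _).
    by rewrite mulrC divfK// gt_eqF.
  rewrite ler_wpM2l ?powR_ge0// ger1_powR// divr_gt0//=.
  by rewrite ler_pdivrMr// mul1r.
have xS : x <= x + y by rewrite lerDl ltW.
have yS : y <= x + y by rewrite lerDr ltW.
apply: le_trans (lerD (H x x0 xS) (H y y0 yS)).
by rewrite -mulrDr -mulrDl divff ?gt_eqF// mulr1.
Qed.

Lemma abs_powR_dist p x y : 0 < p -> p <= 1 ->
  `|x| `^ p <= `|y| `^ p + `|x - y| `^ p.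
Proof.
move=> p0 p1; apply: le_trans (powR_subadditive p0 p1 _ _) => //.
apply: ge0_ler_powR; rewrite ?nnegrE ?addr_ge0//; first exact: ltW.
have := ler_normD y (x - y); have -> // : y + (x - y) = x by ring.
Qed.

Lemma powR_antitone p A B : 0 <= p -> 0 < B -> B <= A -> A `^ (- p) <= B `^ (- p).
Proof.
move=> p0 B0 BA; have A0 : 0 < A by exact: lt_le_trans BA.
rewrite !powRN lef_pV2 ?posrE ?powR_gt0//.
by apply: ge0_ler_powR; rewrite ?nnegrE//; exact: ltW.
Qed.

(** [(r - e) ^ p - r ^ p] is nondecreasing in [r] because [r ^ (p - 1)] is nonincreasing. With
    [e = eps] this compares the transport speed with the power of the shifted mean. Derivatives are
    taken only inside []B, A[], so [B = e] is allowed. *)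
Lemma powR_shift p A B e : 0 < p -> p <= 1 -> 0 < e -> e <= B -> B < A ->
  A `^ p - B `^ p <= (A - e) `^ p - (B - e) `^ p.
Proof.
move=> p0 p1 e0 eB BA; have B0 : 0 < B by exact: lt_le_trans eB.
pose F r := `|r - e| `^ p - `|r| `^ p.
have cF : continuous F.
  move=> r; apply: cvgB; last exact: continuous_abs_powR.
  apply: (cvg_comp (fun r => r - e) (fun r => `|r| `^ p)).
    by apply: cvgB; [exact: cvg_id|exact: cvg_cst].
  exact: continuous_abs_powR.
pose G r := p * (r - e) `^ (p - 1) - p * r `^ (p - 1).
have dF r : r \in `]B, A[%R -> is_derive r 1 F (G r).
  rewrite in_itv/= => /andP[Br rA].
  have re : 0 < r - e by rewrite subr_gt0 (le_lt_trans eB).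
  have r0 : 0 < r by rewrite (lt_trans B0).
  have n : \forall y \near r, (y - e) `^ p - y `^ p = F y.
    near=> y; have ey : e < y by near: y; apply: lt_nbhsr; rewrite -subr_gt0.
    by rewrite /F !gtr0_norm ?subr_gt0// (lt_trans e0).
  apply: near_eq_is_derive n _.
  have d1 := der_powR (f := fun y => y - e) p re (derB (der_id r) (der_cst e r)).
  have d2 := der_powR (f := fun y => y) p r0 (der_id r).
  by apply: der_eq (derB d1 d2) _; rewrite /G subr0 !mulr1.
have [z] := MVT BA dF (continuous_subspaceT cF).
rewrite in_itv/= => /andP[Bz zA].
rewrite /F !ger0_norm ?subr_ge0 ?(ltW B0) ?(ltW (lt_trans B0 BA)) ?(le_trans eB (ltW BA))// => E.
have : 0 <= G z * (A - B).
  apply: mulr_ge0; last by rewrite subr_ge0 ltW.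
  rewrite subr_ge0 ler_wpM2l ?(ltW p0)//.
  rewrite -[p - 1]opprK; apply: powR_antitone.
  - by rewrite oppr_ge0 subr_le0.
  - by rewrite subr_gt0 (le_lt_trans eB).
  - by rewrite gerBl ltW.
by rewrite -E; lra.
Unshelve. all: by end_near. Qed.

Lemma powR_convex r s x y : 1 <= r -> 0 <= s -> s <= 1 -> 0 <= x -> 0 <= y ->
  (s * x + (1 - s) * y) `^ r <= s * x `^ r + (1 - s) * y `^ r.
Proof.
move=> r1 s0 s1 x0 y0.
have := @convex_powR R r r1 (Itv01 s0 s1) x y.
rewrite !inE/= !in_itv/= !andbT => /(_ x0 y0).
by rewrite !convRE.
Qed.

(* The perspective [a g (r / a)] of the convex function [g r = r ^ (1 / p) - 1],
   which vanishes at 1, does not increase when [a] and [r] grow equally. *)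
Lemma powR_perspective p A B A' B' : 0 < p -> p <= 1 -> 0 < B -> B < A ->
  0 < A' -> 0 < B' -> A' `^ p - B' `^ p <= A `^ p - B `^ p ->
  A `^ (p - 1) * (A' - A) <= B `^ (p - 1) * (B' - B).
Proof.
move=> p0 p1 B0 BA A'0 B'0 H.
have A0 : 0 < A by exact: lt_trans BA.
set a := A `^ p in H; set b := B `^ p in H; set a' := A' `^ p in H; set b' := B' `^ p in H.
have a0 : 0 < a by exact: powR_gt0. have b0 : 0 < b by exact: powR_gt0.
have a'0 : 0 < a' by exact: powR_gt0. have b'0 : 0 < b' by exact: powR_gt0.
have ba : b < a by apply: gt0_ltr_powR; rewrite ?nnegrE//; exact: ltW.
(* Both sides of the goal become [a * g (a' / a)] in the variables [a = A ^ p], [a' = A' ^ p]. *)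
have E C C' : 0 < C -> 0 < C' -> C `^ (p - 1) * (C' - C) =
    C `^ p * ((C' `^ p / C `^ p) `^ p^-1 - 1).
  move=> C0 C'0; have -> : (C' `^ p / C `^ p) = (C' / C) `^ p.
    by rewrite powRM ?invr_ge0 ?ltW// -(powR_inv1 (ltW C0)) -powRrM mulN1r powRN.
  rewrite -powRrM divff ?gt_eqF// powRr1 ?divr_ge0 ?ltW//.
  by rewrite -(mulr_powRB1 (ltW C0) p0); field; rewrite gt_eqF.
rewrite (E A A' A0 A'0) (E B B' B0 B'0) -/a -/b -/a' -/b'.
have r1 : 1 <= p^-1 by rewrite invf_ge1.
have ba0 : 0 <= b / a by rewrite divr_ge0// ltW.
have ba1 : b / a <= 1 by rewrite ler_pdivrMr// mul1r ltW.
have bb0 : 0 <= b' / b by rewrite divr_ge0// ltW.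
(* Weights [b / a] and [1 - b / a] at [b' / b] and 1 give the point [(b' + a - b) / a], which
   dominates [a' / a] by [H]. *)
have := powR_convex r1 ba0 ba1 bb0 ler01; rewrite powR1 => C.
have {}C : (a' / a) `^ p^-1 <= b / a * (b' / b) `^ p^-1 + (1 - b / a) * 1.
  apply: le_trans C; apply: ge0_ler_powR.
  - by rewrite invr_ge0 ltW.
  - by rewrite nnegrE divr_ge0// ltW.
  - by rewrite nnegrE mulr1 addr_ge0 ?subr_ge0// mulr_ge0.
  - have -> : b / a * (b' / b) + (1 - b / a) * 1 = (b' + (a - b)) / a.
      by field; rewrite (gt_eqF a0) (gt_eqF b0).
    by rewrite ler_pM2r ?invr_gt0//; lra.
have := ler_wpM2l (ltW a0) C; set c' := (b' / b) `^ _ => {}C.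
have E2 : a * (b / a * c' + (1 - b / a) * 1) = b * (c' - 1) + a.
  by field; rewrite gt_eqF.
by rewrite E2 in C; lra.
Qed.

End power_inequalities.

(** * The doubled functional at a positive maximum *)

Section oleinik.
Context {R : realType}.
Notation mu := (@lebesgue_measure R).
Implicit Types (f g : R -> R) (x y z a b c t s h e r l : R).

Lemma nondecreasing_derive_ge0 f x a : is_derive x 1 f a ->
  {homo f : y z / y <= z} -> 0 <= a.
Proof.
move=> df f_nd; rewrite leNgt; apply/negP => a0.
have e0 : 0 < - a / 2 by rewrite divr_gt0// oppr_gt0.
move/is_deriveP : df => /(_ _ e0)[r r0 Hr].
have r20 : 0 < r / 2 by rewrite divr_gt0.
have := Hr (r / 2); rewrite gtr0_norm// => /(_ _); rewrite ler_norml => H.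
have {H}/andP[_] := H (ltac:(lra)).
have : f x <= f (x + r / 2) by apply: f_nd; rewrite lerDl ltW.
nra.
Qed.

Lemma MVT_value f f' a b : (forall x, is_derive x 1 f (f' x)) ->
  exists2 z, `|z - a| <= `|b - a| & f b - f a = f' z * (b - a).
Proof.
move=> df; have cf c e : {within `[c, e], continuous f}.
  by apply: continuous_subspaceT => x; exact: is_derive_continuous (df x).
have [ab|ba|<-] := ltgtP a b.
- have [z zab E] := MVT ab (fun x _ => df x) (cf _ _).
  exists z => //; move: zab; rewrite in_itv/= => /andP[az zb].
  by rewrite !gtr0_norm ?subr_gt0// lerD2r ltW.
- have [z zab E] := MVT ba (fun x _ => df x) (cf _ _).
  exists z; last by rewrite -opprB E; ring.
  move: zab; rewrite in_itv/= => /andP[bz za].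
  by rewrite !ltr0_norm ?subr_lt0// lerN2 lerD2r ltW.
- by exists a; rewrite ?subrr ?normr0 ?mulr0.
Qed.

Variables (q alpha nu : R) (J : R -> R) (P w wx : R -> R -> R).
Hypothesis rf : regular_flow q alpha nu J P w wx.
Hypotheses (q1 : 1 < q) (q2 : q < 2) (alpha0 : 0 <= alpha) (nu0 : 0 <= nu).
Hypotheses (iJ : mu.-integrable setT (EFin \o J))
  (J0 : {ae mu, forall x, 0 <= J x}) (J1 : \int[mu]_x J x = 1).
Hypothesis Pnd : forall t a b, 0 <= t -> a <= b -> P t a <= P t b.

Lemma rf_w_ge0 t x : 0 < t -> 0 <= w t x.
Proof.
move=> t0; apply: nondecreasing_derive_ge0 (rf_dP rf x t0) _ => a b ab.
by apply: Pnd => //; exact: ltW.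
Qed.

Lemma rf_uniform_tail T e : 0 < e -> exists M, forall t, 0 <= t <= T ->
  forall x y, (M <= x /\ M <= y) \/ (x <= - M /\ y <= - M) -> `|P t x - P t y| <= e.
Proof.
move=> e0; apply: (@segment_bound _ (fun M t => forall x y,
  (M <= x /\ M <= y) \/ (x <= - M /\ y <= - M) -> `|P t x - P t y| <= e)).
  move=> B B' s BB' H x y xy; apply: H; case: xy => -[? ?]; [left|right]; split; lra.
move=> t /andP[t0 tT]; have e30 : 0 < e / 3 by rewrite divr_gt0.
have [M HM] := rf_tail rf t0 e30; have [r r0 Hr] := rf_time rf t0 e30.
exists M, r; split => // s /andP[s0 sT] st x y xy.
have := HM x y xy; have := Hr s s0 st x; have := Hr s s0 st y.
rewrite !ler_norml => /andP[? ?] /andP[? ?] /andP[? ?]; apply/andP; split; lra.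
Qed.

Variables (eps d tau T eta L : R).
Hypotheses (eps0 : 0 < eps) (d0 : 0 < d) (tau0 : 0 < tau) (tauT : tau <= T) (eta0 : 0 < eta).
Hypothesis wxL : forall t x, tau <= t <= T -> `|wx t x| <= L.
Local Notation p := (q - 1).
(** Each of the two points contributes a flux error of at most [(2 * L * d) ^ p]. *)
Hypothesis small : 2 * (2 * L * d) `^ p < eta.

Let p0 : 0 < p. Proof. by rewrite subr_gt0. Qed.
Let p1 : p <= 1. Proof. by rewrite lerBlDr ltW. Qed.

(** Its two space derivatives are difference quotients of [w] and [wx], and its time derivative is
    read off [rf_eq]; neither [wx] nor the time dependence of [w] is ever differentiated. *)
Definition qmean t x := eps + d^-1 * (P t (x + d) - P t x).
Definition qmean_x t x := d^-1 * (w t (x + d) - w t x).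
Definition qmean_xx t x := d^-1 * (wx t (x + d) - wx t x).
Definition vpow t x := qmean t x `^ p.

Lemma qmean_ge t x : 0 <= t -> eps <= qmean t x.
Proof.
move=> t0; rewrite lerDl mulr_ge0 ?invr_ge0 ?(ltW d0)// subr_ge0 Pnd//.
by rewrite lerDl ltW.
Qed.

Lemma qmean_gt0 t x : 0 <= t -> 0 < qmean t x.
Proof. by move=> t0; apply: lt_le_trans (qmean_ge x t0). Qed.

Let der_shift f g x : (forall y, is_derive y 1 f (g y)) ->
  is_derive x 1 (fun y => f (y + d)) (g (x + d)).
Proof.
move=> df; have dd := derD (der_id x) (der_cst d x).
apply: der_eq (@der_comp _ f (fun y => y + d) x _ _ (df (x + d)) dd) _.
by rewrite addr0 mulr1.
Qed.

Lemma der_qmean t x : 0 < t -> is_derive x 1 (qmean t) (qmean_x t x).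
Proof.
move=> t0; rewrite -[qmean_x t x]add0r; apply: (derD (der_cst eps x)).
apply: derZ; apply: derB; last exact: (rf_dP rf x t0).
by apply: der_shift => y; exact: (rf_dP rf y t0).
Qed.

Lemma der_qmean_x t x : 0 < t -> is_derive x 1 (qmean_x t) (qmean_xx t x).
Proof.
move=> t0; apply: derZ; apply: derB; last exact: (rf_dw rf x t0).
by apply: der_shift => y; exact: (rf_dw rf y t0).
Qed.

Definition vpow_x t x := p * qmean t x `^ (p - 1) * qmean_x t x.
Definition vpow_xx t x :=
  p * ((p - 1) * qmean t x `^ (p - 1 - 1) * qmean_x t x * qmean_x t x
       + qmean t x `^ (p - 1) * qmean_xx t x).

Lemma der_vpow t x : 0 < t -> is_derive x 1 (vpow t) (vpow_x t x).
Proof. by move=> t0; apply: der_powR; [exact/qmean_gt0/ltW|exact: der_qmean]. Qed.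

Lemma der_vpow_x t x : 0 < t -> is_derive x 1 (vpow_x t) (vpow_xx t x).
Proof.
move=> t0.
have dp := der_powR (p - 1) (qmean_gt0 x (ltW t0)) (der_qmean x t0).
apply: der_eq (derM (derZ p dp) (der_qmean_x x t0)) _.
by rewrite /vpow_xx; ring.
Qed.

Definition qmean_t t x := d^-1 *
  (- (flux p (w t (x + d)) - flux p (w t x))
   + alpha * (\int[mu]_h (J h * (P t (x + d - h) - P t (x - h))) - (P t (x + d) - P t x))
   + nu * (wx t (x + d) - wx t x)).

Lemma der_t_vpow t x : 0 < t ->
  is_derive t 1 (fun s => vpow s x) (p * qmean t x `^ (p - 1) * qmean_t t x).
Proof.
move=> t0; apply: (@der_powR _ (fun s => qmean s x)); first exact/qmean_gt0/ltW.
have xd : x <= x + d by rewrite lerDl ltW.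
have := derD (der_cst eps t) (derZ d^-1 (rf_eq rf t0 xd)).
by rewrite add0r.
Qed.

(** The mean equals [w t s] for some [s] in [[x, x + d]], and [z] lies between the end values of
    [w]; each is within [L * d] of [w t x]. *)
Lemma flux_mvt t x : tau <= t <= T -> exists2 z,
  `|z - (qmean t x - eps)| <= 2 * L * d &
  flux p (w t (x + d)) - flux p (w t x) = `|z| `^ p * (w t (x + d) - w t x).
Proof.
move=> tT; have t0 : 0 < t by case/andP: tT => + _; exact: lt_le_trans.
have Lip y z : `|w t y - w t z| <= L * `|y - z|.
  have [s _ ->] := MVT_value z y (fun y => rf_dw rf y t0).
  by rewrite normrM ler_wpM2r// wxL.
have [z zw E] := MVT_value (w t x) (w t (x + d)) (fun s => der_flux s p0).
exists z => //; have xd : x + d - x = d by ring.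
have [s sx Es] := MVT_value x (x + d) (fun y => rf_dP rf y t0).
have -> : qmean t x - eps = w t s.
  by rewrite /qmean addrC addKr Es xd mulrC mulfK// gt_eqF.
have L0 : 0 <= L by apply: le_trans (wxL x tT).
have sx' : `|s - x| <= d by move: sx; rewrite xd (gtr0_norm d0).
have h1 : `|z - w t x| <= L * d.
  by apply: le_trans zw _; apply: le_trans (Lip _ _) _; rewrite xd (gtr0_norm d0).
have h2 : `|w t s - w t x| <= L * d.
  by apply: le_trans (Lip _ _) _; rewrite ler_wpM2l.
have -> : 2 * L * d = L * d + L * d by ring.
have -> : z - w t s = (z - w t x) - (w t s - w t x) by ring.
by rewrite (le_trans (ler_normB _ _))// lerD.
Qed.

(* The strict decrease [eta * (t - tau)] absorbs the [O(L * d)] distance between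
   [w] and its mean over [[y, y + d]] in the flux terms. *)
Definition gap t y l := (t - tau) * (vpow t (y + l) - vpow t y) - l - eta * (t - tau).

(** [vk 1] and [vk 0] are [vpow] at [y + l] and at [y], as functions of [(t, y, l)]; clamping keeps
    the base at least [eps] everywhere. *)
Let vk (k : R) (z : R * R * R) := (eps + d^-1 *
  (P (clamp z.1.1) (z.1.2 + d + k * z.2) - P (clamp z.1.1) (z.1.2 + 0 + k * z.2))) `^ p.

Let continuous_vk k : continuous (vk k).
Proof.
pose g (z : R * R * R) := eps + d^-1 *
  (P (clamp z.1.1) (z.1.2 + d + k * z.2) - P (clamp z.1.1) (z.1.2 + 0 + k * z.2)).
move=> z.
have cg : {for z, continuous g}.
  apply: cvgD; first exact: cvg_cst.
  by apply: cvgM; [exact: cvg_cst|apply: cvgB; exact: (rf_joint3 rf)].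
have g0 : 0 < g z.
  apply: (lt_le_trans eps0); rewrite lerDl mulr_ge0 ?invr_ge0 ?(ltW d0)//.
  by rewrite subr_ge0 Pnd ?clamp_ge0// !lerD2r lerD2l ltW.
have cp : {for g z, continuous (fun r => r `^ p)}.
  by apply: is_derive_continuous; exact: is_derive1_powR.
exact: (continuous_comp cg cp).
Qed.

(** A positive gap gives [l <= T * C] and a difference of [vpow] above [eta = g ^ p]. By
    subadditivity the mean at [y + l] then exceeds [g], so [P t] varies by more than [g * d] over
    [[y + l, y + l + d]], which the uniform tails forbid far out. The maximum is thus sought on a
    compact box. *)
Lemma gap_max y0 l0 : 0 <= l0 -> 0 < gap T y0 l0 -> exists t y l,
  [/\ tau <= t <= T, 0 <= l, 0 < gap t y l &
      forall t' y' l', tau <= t' <= T -> 0 <= l' -> gap t' y' l' <= gap t y l].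
Proof.
move=> l00 Z0; have T0 : 0 < T by exact: lt_le_trans tauT.
have tau0' := tau0; have d0' := d0.
have [B B0 HB] := rf_bounded rf T.
pose C := (eps + d^-1 * (B + B)) `^ p.
have C0 : 0 <= C by exact: powR_ge0.
have vC t x : 0 <= t <= T -> vpow t x <= C.
  move=> tT; have /andP[t0 _] := tT.
  apply: ge0_ler_powR; first exact: ltW.
  - by rewrite nnegrE ltW// qmean_gt0.
  - by rewrite nnegrE addr_ge0 ?(ltW eps0)// mulr_ge0 ?invr_ge0 ?(ltW d0)// addr_ge0.
  - rewrite lerD2l ler_wpM2l ?invr_ge0 ?(ltW d0)//.
    have := HB t (x + d) tT; have := HB t x tT; rewrite !ler_norml.
    by move=> /andP[? ?] /andP[? ?]; lra.
have v0 t x : 0 <= vpow t x by exact: powR_ge0.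
pose g := eta `^ p^-1; have g0 : 0 < g by exact: powR_gt0.
have gp : g `^ p = eta by rewrite -powRrM mulVf ?gt_eqF// powRr1// ltW.
have [M HM] := rf_uniform_tail T (mulr_gt0 g0 d0).
have box t y l : tau <= t <= T -> 0 <= l -> 0 < gap t y l ->
    l <= T * C /\ - M - d - T * C <= y <= M.
  move=> /andP[tt tT] l_ge0; rewrite /gap => Zpos.
  have t0T : 0 <= t <= T by rewrite tT (le_trans (ltW tau0)).
  have /andP[t0 _] := t0T.
  have ts0 : 0 <= t - tau by rewrite subr_ge0.
  have lTC : l <= T * C.
    have h1 : (t - tau) * (vpow t (y + l) - vpow t y) <= T * C.
      apply: (@le_trans _ _ ((t - tau) * C)).
        by rewrite ler_wpM2l//; have := vC t (y + l) t0T; have := v0 t y; lra.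
      by rewrite ler_wpM2r//; lra.
    have h2 : 0 <= eta * (t - tau) by rewrite mulr_ge0// ltW.
    lra.
  have tpos : 0 < t - tau.
    rewrite lt_neqAle ts0 andbT; apply/eqP => E; rewrite -E !mul0r mulr0 in Zpos; lra.
  have vv : eta < vpow t (y + l) - vpow t y.
    by rewrite -(ltr_pM2l tpos) [_ * eta]mulrC; lra.
  have Ug : eps + g < qmean t (y + l).
    rewrite ltNge; apply/negP => Ug.
    have : vpow t (y + l) <= (eps + g) `^ p.
      apply: ge0_ler_powR Ug; first exact: ltW.
        by rewrite nnegrE ltW// qmean_gt0.
      by rewrite nnegrE addr_ge0// ltW.
    have := powR_subadditive p0 p1 (ltW eps0) (ltW g0); rewrite gp.
    have : eps `^ p <= vpow t y.
      apply: ge0_ler_powR (qmean_ge y t0); first exact: ltW.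
        by rewrite nnegrE ltW.
      by rewrite nnegrE ltW// qmean_gt0.
    by move: vv; lra.
  have Pg : g * d < P t (y + l + d) - P t (y + l).
    move: Ug; rewrite /qmean ltrD2l => H; rewrite -(ltr_pM2l (_ : 0 < d^-1)) ?invr_gt0//.
    by rewrite [d^-1 * (g * d)]mulrC mulfK// gt_eqF.
  have Pn : ~ (`|P t (y + l) - P t (y + l + d)| <= g * d).
    by rewrite distrC => H; have := ler_norm (P t (y + l + d) - P t (y + l)); lra.
  split=> //; apply/andP; split.
    rewrite leNgt; apply/negP => H; apply: Pn; apply: HM => //; right; split; lra.
  by rewrite leNgt; apply/negP => H; apply: Pn; apply: HM => //; left; split; lra.
pose K : set (R * R * R) := (`[tau, T] `*` `[- M - d - T * C, M]) `*` `[0, T * C].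
have cK : compact K.
  by apply: compact_setX; [apply: compact_setX|]; exact: segment_compact.
have inK t y l : tau <= t <= T -> 0 <= l -> 0 < gap t y l -> K (t, y, l).
  move=> tT l_ge0 Zp; have [lTC yM] := box t y l tT l_ge0 Zp.
  by rewrite /K/=; split; [split|]; rewrite /= in_itv/= ?tT ?yM ?l_ge0.
pose Zc (z : R * R * R) := (z.1.1 - tau) * (vk 1 z - vk 0 z) - z.2 - eta * (z.1.1 - tau).
have cZ : continuous Zc.
  move=> z; have ct : (fun z : R * R * R => z.1.1 - tau) @ z --> z.1.1 - tau.
    by apply: cvgB; [apply: (cvg_comp fst fst cvg_fst); exact: cvg_fst|exact: cvg_cst].
  apply: cvgB; last by apply: cvgM; [exact: cvg_cst|exact: ct].
  apply: cvgB; last exact: cvg_snd.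
  by apply: cvgM; [exact: ct|apply: cvgB; exact: continuous_vk].
have ZcE t y l : 0 <= t -> Zc (t, y, l) = gap t y l.
  move=> t0; rewrite /Zc /gap /vk /vpow /qmean/= clamp_id// !mul1r !mul0r !addr0.
  by rewrite [y + d + l]addrAC.
have TT : tau <= T <= T by rewrite tauT lexx.
have K0 : K !=set0 by exists (T, y0, l0); exact: inK.
have [[[t y] l] /set_mem Kz zmax] := compact_EVT_max K0 cK (continuous_subspaceT cZ).
have [[]] := Kz; rewrite /= !in_itv/= => tT _ /andP[l_ge0 _].
have t0 : 0 <= t by case/andP: tT => + _; exact/le_trans/ltW.
have big : gap T y0 l0 <= gap t y l.
  rewrite -!ZcE ?(ltW T0)//; apply: zmax; rewrite inE; exact: inK.
exists t, y, l; split => //; first exact: lt_le_trans big.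
move=> t' y' l' t'T l'0; have [Zn|Zp] := leP (gap t' y' l') 0.
  by apply: le_trans Zn (ltW (lt_le_trans Z0 big)).
have t'0 : 0 <= t' by case/andP: t'T => + _; exact/le_trans/ltW.
by rewrite -!ZcE//; apply: zmax; rewrite inE; exact: inK.
Qed.

Let integrable_average t z : 0 <= t ->
  continuous (fun h => P t (z + d - h) - P t (z - h)) /\
  exists B, forall h, `|P t (z + d - h) - P t (z - h)| <= B.
Proof.
move=> t0; split; last first.
  have [B HB] := rf_bnd rf t0; exists (B + B) => h.
  by rewrite (le_trans (ler_normB _ _))// lerD.
have c0 z' : continuous (fun h => P t (z' - h)).
  move=> h'; apply: (cvg_comp (fun h => z' - h) (P t)).
    by apply: cvgB; [exact: cvg_cst|exact: cvg_id].
  exact: (rf_cont rf t0).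
by move=> h; apply: cvgB; exact: c0.
Qed.

Let N t z := d^-1 * (\int[mu]_h (J h * (P t (z + d - h) - P t (z - h))) - (P t (z + d) - P t z)).

(* By [powR_perspective], the inequality holds pointwise in the shift [h], before
   averaging against [J]. *)
Lemma nonlocal_le t x y : 0 <= t -> qmean t y < qmean t x ->
  (forall h, vpow t (x - h) - vpow t (y - h) <= vpow t x - vpow t y) ->
  qmean t x `^ (p - 1) * N t x <= qmean t y `^ (p - 1) * N t y.
Proof.
move=> t0 UU vmax.
set a1 := qmean t x `^ (p - 1); set b1 := qmean t y `^ (p - 1).
pose gx h := P t (x + d - h) - P t (x - h); pose gy h := P t (y + d - h) - P t (y - h).
have [cx [Bx HBx]] := integrable_average x t0.
have [cy [By HBy]] := integrable_average y t0.
have iJx : mu.-integrable setT (EFin \o (fun h => J h * gx h)).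
  by apply: integrableM_bounded (fun h _ => HBx h) => //; exact: continuous_measurable.
have iJy : mu.-integrable setT (EFin \o (fun h => J h * gy h)).
  by apply: integrableM_bounded (fun h _ => HBy h) => //; exact: continuous_measurable.
pose c1 := - (a1 * d^-1); pose c2 := b1 * d^-1.
pose g h := c1 * gx h + c2 * gy h.
have avg : c1 * (P t (x + d) - P t x) + c2 * (P t (y + d) - P t y) <= \int[mu]_h (J h * g h).
  apply: average_ge => //.
  - move=> h; apply: cvgD; apply: cvgM; [exact: cvg_cst|exact: cx|exact: cvg_cst|exact: cy].
  - exists (`|c1| * Bx + `|c2| * By) => h.
    rewrite /g; apply: le_trans (ler_normD _ _) _; apply: lerD.
      by rewrite normrM ler_wpM2l//; exact: HBx.
    by rewrite normrM ler_wpM2l//; exact: HBy.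
  move=> h; have U0 z := qmean_gt0 z t0.
  have := powR_perspective p0 p1 (U0 y) UU (U0 (x - h)) (U0 (y - h)) (vmax h).
  rewrite -/a1 -/b1 /qmean /g /gx /gy /c1 /c2.
  have -> : x + d - h = x - h + d by ring.
  have -> : y + d - h = y - h + d by ring.
  lra.
have E : \int[mu]_h (J h * g h) = c1 * \int[mu]_h (J h * gx h) + c2 * \int[mu]_h (J h * gy h).
  rewrite -!RintegralZl// -RintegralD//; [|exact: integrableZ_Rfun|exact: integrableZ_Rfun].
  by apply: eq_Rintegral => h _; rewrite /g; ring.
rewrite E in avg; rewrite /N -/gx -/gy; move: avg.
set Ix := \int[mu]_h (J h * gx h); set Iy := \int[mu]_h (J h * gy h); rewrite /c1 /c2; lra.
Qed.

Lemma oleinik_step y0 l0 : 0 <= l0 -> gap T y0 l0 <= 0.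
Proof.
move=> l00; rewrite leNgt; apply/negP => Z0.
have [t [y [l [tT l_ge0 Zp zmax]]]] := gap_max l00 Z0.
have /andP[tt tT'] := tT.
have t0 : 0 < t by exact: lt_le_trans tt.
(* On the faces [t = tau] and [l = 0] the gap is nonpositive; off them, each point may vary in both
   directions. *)
have s0 : 0 < t - tau.
  rewrite subr_gt0 lt_neqAle tt andbT; apply/eqP => E; move: Zp.
  by rewrite /gap -E subrr !mul0r mulr0; lra.
have lpos : 0 < l.
  rewrite lt_neqAle l_ge0 andbT; apply/eqP => E; move: Zp.
  rewrite /gap -E addr0 subrr mulr0 subr0 sub0r ltNge => /negP; apply.
  by rewrite oppr_le0 mulr_ge0// ltW.
set x := y + l in Zp zmax.
set s := t - tau in s0 Zp zmax.
have Zm t' y' x' : tau <= t' <= T -> y' <= x' ->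
    (t' - tau) * (vpow t' x' - vpow t' y') - (x' - y') - eta * (t' - tau) <=
    s * (vpow t x - vpow t y) - (x - y) - eta * s.
  move=> t'T yx; have := zmax t' y' (x' - y') t'T; rewrite subr_ge0 => /(_ yx).
  rewrite /gap -/s -/x; have -> : y' + (x' - y') = x' by ring.
  by have -> : x - y = l by rewrite /x; ring.
have [vxE vxxE] : - (s * vpow_x t x) = - 1 /\ 0 <= - (s * vpow_xx t x).
  have H1 z : is_derive z 1 (fun z => - (s * vpow t z)) (- (s * vpow_x t z)).
    by apply: derN; apply: derZ; exact: der_vpow.
  have H2 : is_derive x 1 (fun z => - (s * vpow_x t z)) (- (s * vpow_xx t x)).
    by apply: derN; apply: derZ; exact: der_vpow_x.
  have H3 h : `|h| < l -> - (s * vpow t x) + (- 1) * h - 0 * h ^+ 2 <= - (s * vpow t (x + h)).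
    rewrite ltr_norml => /andP[hl _].
    have yx : y <= x + h by rewrite /x; lra.
    by have := Zm t y (x + h) tT yx; rewrite -/s; lra.
  by have [E1] := touch2 lpos H1 H2 H3; rewrite mulr0 oppr0.
have [vyE vyyE] : s * vpow_x t y = 1 /\ 0 <= s * vpow_xx t y.
  have H1 z : is_derive z 1 (fun z => s * vpow t z) (s * vpow_x t z).
    by apply: derZ; exact: der_vpow.
  have H2 : is_derive y 1 (fun z => s * vpow_x t z) (s * vpow_xx t y).
    by apply: derZ; exact: der_vpow_x.
  have H3 h : `|h| < l -> s * vpow t y + 1 * h - 0 * h ^+ 2 <= s * vpow t (y + h).
    rewrite ltr_norml => /andP[_ hl].
    have yx : y + h <= x by rewrite /x; lra.
    by have := Zm t (y + h) x tT yx; rewrite -/s; lra.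
  by have [E1] := touch2 lpos H1 H2 H3; rewrite mulr0 oppr0.
have xy : y < x by rewrite ltrDl.
have ba : vpow t y < vpow t x.
  have : 0 < s * (vpow t x - vpow t y).
    have : 0 <= eta * s by rewrite mulr_ge0// ltW.
    by move: Zp; rewrite /gap -/s -/x; lra.
  by rewrite pmulr_rgt0// subr_gt0.
have A0 := qmean_gt0 x (ltW t0); have B0 := qmean_gt0 y (ltW t0).
have BA : qmean t y < qmean t x.
  rewrite ltNge; apply/negP => AB; move: ba; rewrite ltNge => /negP; apply.
  by apply: ge0_ler_powR AB; rewrite ?nnegrE; exact: ltW.
(* The time derivative of [gap] is nonnegative at the maximum, while the first
   and second order conditions in [x] and [y] fix or sign all its terms; the
   flux terms leave [vpow t y - vpow t x], cancelling [vpow t x - vpow t y]. *)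
have dtv : 0 <= vpow t x - vpow t y + s * (p * qmean t x `^ (p - 1) * qmean_t t x
    - p * qmean t y `^ (p - 1) * qmean_t t y) - eta.
  have ds : is_derive t 1 (fun t' => t' - tau) 1.
    by apply: der_eq (derB (der_id t) (der_cst tau t)) _; rewrite subr0.
  have dd := derN (derB (derM ds (derB (der_t_vpow x t0) (der_t_vpow y t0))) (derZ eta ds)).
  have tau_t : tau < t by rewrite -subr_gt0.
  have := der_left_min tau_t dd; rewrite oppr_le0 mul1r mulr1; apply.
  move=> t' /andP[tt' t't].
  have t'T : tau <= t' <= T by rewrite tt' (le_trans t't).
  by have := Zm t' y x t'T (ltW xy); rewrite -/s; lra.
have [zx zxE Fx] := flux_mvt x tT; have [zy zyE Fy] := flux_mvt y tT.
have NN : qmean t x `^ (p - 1) * N t x <= qmean t y `^ (p - 1) * N t y.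
  apply: nonlocal_le => //; first exact: ltW.
  move=> h; have := Zm t (y - h) (x - h) tT; rewrite lerD2r => /(_ (ltW xy)).
  by rewrite -/s => H; rewrite -(ler_pM2l s0); lra.
pose a1 := qmean t x `^ (p - 1); pose b1 := qmean t y `^ (p - 1).
have X1 : s * p * (a1 * qmean_x t x) = 1.
  by move: vxE; rewrite /vpow_x -/a1 => /oppr_inj E; rewrite -[RHS]E; ring.
have X2 : s * p * (b1 * qmean_x t y) = 1.
  by move: vyE; rewrite /vpow_x -/b1 => E; rewrite -[RHS]E; ring.
have sp0 : 0 < s * p by rewrite mulr_gt0.
have XX : a1 * qmean_x t x = b1 * qmean_x t y.
  by apply: (mulfI (lt0r_neq0 sp0)); rewrite X1 X2.
(* Writing [m] for [qmean], the second-order conditions carry the term [(1 - p) * m ^ (- p) * (m ^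
   (p - 1) * m_x) ^ 2] of the concave power. By [XX] the squares agree at [x] and [y], and
   [m ^ (- p)] is smaller at the larger mean, so this term has the right sign. *)
have DD : a1 * qmean_xx t x <= b1 * qmean_xx t y.
  have UE z : 0 < qmean t z -> qmean t z `^ (p - 1 - 1) =
      qmean t z `^ (- p) * (qmean t z `^ (p - 1) * qmean t z `^ (p - 1)).
    move=> z0; have nz r r' : (r + r' == 0) ==> (qmean t z != 0).
      by rewrite (gt_eqF z0) implybT.
    by rewrite -(powRD (nz (p - 1) (p - 1))) -(powRD (nz (- p) _)); congr (_ `^ _); ring.
  have h1 : a1 * qmean_xx t x <= (1 - p) * (qmean t x `^ (- p) * (a1 * qmean_x t x) ^+ 2).
    have : vpow_xx t x <= 0 by move: vxxE; rewrite oppr_ge0 pmulr_rle0.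
    by rewrite /vpow_xx pmulr_rle0// UE// -/a1 expr2; lra.
  have h2 : (1 - p) * (qmean t y `^ (- p) * (b1 * qmean_x t y) ^+ 2) <= b1 * qmean_xx t y.
    have : 0 <= vpow_xx t y by move: vyyE; rewrite pmulr_rge0.
    by rewrite /vpow_xx pmulr_rge0// UE// -/b1 expr2; lra.
  apply: le_trans h1 (le_trans _ h2); rewrite XX ler_wpM2l ?subr_ge0//.
  rewrite ler_wpM2r ?sqr_ge0// powR_antitone//; exact: ltW.
have UtE z (u : R) : flux p (w t (z + d)) - flux p (w t z) = `|u| `^ p * (w t (z + d) - w t z) ->
    qmean_t t z = - `|u| `^ p * qmean_x t z + alpha * N t z + nu * qmean_xx t z.
  by move=> FE; rewrite /qmean_t FE /qmean_x /N /qmean_xx; ring.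
rewrite (UtE x zx Fx) (UtE y zy Fy) -/a1 -/b1 in dtv.
have L0 : 0 <= 2 * L * d.
  by rewrite !mulr_ge0 ?(ltW d0)//; apply: le_trans (wxL x tT).
have err (z u : R) : `|u - z| <= 2 * L * d -> `|u| `^ p <= `|z| `^ p + (2 * L * d) `^ p.
  move=> uz; apply: le_trans (abs_powR_dist u z p0 p1) _; rewrite lerD2l.
  by apply: ge0_ler_powR uz; rewrite ?nnegrE//; exact: ltW.
have e1 : `|qmean t x - eps| `^ p <= `|zx| `^ p + (2 * L * d) `^ p.
  by apply: err; rewrite distrC.
have e2 := err _ _ zyE.
have Ue z : 0 <= qmean t z - eps by rewrite subr_ge0 qmean_ge// ltW.
(* The speeds are controlled by [(qmean - eps) ^ p]; this returns to the difference of [vpow]. *)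
have shift := powR_shift p0 p1 eps0 (qmean_ge y (ltW t0)) BA.
rewrite (ger0_norm (Ue x)) in e1; rewrite (ger0_norm (Ue y)) in e2.
have Q1 : 0 <= s * p * (alpha * (b1 * N t y - a1 * N t x)).
  by rewrite mulr_ge0 ?(ltW sp0)// mulr_ge0// subr_ge0.
have Q2 : 0 <= s * p * (nu * (b1 * qmean_xx t y - a1 * qmean_xx t x)).
  by rewrite mulr_ge0 ?(ltW sp0)// mulr_ge0// subr_ge0.
have sm := small.
(* The transport coefficients are 1 by [X1] and [X2]; what remains is
   [0 <= 2 * (2 * L * d) ^ p - eta], against [small]. *)
have E : s * (p * a1 * (- `|zx| `^ p * qmean_x t x + alpha * N t x + nu * qmean_xx t x) -
    p * b1 * (- `|zy| `^ p * qmean_x t y + alpha * N t y + nu * qmean_xx t y)) =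
  - `|zx| `^ p * (s * p * (a1 * qmean_x t x)) + `|zy| `^ p * (s * p * (b1 * qmean_x t y))
  - s * p * (alpha * (b1 * N t y - a1 * N t x))
  - s * p * (nu * (b1 * qmean_xx t y - a1 * qmean_xx t x)) by ring.
by rewrite E X1 X2 !mulr1 /vpow in dtv; lra.
Qed.

End oleinik.

(** * Removing the window, the drift and the initial delay *)

Section oleinik_limit.
Context {R : realType}.
Notation mu := (@lebesgue_measure R).
Implicit Types (f g : R -> R) (x y z a b c t s h e r l : R).

Lemma der_cvg_right f x a : is_derive x 1 f a ->
  h^-1 * (f (x + h) - f x) @[h --> 0^'+] --> a.
Proof.
move=> /is_deriveP df; apply/cvgrPdist_le => e e0; have [r r0 Hr] := df e e0.
near=> h; have h0 : 0 < h by near: h; exact: nbhs_right_gt.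
have hr : h < r by near: h; exact: nbhs_right_lt.
have := Hr h; rewrite gtr0_norm// => /(_ hr) H.
have E : a - h^-1 * (f (x + h) - f x) = - (h^-1 * (f (x + h) - f x - a * h)).
  by field; rewrite gt_eqF.
by rewrite E normrN normrM gtr0_norm ?invr_gt0// mulrC ler_pdivrMr.
Unshelve. all: by end_near. Qed.

Variables (q alpha nu : R) (J : R -> R) (P w wx : R -> R -> R).
Hypothesis rf : regular_flow q alpha nu J P w wx.
Hypotheses (q1 : 1 < q) (q2 : q < 2) (alpha0 : 0 <= alpha) (nu0 : 0 <= nu).
Hypotheses (iJ : mu.-integrable setT (EFin \o J))
  (J0 : {ae mu, forall x, 0 <= J x}) (J1 : \int[mu]_x J x = 1).
Hypothesis Pnd : forall t a b, 0 <= t -> a <= b -> P t a <= P t b.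
Local Notation p := (q - 1).

Let cvg_v eps t x : 0 < t -> 0 < eps ->
  (eps + h^-1 * (P t (x + h) - P t x)) `^ p @[h --> 0^'+] --> (eps + w t x) `^ p.
Proof.
move=> t0 eps0.
have c1 : eps + h^-1 * (P t (x + h) - P t x) @[h --> 0^'+] --> eps + w t x.
  by apply: cvgD; [exact: cvg_cst|exact: der_cvg_right (rf_dP rf x t0)].
have e0 : 0 < eps + w t x by rewrite ltr_wpDr// (rf_w_ge0 rf).
have c2 : {for eps + w t x, continuous (fun r => r `^ p)}.
  by apply: is_derive_continuous; exact: is_derive1_powR.
exact: (cvg_comp _ _ c1 c2).
Qed.

(** [tau] fixes the bound [L] on [wx] before the width [h] is chosen. A strict violation in the
    limit would persist for small [h], against [oleinik_step]. *)
Lemma oleinik_limit eps tau T eta y x : 0 < eps -> 0 < tau -> tau < T -> 0 < eta ->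
  y <= x -> (T - tau) * ((eps + w T x) `^ p - (eps + w T y) `^ p) <= x - y + eta * (T - tau).
Proof.
move=> eps0 tau0 tauT eta0 yx.
have T0 : 0 < T by exact: lt_trans tauT.
have p0 : 0 < p by rewrite subr_gt0.
have [L HL] := rf_wx rf T tau0.
have {}HL t z : tau <= t <= T -> `|wx t z| <= L by exact: HL.
have e40 : 0 < eta / 4 by rewrite divr_gt0.
have [r r0 Hr] := powR_small p0 e40.
have TT : tau <= T <= T by rewrite lexx ltW.
have L0 : 0 <= L by apply: le_trans (HL T 0 TT).
rewrite leNgt; apply/negP => H.
have C : (T - tau) * ((eps + h^-1 * (P T (x + h) - P T x)) `^ p -
    (eps + h^-1 * (P T (y + h) - P T y)) `^ p) @[h --> 0^'+] -->
    (T - tau) * ((eps + w T x) `^ p - (eps + w T y) `^ p).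
  by apply: cvgM; [exact: cvg_cst|apply: cvgB; exact: cvg_v].
have G : \forall h \near 0^'+, x - y + eta * (T - tau) <
    (T - tau) * ((eps + h^-1 * (P T (x + h) - P T x)) `^ p -
    (eps + h^-1 * (P T (y + h) - P T y)) `^ p).
  by have := @cvgr_gt R _ _ _ _ _ C _ H; apply.
near (0 : R)^'+ => h.
have h0 : 0 < h by near: h; exact: nbhs_right_gt.
have hr : `|2 * L * h| < r.
  rewrite ger0_norm; last by rewrite !mulr_ge0// ltW.
  have : h < r / (2 * L + 1).
    by near: h; apply: nbhs_right_lt; rewrite divr_gt0// ltr_wpDl// mulr_ge0.
  by rewrite ltr_pdivlMr ?ltr_wpDl ?mulr_ge0//; move: h0; lra.
have small : 2 * (2 * L * h) `^ (q - 1) < eta.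
  have := Hr _ hr; rewrite ger0_norm; last by rewrite !mulr_ge0// ltW.
  by move: eta0; lra.
have xy0 : 0 <= x - y by rewrite subr_ge0.
have := oleinik_step rf q1 q2 alpha0 nu0 iJ J0 J1 Pnd eps0 h0 tau0 (ltW tauT) eta0 HL small y xy0.
rewrite /gap /vpow /qmean; have -> : y + (x - y) = x by ring.
apply/negP; rewrite -ltNge subr_gt0 ltrBrDr addrC.
by near: h; exact: G.
Unshelve. all: by end_near. Qed.

(** The choice [eta = e / (T - tau)] makes the first error [e]; then [tau <= e / V] does the same
    for [tau * V]. *)
Lemma oleinik_profile eps T y x : 0 < eps -> 0 < T -> y <= x ->
  T * ((eps + w T x) `^ p - (eps + w T y) `^ p) <= x - y.
Proof.
move=> eps0 T0 yx; set V := _ - _.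
have H1 tau : 0 < tau -> tau < T -> (T - tau) * V <= x - y.
  move=> tau0 tauT; apply/ler_addgt0Pr => e e0.
  have Tt : 0 < T - tau by rewrite subr_gt0.
  have := oleinik_limit eps0 tau0 tauT (divr_gt0 e0 Tt) yx.
  by rewrite divfK// gt_eqF.
have [V0|V0] := leP V 0.
  by apply: (@le_trans _ _ 0); rewrite ?subr_ge0// mulr_ge0_le0// ltW.
apply/ler_addgt0Pr => e e0.
pose tau := Num.min (T / 2) (e / V).
have tau0 : 0 < tau by rewrite lt_min !divr_gt0.
have tauT : tau < T.
  by apply: (@le_lt_trans _ _ (T / 2)); [rewrite ge_min lexx|move: T0; lra].
have tV : tau * V <= e by rewrite -ler_pdivlMr// ge_min lexx orbT.
by have := H1 tau tau0 tauT; lra.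
Qed.

End oleinik_limit.

(** * The weak derivative of the power *)

Section test_functions.
Context {R : realType}.
Notation mu := (@lebesgue_measure R).
Implicit Types (phi : R -> R) (x y : R).

Lemma test_function_der phi : test_function phi ->
  (forall x, is_derive x 1 phi (derive1 phi x)) /\ continuous (derive1 phi).
Proof.
move=> [dphi _]; split=> x.
  by rewrite derive1E; apply: derivableP; exact: (dphi 0%N).
by apply/differentiable_continuous/derivable1_diffP; exact: (dphi 1%N).
Qed.

Lemma test_function_support phi : test_function phi -> exists M, forall x,
  ~ `]- M, M[%classic x -> phi x = 0 /\ derive1 phi x = 0.
Proof.
move=> tphi; have [dphi _] := test_function_der tphi.
have [_ cphi] := tphi; have [M [_ /(_ (M + 1))]] := compact_bounded cphi.
rewrite ltrDl ltr01 => /(_ isT) KM.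
have out x : M + 1 < `|x| -> phi x = 0.
  move=> Mx; apply/eqP/negPn/negP => px.
  have /KM /= : closure [set x | phi x != 0] x by exact: subset_closure.
  by rewrite leNgt Mx.
(* Beyond [M + 1] the function vanishes on an open set, so its derivative vanishes too. The margin
   puts the endpoints of the interval among the zeros. *)
exists (M + 2) => x; rewrite /= in_itv/= => /negP; rewrite -ltr_norml -leNgt => Mx.
have Mx1 : M + 1 < `|x| by lra.
split; first exact: out.
have n : \forall y \near x, 0 = phi y.
  have : \forall y \near x, M + 1 < `|y|.
    by have := @norm_continuous _ _ x => /cvgr_gt; apply.
  by apply: filterS => y /out.
have d0 := near_eq_is_derive n (der_cst 0 x).
by rewrite derive1E; exact: derive_val.
Qed.

End test_functions.

Section power_weak_derivative.
Context {R : realType}.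
Notation mu := (@lebesgue_measure R).
Implicit Types (x y a b r : R) (n : nat).
Variables (p t : R) (w wx : R -> R).
Hypotheses (p0 : 0 < p) (p1 : p < 1) (t0 : 0 < t).
Hypotheses (dw : forall x, is_derive x 1 w (wx x)) (cwx : continuous wx).
Hypothesis w0 : forall x, 0 <= w x.
Hypothesis osl : forall eps y x : R, 0 < eps -> y <= x ->
  t * ((eps + w x) `^ p - (eps + w y) `^ p) <= x - y.

(* Where [w x = 0], also [wx x = 0], so that [W x = 0] whatever the junk value
   [0 `^ (p - 1)] is. *)
Let W x := p * w x `^ (p - 1) * wx x.
Let e (n : nat) : R := n.+1%:R^-1.
Let f n x := (e n + w x) `^ p.
Let g n x := p * (e n + w x) `^ (p - 1) * wx x.

Let e0 n : 0 < e n. Proof. by rewrite invr_gt0. Qed.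
Let ew0 n x : 0 < e n + w x. Proof. by rewrite ltr_wpDr. Qed.

Let cw : continuous w.
Proof. by move=> x; exact: is_derive_continuous (dw x). Qed.

Let df n x : is_derive x 1 (f n) (g n x).
Proof.
apply: der_powR => //; rewrite -[wx x]add0r; apply: (derD (der_cst _ x)); exact: dw.
Qed.

Let cf n : continuous (f n).
Proof. by move=> x; exact: is_derive_continuous (df n x). Qed.

Let cpow n r : continuous (fun x => (e n + w x) `^ r).
Proof.
move=> x; have := @der_powR _ (fun y => e n + w y) x _ r (ew0 n x) (derD (der_cst (e n) x) (dw x)).
exact: is_derive_continuous.
Qed.

Let cg n : continuous (g n).
Proof.
move=> x; apply: cvgM; last exact: cwx.
by apply: cvgM; [exact: cvg_cst|exact: cpow].
Qed.

Let g_le n x : g n x <= t^-1.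
Proof.
have d : is_derive x 1 (fun y => t^-1 * y - f n y) (t^-1 * 1 - g n x).
  exact: (derB (derZ t^-1 (der_id x)) (df n x)).
rewrite -subr_ge0 -[t^-1]mulr1; apply: nondecreasing_derive_ge0 d _ => a b ab.
have := osl (e0 n) ab; rewrite -(ler_pM2l (_ : 0 < t^-1)) ?invr_gt0//.
by rewrite mulKf ?gt_eqF// /f; lra.
Qed.

(** A zero of the nonnegative [w] is a minimum. *)
Let wx_zero x : w x = 0 -> wx x = 0.
Proof.
move=> wx0; apply: (touch1 ltr01 (dw x) (c := 0)) => h _.
by rewrite wx0 !mul0r subr0 addr0.
Qed.

Let e_cvg0 : e n @[n --> \oo] --> (0 : R).
Proof. exact: cvg_harmonic. Qed.

Let g_cvg x : g n x @[n --> \oo] --> W x.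
Proof.
have [wx0|] := eqVneq (w x) 0.
  rewrite /W /g (wx_zero wx0) mulr0; under eq_fun do rewrite mulr0.
  exact: cvg_cst.
rewrite neq_lt ltNge w0/= => wx0.
apply: cvgM; last exact: cvg_cst.
apply: cvgM; first exact: cvg_cst.
have c1 : e n + w x @[n --> \oo] --> w x.
  by rewrite -[X in _ --> X]add0r; apply: cvgD; [exact: e_cvg0|exact: cvg_cst].
have c2 : {for w x, continuous (fun r => r `^ (p - 1))}.
  by apply: is_derive_continuous; exact: is_derive1_powR.
exact: (cvg_comp _ _ c1 c2).
Qed.

Let f_cvg x : f n x @[n --> \oo] --> w x `^ p.
Proof.
have c1 : e n + w x @[n --> \oo] --> w x.
  by rewrite -[X in _ --> X]add0r; apply: cvgD; [exact: e_cvg0|exact: cvg_cst].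
have := cvg_comp _ _ c1 (@continuous_abs_powR _ _ p0 (w x)).
rewrite /= ger0_norm//; apply: cvg_trans; apply: near_eq_cvg; apply: nearW => n.
by rewrite /= ger0_norm// ltW.
Qed.

Lemma power_derivative_le x : p * w x `^ (p - 1) * wx x <= t^-1.
Proof.
apply: (cvgr_to_le (@g_cvg x)); apply: nearW => n; exact: g_le.
Qed.

(** Since [p - 1 < 0], adding [e n] decreases the power; where [w] vanishes, so does [wx]. *)
Let g_norm n x : `|g n x| <= `|W x|.
Proof.
have [wx0|] := eqVneq (w x) 0.
  by rewrite /g (wx_zero wx0) mulr0 normr0.
rewrite neq_lt ltNge w0/= => wx0.
rewrite /g /W !normrM ler_wpM2r// ler_wpM2l// !ger0_norm ?powR_ge0//.
rewrite -[p - 1]opprB; apply: powR_antitone => //.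
  by rewrite subr_ge0 ltW.
by rewrite lerDr ltW.
Qed.

Let g_mono x : {homo (fun n => `|g n x|) : n m / (n <= m)%N >-> n <= m}.
Proof.
move=> n m nm; rewrite /g !normrM ler_wpM2r// ler_wpM2l// !ger0_norm ?powR_ge0//.
rewrite -[p - 1]opprB; apply: powR_antitone => //.
  by rewrite subr_ge0 ltW.
by rewrite lerD2r lef_pV2 ?posrE ?ltr0n// ler_nat.
Qed.

Let measurable_W : measurable_fun setT W.
Proof.
apply: measurable_funM; last exact: continuous_measurable.
apply: measurable_funM => //; apply: (measurableT_comp (measurable_powR _)).
exact: continuous_measurable.
Qed.

(* The one-sided bound controls the total variation: [|g n| <= 2 / t - g n], whose
   integral is bounded uniformly in [n]. *)
Lemma power_derivative_locint : locint (fun x => p * w x `^ (p - 1) * wx x).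
Proof.
rewrite -/W => a b; have [ab|ba] := leP a b; last first.
  by rewrite set_itv_ge ?bnd_simp -?ltNge//; exact: integrable_set0.
have mW : measurable_fun `[a, b] (EFin \o W).
  by apply/measurable_EFinP; exact: measurable_funS measurable_W.
apply/integrableP; split => //.
have mg n : measurable_fun `[a, b] (fun x => `|g n x|%:E).
  apply/measurable_EFinP; apply: measurableT_comp => //.
  exact: continuous_measurable (@cg n) _.
have ndg x : `[a, b]%classic x -> {homo (fun n => `|g n x|%:E) : n m / (n <= m)%N >-> (n <= m)%E}.
  by move=> _ n m nm; rewrite lee_fin; exact: g_mono.
have g0 n x : `[a, b]%classic x -> (0 <= `|g n x|%:E)%E by rewrite lee_fin.
have C := @cvg_monotone_convergence _ _ _ mu _ (measurable_itv _) _ mg g0 ndg.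
have gW x : limn (fun n => `|g n x|%:E) = `|W x|%:E.
  apply/cvg_lim => //; apply: cvg_EFin; first exact: nearW.
  exact: (cvg_comp _ _ (@g_cvg x) (@norm_continuous _ _ (W x))).
have {C} : (\int[mu]_(x in `[a, b]) `|g n x|%:E)%E @[n --> \oo] -->
    (\int[mu]_(x in `[a, b]) `|W x|%:E)%E.
  by under [X in _ --> X]eq_integral do rewrite -gW.
(* The integral of [2 / t - g n] is [2 * (b - a) / t + f n a - f n b]; dropping [f n b >= 0] and
   using [e n <= 1] gives [B]. *)
move=> C; pose B := 2 * (b - a) / t + (1 + w a) `^ p.
suff : (\int[mu]_(x in `[a, b]) `|W x|%:E <= B%:E)%E.
  by move/le_lt_trans; apply; rewrite ltry.
apply: (cvge_to_le C); apply: nearW => n.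
have ig : mu.-integrable `[a, b] (EFin \o g n) by exact/continuous_locint/cg.
have ign := integrable_norm_Rfun ig.
have -> : (\int[mu]_(x in `[a, b]) `|g n x|%:E)%E = (\int[mu]_(x in `[a, b]) `|g n x|)%:E.
  by rewrite /Rintegral fineK//; exact: integrable_fin_num.
rewrite lee_fin.
have icst : mu.-integrable `[a, b] (EFin \o (fun _ => 2 * t^-1)).
  by apply: continuous_locint => x; exact: cvg_cst.
apply: (@le_trans _ _ (\int[mu]_(x in `[a, b]) (2 * t^-1 - g n x))).
  apply: le_Rintegral => //; first exact: integrableB_Rfun.
  move=> x _; have := g_le n x; have : 0 < t^-1 by rewrite invr_gt0.
  by rewrite ler_norml => ? ?; apply/andP; split; lra.
rewrite RintegralB// (Rintegral_derive ab (@df n) (@cg n)) Rintegral_cst//=.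
rewrite lebesgue_measure_itv/= lte_fin.
have -> : fine (if a < b then (b%:E - a%:E)%E else 0%E) = b - a.
  by case: ltP => //= ba; apply/eqP; rewrite eq_sym subr_eq0 eq_le ab ba.
have fb : 0 <= f n b by exact: powR_ge0.
have fa : f n a <= (1 + w a) `^ p.
  apply: ge0_ler_powR; rewrite ?nnegrE ?addr_ge0 ?(ltW (e0 n)) ?(ltW p0)//.
  by rewrite lerD2r invf_le1 ?ltr0n// ler1n.
have -> : B = 2 * t^-1 * (b - a) + (1 + w a) `^ p by rewrite /B; ring.
lra.
Qed.

(** Integration by parts is exact for the [C^1] functions [f n]. In the limit, the left side is
    dominated through [f 0], since [e n] decreases, and the right side by [|W * phi|], integrable by
    [power_derivative_locint]. *)
Lemma power_weak_derivative :
  is_weak_derivative (fun x => w x `^ p) (fun x => p * w x `^ (p - 1) * wx x).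
Proof.
have cwp : continuous (fun x => w x `^ p).
  have -> : (fun x => w x `^ p) = (fun x => `|w x| `^ p).
    by apply/funext => x; rewrite ger0_norm.
  move=> x; exact: (continuous_comp (@cw x) (@continuous_abs_powR _ _ p0 _)).
split.
- apply: locint_locally_integrable; last exact: continuous_locint.
  exact: continuous_measurable.
- exact: locint_locally_integrable power_derivative_locint.
move=> phi tphi; have [dphi cdphi] := test_function_der tphi.
have cphi : continuous phi by move=> x; exact: is_derive_continuous (dphi x).
have [M HM] := test_function_support tphi.
pose D := `[- M, M]%classic : set R.
have DM x : ~ D x -> ~ `]- M, M[%classic x.
  by apply: contra_not; exact: subset_itv_oo_cc.
have mD : measurable D by exact: measurable_itv.
have out h : (forall x, ~ `]- M, M[%classic x -> h x = 0) -> \int[mu]_x h x = \int[mu]_(x in D) h x.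
  by move=> h0; apply: Rintegral_zero_outside => x /DM; exact: h0.
rewrite !out; last 2 first.
- by move=> x /HM[-> _]; rewrite mulr0.
- by move=> x /HM[_ ->]; rewrite mulr0.
(* [M] may be negative; then [D] is empty and both sides are 0. *)
have [M0|M0] := ltP M 0.
  have -> : D = set0 by rewrite /D set_itv_ge// bnd_simp -ltNge; lra.
  by rewrite !Rintegral_set0 oppr0.
have phiM : phi M = 0 /\ phi (- M) = 0.
  by split; apply HM; rewrite /= in_itv/= ?ltxx ?andbF.
have E n : \int[mu]_(x in D) (f n x * derive1 phi x) = - \int[mu]_(x in D) (g n x * phi x).
  have cF : continuous (fun x => g n x * phi x + f n x * derive1 phi x).
    by move=> x; apply: cvgD; apply: cvgM; [exact: cg|exact: cphi|exact: cf|exact: cdphi].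
  have dF x : is_derive x 1 (fun x => f n x * phi x) (g n x * phi x + f n x * derive1 phi x).
    exact: (derM (df n x) (dphi x)).
  have MM : - M <= M by lra.
  have := Rintegral_derive MM dF cF; rewrite phiM.1 phiM.2 !mulr0 subrr.
  rewrite RintegralD//; last 2 first.
  - by apply: continuous_locint => x; apply: cvgM; [exact: cg|exact: cphi].
  - by apply: continuous_locint => x; apply: cvgM; [exact: cf|exact: cdphi].
  by rewrite addrC => /eqP; rewrite addr_eq0 => /eqP.
have L1 : \int[mu]_(x in D) (f n x * derive1 phi x) @[n --> \oo] -->
    \int[mu]_(x in D) (w x `^ p * derive1 phi x).
  apply: (@Rdominated_cvg _ _ _ _ (fun x => f 0 x * `|derive1 phi x|)) => //.
  - by move=> n; apply: measurable_funM; apply: continuous_measurable => //; exact: cf.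
  - by apply: measurable_funM; apply: continuous_measurable.
  - by move=> x _; apply: cvgM; [exact: f_cvg|exact: cvg_cst].
  - apply: continuous_locint => x; apply: cvgM; first exact: cf.
    exact: (continuous_comp (cdphi x) (@norm_continuous _ _ _)).
  - move=> n x _; rewrite normrM ler_wpM2r// ger0_norm ?powR_ge0//.
    apply: ge0_ler_powR; rewrite ?nnegrE ?addr_ge0 ?(ltW (e0 _)) ?(ltW p0)//.
    by rewrite lerD2r lef_pV2 ?posrE ?ltr0n// ler_nat.
have [B HB] : exists B, forall x, D x -> `|phi x| <= B.
  have K := continuous_compact (continuous_subspaceT cphi) (@segment_compact R (- M) M).
  have [B [_ /(_ (B + 1))]] := compact_bounded K.
  rewrite ltrDl ltr01 => /(_ isT) H; exists (B + 1) => x Dx; apply: H.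
  by exists x.
have L2 : \int[mu]_(x in D) (g n x * phi x) @[n --> \oo] -->
    \int[mu]_(x in D) (W x * phi x).
  have iWp : mu.-integrable D (EFin \o (fun x => W x * phi x)).
    apply: (@integrableM_bounded _ _ _ _ B) => //; first exact: power_derivative_locint.
    exact: continuous_measurable.
  apply: (@Rdominated_cvg _ _ _ _ (fun x => `|W x * phi x|)) => //.
  - by move=> n; apply: measurable_funM; apply: continuous_measurable => //; exact: cg.
  - apply: measurable_funM; last exact: continuous_measurable.
    exact: measurable_funS measurable_W.
  - by move=> x _; apply: cvgM; [exact: g_cvg|exact: cvg_cst].
  - exact: integrable_norm_Rfun.
  - by move=> n x _; rewrite [leLHS]normrM [leRHS]normrM; apply: ler_wpM2r => //; exact: g_norm.
apply: cvg_unique L1 _ => //.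
have -> : (fun n => \int[mu]_(x in D) (f n x * derive1 phi x)) =
    (fun n => - \int[mu]_(x in D) (g n x * phi x)) by apply/funext => n; exact: E.
exact: cvgN L2.
Qed.

End power_weak_derivative.

(** * Transfer to the solution and conclusion *)

Section transfer.
Context {R : realType}.
Notation mu := (@lebesgue_measure R).
Implicit Types (f g : R -> R).

Lemma is_weak_derivative_ae f f0 g : measurable_fun setT f ->
  {ae mu, forall x, f x = f0 x} -> is_weak_derivative f0 g -> is_weak_derivative f g.
Proof.
move=> mf ff0 [lf0 lg fg]; split => //.
  have [mf0 _ _] := lf0; apply: locint_locally_integrable => // a b.
  have /integrableP[m0 i0] := locally_integrable_locint lf0 a b.
  have mab : measurable_fun `[a, b] (EFin \o f).
    by apply/measurable_EFinP; exact: measurable_funS mf.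
  apply/integrableP; split => //; apply: le_lt_trans i0.
  rewrite le_eqVlt; apply/orP; left; apply/eqP; apply: ae_eq_integral => //.
  - exact: measurableT_comp.
  - exact: measurableT_comp.
  - by apply: ae_imply ff0 => x /= ->.
move=> phi tphi; have [_ cdphi] := test_function_der tphi.
rewrite -fg//; apply: ae_Rintegral_eq => //.
- by apply: measurable_funM => //; exact: continuous_measurable.
- by have [mf0 _ _] := lf0; apply: measurable_funM => //; exact: continuous_measurable.
- by apply: ae_imply ff0 => x ->.
Qed.

End transfer.

Unset Implicit Arguments.

Theorem theorem3p3 (R : realType) (q alpha mu : R) (J phi : R -> R)
    (u : R -> R -> R) :
  1 < q -> q < 2 -> 0 < alpha -> 0 < mu ->
  J \in Lfun (@lebesgue_measure R) 1%:E ->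
  {ae @lebesgue_measure R, forall x, 0 <= J x} ->
  {ae @lebesgue_measure R, forall x, J (- x) = J x} ->
  \int[@lebesgue_measure R]_x J x = 1 ->
  phi \in Lfun (@lebesgue_measure R) 1%:E ->
  {ae @lebesgue_measure R, forall x, 0 <= phi x} ->
  is_solution q alpha mu J phi u ->
  forall t : R, 0 < t ->
    exists2 w : R -> R,
      is_weak_derivative (fun x => u t x `^ (q - 1)) w &
      {ae @lebesgue_measure R, forall x, w x <= 1 / t}.
Proof.
move=> q1 q2 alpha0 mu0 /Lfun1_integrable iJ J0 _ J1 _ phi0 sol t t0.
have [w [wx [rf uw]]] := solution_regular_flow q1 iJ sol.
have [cu u0 _] := sol.
have I0 : (`[0, +oo[%classic : set R) 0 by rewrite /= in_itv/= lexx.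
have iu0 := continuous_Lp1_integrable cu I0.
(* Nonnegativity of the initial datum enters as monotonicity of its distribution function. *)
have Pnd0 (a b : R) : a <= b -> cumul (u 0) a <= cumul (u 0) b.
  move=> ab; rewrite -subr_ge0 cumulB//.
  have mu0' : measurable_fun setT (u 0).
    by apply/measurable_EFinP; exact: measurable_int iu0.
  rewrite (@ae_Rintegral_eq _ _ _ (fun x => `|u 0 x|))//.
  - exact: Rintegral_norm_ge0.
  - exact: measurable_funS mu0'.
  - by apply: measurableT_comp => //; exact: measurable_funS mu0'.
  - by apply: ae_imply2 u0 phi0 => x -> ?; rewrite ger0_norm.
have Pnd (s a b : R) : 0 <= s -> a <= b -> cumul (u s) a <= cumul (u s) b.
  by apply: (rf_nondecreasing rf) => //; exact: ltW.
have p0 : 0 < q - 1 by rewrite subr_gt0.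
have p1 : q - 1 < 1 by rewrite ltrBlDr.
have dw (x : R) : is_derive x 1 (w t) (wx t x) := rf_dw rf x t0.
have w0 (x : R) : 0 <= w t x := rf_w_ge0 rf Pnd x t0.
have osl (eps y x : R) : 0 < eps -> y <= x ->
    t * ((eps + w t x) `^ (q - 1) - (eps + w t y) `^ (q - 1)) <= x - y.
  by move=> eps0; apply: (oleinik_profile rf) => //; exact: ltW.
(* The bound holds at every point for the [C^1] representative; only its identification with [u t]
   is almost everywhere. *)
exists (fun x => (q - 1) * w t x `^ (q - 1 - 1) * wx t x); last first.
  by apply: aeW => x; rewrite div1r; exact: power_derivative_le t0 dw w0 osl x.
apply: (is_weak_derivative_ae _ _ (power_weak_derivative p0 p1 t0 dw (rf_cwx rf t0) w0 osl)).
- apply: (measurableT_comp (measurable_powR _)).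
  have It : (`[0, +oo[%classic : set R) t by rewrite /= in_itv/= ltW.
  by apply/measurable_EFinP; exact: measurable_int (continuous_Lp1_integrable cu It).
- by apply: ae_imply (uw t t0) => x ->.
Qed.
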